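(* The sequences $$\tilde r_n=a_n\zeta(2)-\tilde b_n,\qquad \tilde{\tilde r}_n=a_n\zeta(3)-\tilde{\tilde b}_n,\qquad n=0,1,\dots,$$ as well as the coefficients $a_n$, $\tilde b_n$ and $\tilde{\tilde b}_n$, satisfy the recurrence relation (displayed for $a_n$; the same relation holds with $(a_n)$ replaced by each of $(\tilde b_n)$, $(\tilde{\tilde b}_n)$, $(\tilde r_n)$, $(\tilde{\tilde r}_n)$) $$\begin{aligned}&2(946n^2-731n+153)(2n+1)(n+1)^3a_{n+1}\\&\quad-2(104060n^6+127710n^5+12788n^4-34525n^3-8482n^2+3298n+1071)a_n\\&\quad+2(3784n^5-1032n^4-1925n^3+853n^2+328n-184)n\,a_{n-1}\\&\quad-(946n^2+1161n+368)n(n-1)^3a_{n-2}=0,\qquad n=2,3,\dots,\end{aligned}$$ of order $3$, and the necessary initial data is as follows: $$a_0=1,\quad a_1=7,\quad a_2=163,$$ $$\tilde b_0=0,\quad \tilde b_1=\frac{23}2,\quad \tilde b_2=\frac{2145}8,\qquad \tilde{\tilde b}_0=0,\quad \tilde{\tilde b}_1=\frac{17}2,\quad \tilde{\tilde b}_2=\frac{3135}{16}.$$ In addition, $$\limsup_{n\to\infty}|\tilde r_n|^{1/n}=\limsup_{n\to\infty}|\tilde{\tilde r}_n|^{1/n}=|\lambda_{1,2}|=0.067442248\dots,$$ $$\lim_{n\to\infty}|a_n|^{1/n}=\lim_{n\to\infty}|\tilde b_n|^{1/n}=\lim_{n\to\infty}|\tilde{\tilde b}_n|^{1/n}=\lambda_3=54.96369509\dots,$$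 where $\lambda_{1,2}=0.018152450\ldots\pm i\,0.064953409\dots$ (a complex conjugate pair) and $\lambda_3$ are the zeros of the characteristic polynomial $4\lambda^3-220\lambda^2+8\lambda-1$.
   Context: For $n=0,1,2,\dots$ let $$R_n(t)=\frac{((t-1)(t-2)\cdots(t-n))^3}{n!^2\cdot t(t+1)\cdots(t+n)}.$$ For $0<|z|<1$ put $$r_n(z)=\sum_{\nu=1}^\infty z^\nu R_n(\nu),\qquad \tilde r_n(z)=-\sum_{\nu=1}^\infty z^\nu R_n'(\nu),\qquad \tilde{\tilde r}_n(z)=\frac12\sum_{\nu=1}^\infty z^\nu R_n''(\nu),$$ where primes denote $d/dt$. At $z=1$ these series need not converge; the quantities $\tilde r_n=\tilde r_n(1)$ and $\tilde{\tilde r}_n=\tilde{\tilde r}_n(1)$ are understood as the following limits over real $z\in(0,1)$ (which exist): $$\tilde r_n=\lim_{z\to1^-}\bigl(\tilde r_n(z)-r_n(z)\log z\bigr),\qquad \tilde{\tilde r}_n=\lim_{z\to1^-}\Bigl(\tilde{\tilde r}_n(z)-\tilde r_n(z)\log z+\tfrac12 r_n(z)\log^2z\Bigr).$$ Here $$a_n=(-1)^n\sum_{k=0}^n(-1)^k\binom nk\binom{n+k}k^3,$$ and $\tilde b_n$, $\tilde{\tilde b}_n$ are then determined by $\tilde b_n=a_n\zeta(2)-\tilde r_n$, $\tilde{\tilde b}_n=a_n\zeta(3)-\tilde{\tilde r}_n$, where $\zeta$ is the Riemann zeta function. Decimals followed by dots denote truncated numerical values. *)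

(* Defs.v *)
From HB Require Import structures.
From mathcomp Require Import all_boot all_order all_algebra.
From mathcomp Require Import all_classical all_reals all_analysis.
From mathcomp Require Import complex.

Set Implicit Arguments.
Unset Strict Implicit.
Unset Printing Implicit Defensive.

Import Order.TTheory GRing.Theory Num.Theory.
Import numFieldNormedType.Exports.

Local Open Scope classical_set_scope.
Local Open Scope ring_scope.

Definition Rn (R : realType) (n : nat) (t : R) : R :=
  (\prod_(1 <= j < n.+1) (t - j%:R)) ^+ 3 /
    (n`!%:R ^+ 2 * \prod_(0 <= j < n.+1) (t + j%:R)).

(* u 0 does not contribute. *)
Definition sum_pos (R : realType) (u : nat -> R) : R :=
  limn (series (fun k : nat => u k.+1)).

Definition r_fun (R : realType) (n : nat) (z : R) : R :=
  sum_pos (fun nu => z ^+ nu * Rn n nu%:R).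

Definition rt_fun (R : realType) (n : nat) (z : R) : R :=
  - sum_pos (fun nu => z ^+ nu * derive1 (Rn n) nu%:R).

Definition rtt_fun (R : realType) (n : nat) (z : R) : R :=
  2^-1 * sum_pos (fun nu => z ^+ nu * derive1n 2 (Rn n) nu%:R).

(* The series at z = 1 may diverge: rt and rtt are left limits at 1 of these
   combinations. *)
Definition rt_reg (R : realType) (n : nat) (z : R) : R :=
  rt_fun n z - r_fun n z * ln z.

Definition rtt_reg (R : realType) (n : nat) (z : R) : R :=
  rtt_fun n z - rt_fun n z * ln z + 2^-1 * r_fun n z * ln z ^+ 2.

Definition rt (R : realType) (n : nat) : R := lim (rt_reg n z @[z --> (1 : R)^'-]).

Definition rtt (R : realType) (n : nat) : R := lim (rtt_reg n z @[z --> (1 : R)^'-]).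

Definition zeta (R : realType) (s : nat) : R :=
  sum_pos (fun k => (k%:R ^+ s)^-1).

Definition a (R : realType) (n : nat) : R :=
  (-1) ^+ n * \sum_(0 <= k < n.+1) (-1) ^+ k * 'C(n, k)%:R * 'C(n + k, k)%:R ^+ 3.

Definition bt (R : realType) (n : nat) : R := a R n * zeta R 2 - rt R n.

Definition btt (R : realType) (n : nat) : R := a R n * zeta R 3 - rtt R n.

(* rec_coef`_j, a polynomial in n, is the coefficient of u_{n-2+j}.  Large
   integers are split at the thousands, because numerals are unary. *)
Definition rec_coef (R : realType) : seq {poly R} :=
  [:: - ((946 *: 'X^2 + 1161 *: 'X + 368%:P) * 'X * ('X - 1) ^+ 3);
      2 *: (3784 *: 'X^5 - 1032 *: 'X^4 - 1925 *: 'X^3 + 853 *: 'X^2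
            + 328 *: 'X - 184%:P) * 'X;
      - (2 *: ((104 * 1000 + 60) *: 'X^6 + (127 * 1000 + 710) *: 'X^5
               + (12 * 1000 + 788) *: 'X^4 - (34 * 1000 + 525) *: 'X^3
               - (8 * 1000 + 482) *: 'X^2 + 3298 *: 'X + 1071%:P));
      2 *: (946 *: 'X^2 - 731 *: 'X + 153%:P) * (2 *: 'X + 1) * ('X + 1) ^+ 3].

Definition rec_at (R : realType) (j n : nat) : R :=
  ((rec_coef R)`_j).[n%:R].

Definition satisfies_rec (R : realType) (u : nat -> R) : Prop :=
  forall n : nat, (2 <= n)%N ->
    rec_at R 3 n * u n.+1 + rec_at R 2 n * u n
    + rec_at R 1 n * u n.-1 + rec_at R 0 n * u n.-2 = 0.

(* Characteristic polynomial of the recurrence with coefficients c: with d the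
   largest degree of the c`_j, the coefficient of 'X^j is that of n^d in c`_j.
   It is determined up to a nonzero scalar. *)
Definition rec_charpoly (R : realType) (c : seq {poly R}) : {poly R} :=
  let d := (\max_(j < size c) size (nth 0%R c j)).-1 in
  \poly_(j < size c) ((nth 0 c j)`_d).

Definition chi (R : realType) : {poly R} :=
  4 *: 'X^3 - 220 *: 'X^2 + 8 *: 'X - 1.

(* x = N.d1 d2 d3 ... as a truncated decimal expansion, ds = [:: d1; d2; ...] *)
Definition has_decimals (R : realType) (x : R) (N : nat) (ds : seq nat) : Prop :=
  let v := N%:R + \sum_(i < size ds) (nth 0%N ds i)%:R / 10 ^+ i.+1 in
  v <= x < v + (10 ^+ size ds)^-1.

(* Main.v *)
Require Import Defs.
From HB Require Import structures.
From mathcomp Require Import all_boot all_order all_algebra.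
From mathcomp Require Import all_classical all_reals all_analysis.
From mathcomp Require Import complex.
From mathcomp Require Import ring lra.

(** The proof rests on a pair of linear functionals.  For a function F that is
smooth on t > 0, form the two combinations that define the two sequences of
linear forms, with F in place of R_n, and let z tend to 1 from the left;
[regular F l1 l2] says that the limits exist and are l1 and l2.  Both limits are
linear in F, and they are known for three kinds of functions.

- For a simple pole 1 / (t + k) they are the tails of zeta(2) and zeta(3)
  beyond k ([regular_pole]).
- For the binomial polynomial C(t - 1, m), put u = 1/z - 1 and l = ln (1 + u),
  which is the negative of ln z, and let p and q be the Taylor polynomials of
  degree m of l and l^2 / 2 in u.  By summation by parts, u^(m+1) times the two
  combinations are l - p and l^2 / 2 + q - l p; hence the limits are, up to sign,
  the Taylor coefficients of degree m + 1 of l and l^2 / 2 ([regular_binpoly]).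
- For a difference S(t + 1) - S(t) they only involve the first two derivatives
  of S at t = 1 ([regular_shift]).

Existence and initial data: R_n is a polynomial plus simple poles, and for
n = 0, 1, 2 this decomposition is short enough to be written down.

Recurrence: there is a rational function S_n(t), with the polynomial [cert] in its
numerator, such that the recurrence operator maps R_n(t) to S_n(t + 1) - S_n(t)
([Rn_recurrence]).  Since S_n vanishes to the third order at t = 1, both
functionals kill this difference.  The same polynomial identity [certP], read at
t = - k, makes the sum that defines a_n telescope ([a_recurrence]), and the two
remaining sequences are linear combinations of those already treated.

Size of the linear forms: expand R_n in the functions C(t - 1, m) / (t + k), using
partial fractions and the linearization of C(t - 1, n)^2.  The functionals take
values of absolute value at most 4 on these, uniformly in m and k
([binpoly_pole_bound]), and both expansions have central Delannoy numbers as sums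
of absolute coefficients; hence the bound 4 * 40^n ([rt_bound]).

Asymptotics: the recurrence is of Poincare type.  Its characteristic polynomial
has a dominant real zero L and a conjugate pair of zeros of smaller modulus.  In
coordinates adapted to this splitting, a nonzero solution either has
|u_n|^(1/n) tending to L, or it is governed by the pair and the limsup of
|u_n|^(1/n) is the modulus of the pair ([poincare_dichotomy]).  The linear forms
belong to the second case because 40 < L.  The a_n are integers, no three
consecutive ones of which are all zero, so they do not tend to 0 and belong to
the first case.  The rational parts a_n zeta(s) - r_n belong to the first case too,
since otherwise a_n would tend to 0. *)

Set Implicit Arguments.
Unset Strict Implicit.
Unset Printing Implicit Defensive.

Import Order.TTheory GRing.Theory Num.Theory.
Import numFieldNormedType.Exports.
Import ComplexField.Normc.
Local Open Scope classical_set_scope.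
Local Open Scope ring_scope.

(** * Sums over the positive integers *)

Section PositiveSums.
Context {R : realType}.
Implicit Types u v : nat -> R.

(** A type of its own, so that unification does not unfold the convergence of a
series. *)
Variant summable u : Prop := Summable of cvgn (series (fun k => u k.+1)).

Lemma eq_sum_pos u v : (forall k, (0 < k)%N -> u k = v k) ->
  sum_pos u = sum_pos v.
Proof. by move=> uv; rewrite /sum_pos; congr (limn (series _)); apply/funext => k; exact: uv. Qed.

Lemma eq_summable u v : (forall k, (0 < k)%N -> u k = v k) ->
  summable u -> summable v.
Proof.
move=> uv [su]; constructor; rewrite (_ : (fun k => v k.+1) = fun k => u k.+1)//.
by apply/funext => k; rewrite uv.
Qed.

Lemma sum_pos_cvg u : summable u -> series (fun k => u k.+1) @ \oo --> sum_pos u.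
Proof. by case. Qed.

Lemma summableD u v : summable u -> summable v -> summable (fun k => u k + v k).
Proof. by move=> [su] [sv]; constructor; exact: is_cvg_seriesD su sv. Qed.

Lemma sum_posD u v : summable u -> summable v ->
  sum_pos (fun k => u k + v k) = sum_pos u + sum_pos v.
Proof. by move=> [su] [sv]; exact: lim_seriesD su sv. Qed.

Lemma summableZ c u : summable u -> summable (fun k => c * u k).
Proof. by move=> [su]; constructor; exact: is_cvg_seriesZ su. Qed.

Lemma sum_posZ c u : summable u -> sum_pos (fun k => c * u k) = c * sum_pos u.
Proof. by move=> [su]; exact: lim_seriesZ su. Qed.

Lemma series_shift u : series (fun k => u k.+2) =
  (fun n => series (fun k => u k.+1) n.+1 - u 1%N).
Proof.
apply/funext => n; rewrite /series/= big_nat_recl//=.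
by rewrite addrAC subrr add0r.
Qed.

Lemma summable_shift u : summable u -> summable (fun k => u k.+1).
Proof.
move=> su; constructor; rewrite series_shift.
apply: is_cvgB; last exact: is_cvg_cst.
apply/cvg_ex; exists (sum_pos u); rewrite (cvg_shiftS (series _)).
exact: sum_pos_cvg.
Qed.

Lemma sum_pos_shift u : summable u ->
  sum_pos (fun k => u k.+1) = sum_pos u - u 1%N.
Proof.
move=> su; rewrite {1}/sum_pos series_shift; apply/cvg_lim => //.
apply: cvgB; last exact: cvg_cst.
by rewrite (cvg_shiftS (series _)); exact: sum_pos_cvg.
Qed.

Lemma le_summable u v : (forall k, (0 < k)%N -> 0 <= u k <= v k) ->
  summable v -> summable u.
Proof.
move=> uv [sv]; constructor; apply: series_le_cvg sv => k.
- by have /andP[] := uv k.+1 isT.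
- by have /andP[/le_trans] := uv k.+1 isT; apply.
- by have /andP[] := uv k.+1 isT.
Qed.

Lemma le_sum_pos u v : (forall k, (0 < k)%N -> u k <= v k) ->
  summable u -> summable v -> sum_pos u <= sum_pos v.
Proof. by move=> uv [su] [sv]; apply: lim_series_le => // k; exact: uv. Qed.

Lemma sum_pos_ge u n : (forall k, (0 < k)%N -> 0 <= u k) -> summable u ->
  series (fun k => u k.+1) n <= sum_pos u.
Proof.
move=> u0 [su]; apply: nondecreasing_cvgn_le => //.
by apply: nondecreasing_series => k _ _; exact: u0.
Qed.

Lemma sum_pos_ge0 u : (forall k, (0 < k)%N -> 0 <= u k) -> summable u -> 0 <= sum_pos u.
Proof. by move=> u0 su; have := sum_pos_ge 0 u0 su; rewrite /series/= big_geq. Qed.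

Lemma bounded_summable u M : (forall k, (0 < k)%N -> 0 <= u k) ->
  (forall n, series (fun k => u k.+1) n <= M) -> summable u /\ sum_pos u <= M.
Proof.
move=> u0 uM; have su : summable u.
  constructor; apply: nondecreasing_is_cvgn.
    by apply: nondecreasing_series => k _ _; exact: u0.
  by exists M => _ [n _ <-].
by split=> //; case: su => su; apply: limr_le => //; exact: nearW.
Qed.

Lemma sum_pos_telescope u (l : R) : u @ \oo --> l ->
  let d := fun k => u k.+1 - u k in summable d /\ sum_pos d = l - u 1%N.
Proof.
move=> ul d; suff H : series (fun k => d k.+1) @ \oo --> l - u 1%N.
  by split; [constructor; apply/cvg_ex; exists (l - u 1%N) | exact/cvg_lim].
rewrite (_ : series _ = fun n => u n.+1 - u 1%N).
  by apply: cvgB; [rewrite cvg_shiftS | exact: cvg_cst].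
apply/funext => n; rewrite /series/= /d big_mkord.
rewrite -(big_mkord xpredT (fun k => u k.+2 - u k.+1)).
by rewrite (@telescope_sumr _ 0%N n (fun k => u k.+1)).
Qed.

Lemma partial_series_cvg u N :
  series (fun k => z ^+ k.+1 * u k.+1) N @[z --> (1 : R)^'-] -->
  series (fun k => u k.+1) N.
Proof.
apply: cvg_at_left_filter; rewrite /series/=; elim: N => [|N IH].
  by under eq_fun do rewrite big_geq//; rewrite big_geq//; exact: cvg_cst.
under eq_fun do rewrite big_nat_recr//=.
rewrite big_nat_recr//=; apply: cvgD => //.
rewrite -[X in _ --> X]mul1r -[X in X * _](expr1n _ N.+1).
by apply: cvgM; [exact: exprn_continuous | exact: cvg_cst].
Qed.

(** Abel's theorem, easy for nonnegative terms: the sum at z lies between a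
truncation at z, which tends to the truncation at 1, and the sum at 1. *)
Lemma abel_limit u : (forall k, (0 < k)%N -> 0 <= u k) -> summable u ->
  (forall z : R, 0 < z < 1 -> summable (fun k => z ^+ k * u k)) /\
  sum_pos (fun k => z ^+ k * u k) @[z --> (1 : R)^'-] --> sum_pos u.
Proof.
move=> u0 su.
have zu (z : R) : 0 < z < 1 -> forall k, (0 < k)%N -> 0 <= z ^+ k * u k <= u k.
  move=> /andP[z0 z1] k k0; rewrite mulr_ge0 ?exprn_ge0 ?(ltW z0) ?u0//=.
  by rewrite ler_piMl ?u0// exprn_ile1 ?ltW.
have szu (z : R) : 0 < z < 1 -> summable (fun k => z ^+ k * u k).
  by move=> z01; exact: le_summable (zu _ z01) su.
split=> //.
apply/cvgrPdist_lt => e e0.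
have e20 : 0 < e / 2 by rewrite divr_gt0.
have [N _ HN] := (proj1 (cvgrPdist_lt _ _) (sum_pos_cvg su)) _ e20.
have {HN} := HN N (leqnn N); rewrite ger0_norm ?subr_ge0 ?sum_pos_ge// => HN.
have pc := @partial_series_cvg u N.
near=> z.
have z01 : 0 < z < 1.
  by apply/andP; split; near: z; [exact: nbhs_left_gt | exact: nbhs_left_lt].
have : `|series (fun k => u k.+1) N - series (fun k => z ^+ k.+1 * u k.+1) N| < e / 2.
  by near: z; exact: (proj1 (cvgrPdist_lt _ _) pc) _ e20.
have lo : series (fun k => z ^+ k.+1 * u k.+1) N <= sum_pos (fun k => z ^+ k * u k).
  apply: (sum_pos_ge (u := fun k => z ^+ k * u k)) (szu _ z01).
  by move=> k k0; have /andP[] := zu _ z01 k k0.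
have up : sum_pos (fun k => z ^+ k * u k) <= sum_pos u.
  by apply: le_sum_pos (szu _ z01) su => k k0; have /andP[] := zu _ z01 k k0.
move=> /ltr_normlW H; rewrite ger0_norm ?subr_ge0//.
by lra.
Unshelve. all: by end_near. Qed.

End PositiveSums.

(** * Limits of the logarithmic combinations at 1 *)

Section Regular.
Context {R : realType}.
Implicit Types (f g F G : R -> R) (z l t : R).

Definition power_sum f z : R := sum_pos (fun nu => z ^+ nu * f nu%:R).

Definition power_summable f := forall z, 0 < z < 1 -> summable (fun nu => z ^+ nu * f nu%:R).

(** For [f := Rn n] and its derivatives [f1], [f2], [log_comb1] and [log_comb2] are
the functions whose left limits at 1 are [rt] and [rtt].  The derivatives are
arguments because only their values on t > 0 matter. *)
Definition log_comb1 f f1 z := - power_sum f1 z - power_sum f z * ln z.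

Definition log_comb2 f f1 f2 z :=
  2^-1 * power_sum f2 z - - power_sum f1 z * ln z + 2^-1 * power_sum f z * ln z ^+ 2.

Record regular_jet f f1 f2 l1 l2 : Prop := RegularJet {
  jet_is_derive1 : forall t : R, 0 < t -> is_derive t 1 f (f1 t);
  jet_is_derive2 : forall t : R, 0 < t -> is_derive t 1 f1 (f2 t);
  jet_summable : [/\ power_summable f, power_summable f1 & power_summable f2];
  jet_log_comb1 : log_comb1 f f1 z @[z --> (1 : R)^'-] --> l1;
  jet_log_comb2 : log_comb2 f f1 f2 z @[z --> (1 : R)^'-] --> l2 }.

(** The two functionals, as a relation: it includes their existence, and it does
not depend on the values of [F] outside t > 0. *)
Definition regular F l1 l2 := exists F1 F2, regular_jet F F1 F2 l1 l2.

Lemma eq_cvg_left1 (f g : R -> R) l : (forall z, 0 < z < 1 -> f z = g z) ->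
  g z @[z --> (1 : R)^'-] --> l -> f z @[z --> (1 : R)^'-] --> l.
Proof.
move=> fg; apply: cvg_trans; apply: near_eq_cvg; near=> z; apply/esym/fg.
by apply/andP; split; near: z; [exact: nbhs_left_gt | exact: nbhs_left_lt].
Unshelve. all: by end_near. Qed.

Lemma cvg_ln_left1 : ln z @[z --> (1 : R)^'-] --> (0 : R).
Proof.
apply: cvg_at_left_filter; rewrite -(ln1 R).
exact: (@continuous_ln R 1).
Qed.

Lemma cvg_invB1_left1 : z^-1 - 1 @[z --> (1 : R)^'-] --> (0 : R).
Proof.
apply: cvg_at_left_filter; rewrite -[X in _ --> X](subrr 1) -[X in _ --> X - _]invr1.
apply: cvgB; last exact: cvg_cst.
by apply: cvgV; [rewrite oner_eq0 | exact: cvg_id].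
Qed.

Lemma eq_power_sum f g z : (forall t : R, 0 < t -> f t = g t) -> power_sum f z = power_sum g z.
Proof. by move=> fg; apply: eq_sum_pos => k k0; rewrite fg// ltr0n. Qed.

Lemma eq_power_summable f g : (forall t : R, 0 < t -> f t = g t) ->
  power_summable f -> power_summable g.
Proof.
move=> fg sf z z01; apply: eq_summable (sf _ z01) => k k0.
by rewrite fg// ltr0n.
Qed.

Lemma power_summableD f g : power_summable f -> power_summable g -> power_summable (f \+ g).
Proof.
move=> sf sg z z01.
by apply: eq_summable (summableD (sf _ z01) (sg _ z01)) => k k0; rewrite -mulrDr.
Qed.

Lemma power_sumD f g z : 0 < z < 1 -> power_summable f -> power_summable g ->
  power_sum (f \+ g) z = power_sum f z + power_sum g z.
Proof.
move=> z01 sf sg; rewrite -sum_posD; [|exact: sf|exact: sg].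
by apply: eq_sum_pos => k k0; rewrite -mulrDr.
Qed.

Lemma power_summableZ c f : power_summable f -> power_summable (fun t => c * f t).
Proof.
move=> sf z z01.
have H := @summableZ _ c _ (sf _ z01).
by apply: eq_summable H => k k0; rewrite mulrCA.
Qed.

Lemma power_sumZ c f z : 0 < z < 1 -> power_summable f ->
  power_sum (fun t => c * f t) z = c * power_sum f z.
Proof.
move=> z01 sf; rewrite -sum_posZ; last exact: sf.
by apply: eq_sum_pos => k k0; rewrite mulrCA.
Qed.

Lemma power_summable_shift f : power_summable f -> power_summable (fun t => f (t + 1)).
Proof.
move=> sf z z01; have z0 : z != 0 by case/andP: z01 => /gt_eqF ->.
have H := @summableZ _ z^-1 _ (summable_shift (sf _ z01)).
apply: eq_summable H => k k0.
by rewrite exprS -natr1 -!mulrA mulKf.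
Qed.

Lemma power_sum_shift f z : 0 < z < 1 -> power_summable f ->
  power_sum (fun t => f (t + 1)) z = z^-1 * power_sum f z - f 1.
Proof.
move=> z01 sf; have z0 : z != 0 by case/andP: z01 => /gt_eqF ->.
transitivity (z^-1 * (power_sum f z - z * f 1)); last by rewrite mulrBr mulKf.
rewrite -[z in z * f 1]expr1 -[in f 1](mulr1n 1) -(sum_pos_shift (sf _ z01)).
rewrite -sum_posZ; last exact: (summable_shift (sf _ z01)).
by apply: eq_sum_pos => k k0; rewrite exprS -natr1 -!mulrA mulKf.
Qed.

Lemma regular_eq F G l1 l2 : (forall t : R, 0 < t -> F t = G t) ->
  regular F l1 l2 -> regular G l1 l2.
Proof.
move=> FG [F1 [F2 [d1 d2 [s0 s1 s2] c1 c2]]]; exists F1, F2; split=> //.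
- move=> t t0; apply: near_eq_is_derive (d1 _ t0) => //; near=> x.
  by apply: FG; near: x; exact: lt_nbhsr.
- by split=> //; exact: eq_power_summable s0.
- by apply: eq_cvg_left1 c1 => z z01; rewrite /log_comb1 (@eq_power_sum G F)// => t /FG.
- by apply: eq_cvg_left1 c2 => z z01; rewrite /log_comb2 (@eq_power_sum G F)// => t /FG.
Unshelve. all: by end_near. Qed.

Lemma regularD F G l1 l2 m1 m2 : regular F l1 l2 -> regular G m1 m2 ->
  regular (F \+ G) (l1 + m1) (l2 + m2).
Proof.
move=> [F1 [F2 [d1 d2 [s0 s1 s2] c1 c2]]] [G1 [G2 [e1 e2 [r0 r1 r2] b1 b2]]].
exists (F1 \+ G1), (F2 \+ G2); split.
- by move=> t t0; apply: is_deriveD; [exact: d1 | exact: e1].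
- by move=> t t0; apply: is_deriveD; [exact: d2 | exact: e2].
- by split; exact: power_summableD.
- apply: eq_cvg_left1 (cvgD c1 b1) => z z01.
  by rewrite /log_comb1 !power_sumD//; ring.
- apply: eq_cvg_left1 (cvgD c2 b2) => z z01.
  by rewrite /log_comb2 !power_sumD//; ring.
Qed.

Lemma regularZ c F l1 l2 : regular F l1 l2 ->
  regular (fun t => c * F t) (c * l1) (c * l2).
Proof.
move=> [F1 [F2 [d1 d2 [s0 s1 s2] c1 c2]]].
exists (fun t => c * F1 t), (fun t => c * F2 t); split.
- by move=> t t0; apply: is_deriveZ; exact: d1.
- by move=> t t0; apply: is_deriveZ; exact: d2.
- by split; exact: power_summableZ.
- apply: eq_cvg_left1 (cvgM (cvg_cst c) c1) => z z01.
  by rewrite /log_comb1 !power_sumZ//; ring.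
- apply: eq_cvg_left1 (cvgM (cvg_cst c) c2) => z z01.
  by rewrite /log_comb2 !power_sumZ//; ring.
Qed.

Lemma regular_derive1 f f1 f2 l1 l2 : regular_jet f f1 f2 l1 l2 ->
  forall t, 0 < t -> f^`()%classic t = f1 t /\ derive1n 2 f t = f2 t.
Proof.
move=> [d1 d2 _ _ _] t t0.
have D1 s : 0 < s -> f^`()%classic s = f1 s.
  by move=> s0; rewrite derive1E; have [_ ->] := d1 _ s0.
split; first exact: D1.
rewrite /derive1n/= derive1E.
rewrite (@near_eq_derive _ _ _ _ f1); last first.
  by near=> x; apply: D1; near: x; exact: lt_nbhsr.
by have [_ ->] := d2 _ t0.
Unshelve. all: by end_near. Qed.

Lemma regular_rt n l1 l2 : regular (Rn n) l1 l2 ->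
  rt_reg n z @[z --> (1 : R)^'-] --> l1 /\ rtt_reg n z @[z --> (1 : R)^'-] --> l2.
Proof.
move=> [F1 [F2 J]]; have E := regular_derive1 J; case: J => d1 d2 s c1 c2.
split; [apply: eq_cvg_left1 c1 | apply: eq_cvg_left1 c2] => z z01.
- rewrite /log_comb1 -(@eq_power_sum (Rn n)^`()%classic F1)// => t t0.
  by have [] := E _ t0.
- rewrite /log_comb2 -(@eq_power_sum (Rn n)^`()%classic F1); last first.
    by move=> t t0; have [] := E _ t0.
  by rewrite -(@eq_power_sum (derive1n 2 (Rn n)) F2)// => t t0; have [] := E _ t0.
Qed.

Lemma log_comb_shift f f1 f2 z :
  [/\ power_summable f, power_summable f1 & power_summable f2] -> 0 < z < 1 ->
  log_comb1 (fun t => f (t + 1) - f t) (fun t => f1 (t + 1) - f1 t) z =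
    (z^-1 - 1) * log_comb1 f f1 z + f1 1 + f 1 * ln z /\
  log_comb2 (fun t => f (t + 1) - f t) (fun t => f1 (t + 1) - f1 t)
    (fun t => f2 (t + 1) - f2 t) z =
    (z^-1 - 1) * log_comb2 f f1 f2 z - 2^-1 * f2 1 - f1 1 * ln z - 2^-1 * f 1 * ln z ^+ 2.
Proof.
move=> [s0 s1 s2] z01.
have E g : power_summable g ->
    power_sum (fun t => g (t + 1) - g t) z = (z^-1 - 1) * power_sum g z - g 1.
  move=> sg; transitivity (power_sum ((fun t => g (t + 1)) \+ (fun t => -1 * g t)) z).
    by apply: eq_power_sum => t _ /=; rewrite mulN1r.
  rewrite power_sumD//; [|exact: power_summable_shift|exact: power_summableZ].
  by rewrite power_sum_shift// power_sumZ//; ring.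
by rewrite /log_comb1 /log_comb2 !E//; split; ring.
Qed.

(** Summation by parts: replacing S by S(t + 1) - S(t) multiplies the two
combinations by 1/z - 1, up to boundary terms at t = 1.  As z tends to 1 this
factor and ln z vanish, and only the derivatives of S at 1 are left. *)
Lemma regular_shift f f1 f2 l1 l2 : regular_jet f f1 f2 l1 l2 ->
  regular (fun t => f (t + 1) - f t) (f1 1) (- (2^-1 * f2 1)).
Proof.
move=> [d1 d2 s012 c1 c2]; have E z := @log_comb_shift _ _ _ z s012.
have [s0 s1 s2] := s012.
exists (fun t => f1 (t + 1) - f1 t), (fun t => f2 (t + 1) - f2 t).
have D (g g' : R -> R) : (forall t : R, 0 < t -> is_derive t 1 g (g' t)) ->
    forall t : R, 0 < t -> is_derive t 1 (fun t => g (t + 1) - g t) (g' (t + 1) - g' t).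
  move=> dg t t0; apply: is_deriveB; last exact: dg.
  have dg1 : is_derive (t + 1) 1 g (g' (t + 1)) by apply: dg; lra.
  have dt1 : is_derive t 1 (fun s : R => s + 1) 1.
    by apply: is_derive_eq; rewrite addr0.
  by have := @is_derive1_comp _ g (fun s : R => s + 1) t _ _ dg1 dt1; rewrite mulr1.
have S g : power_summable g -> power_summable (fun t => g (t + 1) - g t).
  move=> sg; apply: (@eq_power_summable ((fun t => g (t + 1)) \+ (fun t => -1 * g t))).
    by move=> t _ /=; rewrite mulN1r.
  by apply: power_summableD; [exact: power_summable_shift|exact: power_summableZ].
split; [exact: D | exact: D | by split; exact: S | |].
- apply: eq_cvg_left1 => [z z01|]; first by have [-> _] := E _ z01.
  have E1 : 0 * l1 + f1 1 + f 1 * 0 = f1 1 by ring.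
  rewrite -[X in _ --> X]E1.
  apply: cvgD; last exact: cvgM (cvg_cst _) cvg_ln_left1.
  apply: cvgD; last exact: cvg_cst.
  exact: cvgM cvg_invB1_left1 c1.
- apply: eq_cvg_left1 => [z z01|]; first by have [_ ->] := E _ z01.
  have E2 : 0 * l2 - 2^-1 * f2 1 - f1 1 * 0 - 2^-1 * f 1 * (0 * 0) = - (2^-1 * f2 1).
    by ring.
  rewrite -[X in _ --> X]E2.
  apply: cvgB; last first.
    apply: cvgM; first exact: cvg_cst.
    by under eq_fun do rewrite expr2; exact: cvgM cvg_ln_left1 cvg_ln_left1.
  apply: cvgB; last exact: cvgM (cvg_cst _) cvg_ln_left1.
  apply: cvgB; last exact: cvg_cst.
  exact: cvgM cvg_invB1_left1 c2.
Qed.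

End Regular.

(** * Simple poles *)

Section Poles.
Context {R : realType}.
Implicit Types (f g F G : R -> R) (z l t : R).

Definition pole (k : nat) (t : R) : R := (t + k%:R)^-1.

(** The index starts at 1, so this is the sum of 1 / j^s over j > k. *)
Definition zeta_tail (s k : nat) : R := sum_pos (fun nu => ((nu%:R + k%:R) ^+ s)^-1).

Lemma cvg_pole k : pole k n%:R @[n --> \oo] --> (0 : R).
Proof.
rewrite -(cvg_shiftS (fun n => pole k n%:R)).
apply: (@squeeze_cvgr _ _ _ _ (fun=> 0) (@harmonic R)).
- apply: nearW => n; rewrite /pole /harmonic/= invr_ge0 addr_ge0//=.
  by rewrite lef_pV2 ?posrE ?lerDl ?ltr_wpDr.
- exact: cvg_cst.
- exact: cvg_harmonic.
Qed.

Lemma summable_pole_telescope k :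
  summable (fun nu => pole k nu%:R - pole k.+1 nu%:R) /\
  sum_pos (fun nu => pole k nu%:R - pole k.+1 nu%:R) = pole k 1.
Proof.
have /sum_pos_telescope/= [] : - pole k n%:R @[n --> \oo] --> - (0 : R).
  by apply: cvgN; exact: cvg_pole.
have E n : - pole k n.+1%:R - - pole k n%:R = pole k n%:R - pole k.+1 n%:R :> R.
  by rewrite opprK addrC /pole -[n.+1%:R]natr1 -[k.+1%:R]natr1 addrAC addrA.
under eq_fun do rewrite E.
by rewrite oppr0 add0r opprK.
Qed.

Lemma pole_gt0 k t : 0 < t -> 0 < pole k t.
Proof. by move=> t0; rewrite invr_gt0 ltr_wpDr. Qed.

Lemma poleB k t : 0 < t -> pole k t - pole k.+1 t = pole k t * pole k.+1 t.
Proof.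
move=> t0; rewrite /pole -natr1.
have k0 : 0 <= k%:R :> R by [].
have n1 : t + k%:R != 0 by apply: lt0r_neq0; lra.
have n2 : t + (k%:R + 1) != 0 by apply: lt0r_neq0; lra.
by field; rewrite n1 n2.
Qed.

(** For s > 1 and x >= 1, 1 / x^s is at most 2 (1 / x - 1 / (x + 1)), and this
bound telescopes. *)
Lemma summable_zeta_tail s k : (1 < s)%N ->
  summable (fun nu => ((nu%:R + k%:R) ^+ s)^-1 : R).
Proof.
move=> s1; have [H _] := summable_pole_telescope k.
have H2 := @summableZ _ 2 _ H.
apply: le_summable H2 => nu nu0.
have nu1 : 1 <= nu%:R :> R by rewrite ler1n.
have k0 : 0 <= k%:R :> R by [].
set x := nu%:R + k%:R; have x1 : 1 <= x by rewrite /x; lra.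
have x0 : 0 < x by lra.
rewrite invr_ge0 exprn_ge0 ?(ltW x0)//= poleB ?ltr0n// /pole -[k.+1%:R]natr1 addrA -/x.
rewrite -invfM -[2]invrK -invfM lef_pV2 ?posrE ?exprn_gt0//; last first.
  by rewrite mulr_gt0 ?invr_gt0// mulr_gt0//; lra.
apply: (@le_trans _ _ (x ^+ 2)); last exact: ler_weXn2l.
by rewrite expr2 mulrCA; apply: ler_wpM2l; lra.
Qed.

Lemma zeta_tail0 s : zeta_tail s 0 = zeta R s.
Proof. by apply: eq_sum_pos => k _; rewrite addr0. Qed.

Lemma zeta_tailS s k : (1 < s)%N ->
  zeta_tail s k = (k.+1%:R ^+ s)^-1 + zeta_tail s k.+1.
Proof.
move=> s1; have := sum_pos_shift (summable_zeta_tail k s1).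
rewrite -natrD add1n => H; rewrite [zeta_tail s k.+1](_ : _ =
  sum_pos (fun nu => ((nu.+1%:R + k%:R) ^+ s)^-1)); first by rewrite H addrC subrK.
by apply: eq_sum_pos => nu _; rewrite -!natrD addnS.
Qed.

Lemma power_summable1 : power_summable (fun=> 1 : R).
Proof.
move=> z /andP[z0 z1].
have : cvgn (series (geometric z z)).
  by apply: is_cvg_geometric_series; rewrite gtr0_norm.
move=> H; constructor; move: H; have -> // : geometric z z = (fun k => z ^+ k.+1 * 1).
by apply/funext => n; rewrite mulr1 exprS.
Qed.

Lemma jet_pole k t : 0 < t ->
  is_derive t 1 (pole k) (- (pole k t * pole k t)) /\
  is_derive t 1 (fun t => - (pole k t * pole k t)) (2 * pole k t ^+ 3).
Proof.
move=> t0; have d : is_derive t 1 (pole k) (- (pole k t * pole k t)).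
  have dt1 : is_derive t 1 (fun s : R => s + k%:R) 1.
    by apply: is_derive_eq; rewrite addr0.
  have nz : t + k%:R != 0 by rewrite gt_eqF// ltr_wpDr.
  have := @is_deriveV _ (fun s : R => s + k%:R) t _ _ nz dt1.
  move=> H; apply: is_derive_eq.
  by rewrite /pole -exprVn expr2 /GRing.scale/= mulr1.
split=> //; have H := is_deriveN (is_deriveM d d).
apply: is_derive_eq.
by rewrite /GRing.scale/=; ring.
Qed.

Lemma power_summable_pole_pow k i : power_summable (fun t => pole k t ^+ i).
Proof.
move=> z z01; apply: le_summable (power_summable1 z01) => nu nu0.
have p0 : 0 < pole k nu%:R by rewrite pole_gt0// ltr0n.
have p1 : pole k nu%:R <= 1.
  rewrite invf_le1; last by rewrite ltr_wpDr ?ltr0n.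
  by rewrite -natrD ler1n addn_gt0 nu0.
case/andP: z01 => z0 z1; rewrite mulr_ge0 ?exprn_ge0 ?(ltW z0) ?(ltW p0)//=.
by rewrite ler_pM2l ?exprn_gt0// exprn_ile1// ltW.
Qed.

Lemma abel_power_sum f : (forall t : R, 0 < t -> 0 <= f t) -> summable (fun nu => f nu%:R) ->
  power_sum f z @[z --> (1 : R)^'-] --> sum_pos (fun nu => f nu%:R).
Proof.
move=> f0 sf; have [k k0|_] := @abel_limit R (fun nu => f nu%:R) _ sf => //.
by apply: f0; rewrite ltr0n.
Qed.

Lemma ln_left1_bound z : 0 < z < 1 -> `|ln z| <= z^-1 - 1.
Proof.
move=> /andP[z0 z1].
have zV : 1 < z^-1 by rewrite invf_gt1.
rewrite ler0_norm; last by rewrite -(ln1 R) ler_ln ?posrE// ltW.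
rewrite -lnV ?posrE// -[X in ln X](subrKC 1).
by apply: le_ln1Dx; lra.
Qed.

(** The harmonic-like series only diverges like a logarithm, so ln z kills it.
To avoid an asymptotic expansion, compare |ln z| with 1/z - 1, which by summation
by parts turns the series into the convergent one of 1/(t + k) - 1/(t + k + 1),
whose sum at 1 is exactly the boundary term. *)
Lemma power_sum_pole_ln k : power_sum (pole k) z * ln z @[z --> (1 : R)^'-] --> (0 : R).
Proof.
have s1 : power_summable (pole k).
  by apply: eq_power_summable (power_summable_pole_pow k 1) => t _; rewrite expr1.
have [sd Ed] := summable_pole_telescope k.
have d0 t : 0 < t -> 0 <= pole k t - pole k.+1 t.
  by move=> t0; rewrite poleB// mulr_ge0// ltW// pole_gt0.
have H : (z^-1 - 1) * power_sum (pole k) z @[z --> (1 : R)^'-] --> (0 : R).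
  have := abel_power_sum d0 sd; rewrite Ed => H.
  have E1 : pole k 1 - pole k 1 = 0 by rewrite subrr.
  rewrite -[X in _ --> X]E1.
  apply: eq_cvg_left1 (cvgB (cvg_cst (pole k 1)) H) => z z01; rewrite !fctE.
  have -> : power_sum (fun t => pole k t - pole k.+1 t) z =
      power_sum (pole k \+ (fun t => -1 * pole k (t + 1))) z.
    by apply: eq_power_sum => t _ /=; rewrite mulN1r /pole -natr1 (addrC k%:R) addrA.
  rewrite power_sumD//; last exact/power_summableZ/power_summable_shift.
  rewrite power_sumZ//; last exact/power_summable_shift.
  by rewrite power_sum_shift//; ring.
(* |ln z| <= 1/z - 1, so the product is squeezed. *)
have HN : - ((z^-1 - 1) * power_sum (pole k) z) @[z --> (1 : R)^'-] --> (0 : R).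
  by have O : - 0 = 0 :> R by [rewrite oppr0]; rewrite -[X in _ --> X]O; exact: cvgN H.
apply: squeeze_cvgr HN H; near=> z.
have z01 : 0 < z < 1.
  by apply/andP; split; near: z; [exact: nbhs_left_gt | exact: nbhs_left_lt].
rewrite -ler_norml normrM mulrC.
have g0 : 0 <= power_sum (pole k) z.
  apply: sum_pos_ge0 (s1 _ z01) => nu nu0; case/andP: z01 => z0 z1.
  by rewrite mulr_ge0 ?exprn_ge0 ?ltW ?pole_gt0 ?ltr0n.
rewrite (ger0_norm g0) ler_wpM2r//.
exact: ln_left1_bound.
Unshelve. all: by end_near. Qed.

(** The series of the derivatives of 1 / (t + k) converge at z = 1 by themselves,
and every term with a logarithm tends to 0. *)
Lemma regular_pole k : regular (pole k) (zeta_tail 2 k) (zeta_tail 3 k).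
Proof.
exists (fun t => - (pole k t * pole k t)), (fun t => 2 * pole k t ^+ 3).
have s1 : power_summable (pole k).
  by apply: eq_power_summable (power_summable_pole_pow k 1) => t _; rewrite expr1.
have s2 := power_summable_pole_pow k 2.
have s3 := power_summable_pole_pow k 3.
have E2 z : 0 < z < 1 ->
    power_sum (fun t => - (pole k t * pole k t)) z = -1 * power_sum (fun t => pole k t ^+ 2) z.
  by move=> z01; rewrite -power_sumZ//; apply: eq_power_sum => t _; rewrite mulN1r expr2.
have E3 z : 0 < z < 1 ->
    power_sum (fun t => 2 * pole k t ^+ 3) z = 2 * power_sum (fun t => pole k t ^+ 3) z.
  by move=> z01; rewrite -power_sumZ.
have L i : (1 < i)%N -> power_sum (fun t => pole k t ^+ i) z @[z --> (1 : R)^'-] --> zeta_tail i k.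
  move=> i1; rewrite /zeta_tail.
  rewrite [X in _ --> X](@eq_sum_pos _ _ (fun nu => pole k nu%:R ^+ i)); last first.
    by move=> nu _; rewrite /pole exprVn.
  apply: abel_power_sum => [t t0|]; first by rewrite exprn_ge0// ltW// pole_gt0.
  by apply: eq_summable (summable_zeta_tail k i1) => nu _; rewrite /pole exprVn.
have L2 := L 2%N isT; have L3 := L 3%N isT; have L1 := power_sum_pole_ln k.
split.
- by move=> t t0; have [] := jet_pole k t0.
- by move=> t t0; have [] := jet_pole k t0.
- split=> //; last exact: power_summableZ.
  by apply: eq_power_summable (@power_summableZ _ (-1) _ s2) => t _; rewrite mulN1r expr2.
- have E : zeta_tail 2 k - 0 = zeta_tail 2 k by rewrite subr0.
  rewrite -[X in _ --> X]E.
  by apply: eq_cvg_left1 (cvgB L2 L1) => z z01; rewrite /log_comb1 E2// !fctE; ring.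
- have E : zeta_tail 3 k - zeta_tail 2 k * 0 + 2^-1 * (0 * 0) = zeta_tail 3 k by ring.
  rewrite -[X in _ --> X]E.
  apply: (@eq_cvg_left1 _ _ (fun z => power_sum (fun t => pole k t ^+ 3) z -
      power_sum (fun t => pole k t ^+ 2) z * ln z +
      2^-1 * (power_sum (pole k) z * ln z * ln z))) => [z z01|]; last first.
    apply: cvgD; first exact: cvgB L3 (cvgM L2 cvg_ln_left1).
    exact: cvgM (cvg_cst _) (cvgM L1 cvg_ln_left1).
  by rewrite /log_comb2 E2// E3//; field.
Qed.

End Poles.

(** * Binomial polynomials and expansions of the logarithm *)

Section Polynomials.
Context {R : realType}.
Implicit Types (f g F G : R -> R) (z l t u : R) (p : {poly R}).

(** At z, the factor t is absorbed by passing to y = (1 + z) / 2: Bernoulli's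
inequality bounds t by a multiple of (y / z)^t. *)
Lemma power_summable_mulX f : (forall t, 0 < t -> 0 <= f t) -> power_summable f ->
  power_summable (fun t => t * f t).
Proof.
move=> f0 sf z /andP[z0 z1].
pose y := (1 + z) / 2.
have y01 : 0 < y < 1 by apply/andP; rewrite /y; split; lra.
have zy : z < y by rewrite /y; lra.
have y0 : 0 < y by lra.
(* Bernoulli: t (y / z - 1) <= (y / z)^t. *)
pose C := (y / z - 1)^-1.
have C0 : 0 < C by rewrite invr_gt0 subr_gt0 ltr_pdivlMr// mul1r.
have sC := @summableZ _ C _ (sf _ y01).
apply: le_summable sC => k k0.
have fk : 0 <= f k%:R by apply: f0; rewrite ltr0n.
rewrite !mulr_ge0 ?exprn_ge0 ?(ltW z0)//= mulrCA mulrA mulrA.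
rewrite ler_wpM2r//.
have B : forall n, 1 + n%:R * (y / z - 1) <= (y / z) ^+ n.
  elim=> [|n IH]; first by rewrite mul0r addr0 expr0.
  have w0 : 0 < y / z - 1 by rewrite -invr_gt0.
  rewrite exprSr -natr1.
  apply: (@le_trans _ _ ((1 + n%:R * (y / z - 1)) * (y / z))); last first.
    by rewrite ler_wpM2r// divr_ge0// ltW.
  have n0 : 0 <= n%:R :> R by [].
  set w := y / z in w0 *.
  have : 0 <= n%:R * (w - 1) * (w - 1) by rewrite !mulr_ge0// ltW.
  by nra.
have {}B := B k.
rewrite -ler_pdivrMl// /C invrK.
have -> : y ^+ k = z ^+ k * (y / z) ^+ k.
  by rewrite -exprMn mulrCA divff ?mulr1// gt_eqF.
rewrite mulrA mulrC ler_wpM2l ?exprn_ge0 ?(ltW z0)//.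
by apply: le_trans B; rewrite mulrC lerDr.
Qed.

Lemma power_summable_exp m : power_summable (fun t : R => t ^+ m).
Proof.
elim: m => [|m IH]; first by under eq_fun do rewrite expr0; exact: power_summable1.
under eq_fun do rewrite exprS.
by apply: (@power_summable_mulX (fun t => t ^+ m)) => // t t0; rewrite exprn_ge0// ltW.
Qed.

Lemma power_summable_horner p : power_summable (horner p).
Proof.
suff H m : power_summable (fun t => t ^+ m * p.[t]).
  by apply: eq_power_summable (H 0%N) => t _; rewrite mul1r.
elim/poly_ind: p m => [|p c IH] m.
  apply: (@eq_power_summable _ (fun t => 0 * t ^+ m)).
    by move=> t _; rewrite horner0 mulr0 mul0r.
  by apply: power_summableZ; exact: power_summable_exp.
apply: (@eq_power_summable _ ((fun t => t ^+ m.+1 * p.[t]) \+ (fun t => c * t ^+ m))).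
  by move=> t _ /=; rewrite hornerMXaddC exprS; ring.
by apply: power_summableD; [exact: IH | apply: power_summableZ; exact: power_summable_exp].
Qed.

(** The polynomial t |-> C(t - 1, m).  The shift by 1 makes its zeros the
integers 1, ..., m, as in the numerator of R_n. *)
Definition binpoly (m : nat) : {poly R} :=
  \prod_(i < m) (i.+1%:R^-1 *: ('X - i.+1%:R%:P)).

Lemma binpolyS m : binpoly m.+1 = binpoly m * (m.+1%:R^-1 *: ('X - m.+1%:R%:P)).
Proof. by rewrite /binpoly big_ord_recr. Qed.

Lemma binpoly0 : binpoly 0 = 1. Proof. by rewrite /binpoly big_ord0. Qed.

Lemma horner_binpolyS m t : (binpoly m.+1).[t] = (binpoly m).[t] * ((t - m.+1%:R) / m.+1%:R).
Proof. by rewrite binpolyS hornerM hornerZ hornerXsubC [_^-1 * _]mulrC. Qed.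

Lemma horner_binpolyS_shift m t : (binpoly m.+1).[t + 1] = t / m.+1%:R * (binpoly m).[t].
Proof.
elim: m => [|m IH]; first by rewrite horner_binpolyS binpoly0 !hornerC mul1r addrK mulr1.
rewrite horner_binpolyS IH horner_binpolyS.
have m1 : m.+1%:R != 0 :> R by rewrite pnatr_eq0.
have m2 : m.+1%:R + 1 != 0 :> R by rewrite natr1 pnatr_eq0.
have -> : m.+2%:R = m.+1%:R + 1 :> R by rewrite natr1.
by move: m.+1%:R m1 m2 => x m1 m2; field; rewrite ?m1 ?m2.
Qed.

Lemma binpoly_diff m t : (binpoly m.+1).[t + 1] - (binpoly m.+1).[t] = (binpoly m).[t].
Proof.
rewrite horner_binpolyS_shift horner_binpolyS.
have m1 : m.+1%:R != 0 :> R by rewrite pnatr_eq0.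
by field.
Qed.

Lemma horner_mulX_binpoly m t : t * (binpoly m).[t] = m.+1%:R * (binpoly m.+1).[t] + m.+1%:R * (binpoly m).[t].
Proof.
rewrite horner_binpolyS.
have m1 : m.+1%:R != 0 :> R by rewrite pnatr_eq0.
by field.
Qed.

(** The coefficient of u^i in ln (1 + u); at i = 0 it is 0 because 1 / 0 = 0. *)
Definition log_coef (i : nat) : R := (-1) ^+ i.+1 / i%:R.

(** The harmonic number H_(n-1): this index is the one that occurs in the
expansion of the squared logarithm. *)
Definition harmonic_sum (n : nat) : R := \sum_(1 <= i < n) i%:R^-1.

(** The coefficient of u^i in ln (1 + u)^2 / 2. *)
Definition sqrlog_coef (i : nat) : R := (-1) ^+ i * harmonic_sum i / i%:R.

Lemma harmonic_sumS n : (0 < n)%N -> harmonic_sum n.+1 = harmonic_sum n + n%:R^-1.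
Proof. by move=> n0; rewrite /harmonic_sum big_nat_recr. Qed.

Lemma binpoly1 m : (binpoly m.+1).[1] = 0.
Proof. by rewrite -[1]add0r horner_binpolyS_shift !mul0r. Qed.

Lemma deriv_binpolyS m : (binpoly m.+1)^`() =
  m.+1%:R^-1 *: ((binpoly m)^`() * ('X - m.+1%:R%:P) + binpoly m).
Proof. by rewrite binpolyS -scalerAr derivZ derivM derivXsubC mulr1. Qed.

(** The shift by 1 is exp (d/dt) = 1 + Delta, so d/dt = ln (1 + Delta), and
Delta^i C(t - 1, m + 1) vanishes at t = 1 unless i = m + 1.  This is why Taylor
coefficients of the logarithm and of its square appear as derivatives at 1; the
proofs are direct inductions. *)
Lemma deriv_binpoly1 m : (binpoly m.+1)^`().[1] = log_coef m.+1.
Proof.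
elim: m => [|m IH].
  by rewrite deriv_binpolyS binpoly0 derivC mul0r add0r hornerZ hornerC /log_coef expr2; field.
rewrite deriv_binpolyS hornerZ hornerD hornerM IH binpoly1 hornerXsubC /log_coef.
have m1 : m.+1%:R != 0 :> R by rewrite pnatr_eq0.
have m2 : m.+1%:R + 1 != 0 :> R by rewrite natr1 pnatr_eq0.
have -> : m.+2%:R = m.+1%:R + 1 :> R by rewrite natr1.
rewrite [in RHS]exprS.
by move: m.+1%:R m1 m2 => x m1 m2; field; rewrite ?m1 ?m2.
Qed.

Lemma deriv2_binpoly1 m : 2^-1 * (binpoly m.+1)^`()^`().[1] = sqrlog_coef m.+1.
Proof.
elim: m => [|m IH].
  rewrite deriv_binpolyS binpoly0 derivC mul0r add0r derivZ derivC scaler0 horner0 mulr0.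
  by rewrite /sqrlog_coef /harmonic_sum big_geq// mulr0 mul0r.
rewrite deriv_binpolyS derivZ derivD derivM derivXsubC mulr1 hornerZ !hornerD hornerM.
rewrite deriv_binpoly1 hornerXsubC.
have -> : (binpoly m.+1)^`()^`().[1] = 2 * sqrlog_coef m.+1 by rewrite -IH; field.
rewrite /sqrlog_coef /log_coef (@harmonic_sumS m.+1)//.
have m1 : m.+1%:R != 0 :> R by rewrite pnatr_eq0.
have m2 : m.+1%:R + 1 != 0 :> R by rewrite natr1 pnatr_eq0.
have -> : m.+2%:R = m.+1%:R + 1 :> R by rewrite natr1.
rewrite !exprS.
by move: m.+1%:R m1 m2 => x m1 m2; field; rewrite ?m1 ?m2.
Qed.

Lemma deriv_nonneg_le (g dg : R -> R) u : 0 <= u ->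
  (forall x : R, 0 <= x -> is_derive x 1 g (dg x)) ->
  (forall x : R, 0 <= x -> 0 <= dg x) -> g 0 <= g u.
Proof.
move=> u0 dg_ dg0; apply: (@ger0_derive1_ndecry _ g 0) => //.
- move=> x; rewrite in_itv/= andbT => /ltW x0.
  by have [] := dg_ _ x0.
- move=> x; rewrite in_itv/= andbT => /ltW x0; rewrite derive1E.
  by have [_ ->] := dg_ _ x0; exact: dg0.
- apply: derivable_within_continuous => x; rewrite in_itv/= andbT => x0.
  by have [] := dg_ _ x0.
Qed.

Definition log_trunc (m : nat) : {poly R} := \poly_(i < m.+1) log_coef i.

Lemma horner_log_trunc0 m : (log_trunc m).[0] = 0.
Proof. by rewrite horner_coef0 coef_poly /log_coef invr0 mulr0. Qed.

Lemma log_truncS m : log_trunc m.+1 = log_trunc m + log_coef m.+1 *: 'X^(m.+1).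
Proof. by rewrite /log_trunc poly_def big_ord_recr/= -poly_def. Qed.

Lemma deriv_log_trunc m x : (1 + x) * (log_trunc m)^`().[x] = 1 - (- x) ^+ m.
Proof.
elim: m => [|m IH].
  rewrite /log_trunc poly_def big_ord1 /log_coef invr0 mulr0 scale0r deriv0 horner0.
  by rewrite mulr0 subrr.
rewrite log_truncS derivD derivZ derivXn hornerD hornerZ hornerMn hornerXn /=.
rewrite mulrDr IH /log_coef -mulr_natl.
have m1 : m.+1%:R != 0 :> R by rewrite pnatr_eq0.
by rewrite !exprS (exprNn x); field.
Qed.

(** Both sides vanish at u = 0, and the derivative of the error,
(- u)^m / (1 + u), is bounded by u^m, the derivative of the right-hand side. *)
Lemma log_taylor m u : 0 <= u ->
  `|ln (1 + u) - (log_trunc m).[u]| <= u ^+ m.+1 / m.+1%:R.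
Proof.
move=> u0.
have m1 : m.+1%:R != 0 :> R by rewrite pnatr_eq0.
have dl (x : R) : 0 <= x ->
    is_derive x 1 (fun s => ln (1 + s) - (log_trunc m).[s]) ((1 + x)^-1 - (log_trunc m)^`().[x]).
  move=> x0; apply: is_deriveB.
  have dt1 : is_derive x 1 (fun s : R => 1 + s) 1.
    rewrite (_ : (fun s : R => 1 + s) = (fun s : R => s + 1)); last first.
      by apply/funext => s; rewrite addrC.
    by apply: is_derive_eq; rewrite addr0.
  have x1 : 0 < 1 + x by lra.
  by have := @is_derive1_comp _ (@ln R) (fun s : R => 1 + s) x _ _ (is_derive1_ln x1) dt1; rewrite mulr1.
have dx (x : R) : is_derive x 1 (fun s : R => s ^+ m.+1 / m.+1%:R) (x ^+ m).
  rewrite (_ : (fun s => _) = horner (m.+1%:R^-1 *: 'X^(m.+1))).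
    apply: is_derive_eq.
    by rewrite derivZ derivXn hornerZ hornerMn hornerXn/= -[X in _ * X]mulr_natl mulKf.
  by apply/funext => s; rewrite hornerZ hornerXn mulrC.
have E (x : R) : 0 <= x -> (1 + x)^-1 - (log_trunc m)^`().[x] = (- x) ^+ m / (1 + x).
  move=> x0; have x1 : 1 + x != 0 by apply: lt0r_neq0; lra.
  apply: (mulfI x1); rewrite mulrBr divff// deriv_log_trunc mulrCA divff// mulr1.
  by ring.
have B (x : R) : 0 <= x -> `|(- x) ^+ m / (1 + x)| <= x ^+ m.
  move=> x0; rewrite normrM normrX normrN (ger0_norm x0) ger0_norm ?invr_ge0; last lra.
  by rewrite ler_piMr ?exprn_ge0// invf_le1; lra.
have g0 : ln (1 + 0) - (log_trunc m).[0] = 0 by rewrite addr0 ln1 horner_log_trunc0 subrr.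
(* The bound plus, then minus, the error is nondecreasing and vanishes at 0. *)
rewrite ler_norml; apply/andP; split.
- have := @deriv_nonneg_le
    ((fun s => s ^+ m.+1 / m.+1%:R) \+ (fun s => ln (1 + s) - (log_trunc m).[s]))
    (fun x => x ^+ m + ((1 + x)^-1 - (log_trunc m)^`().[x])) u u0.
  rewrite /= g0 expr0n/= mul0r addr0 => H.
  suff : 0 <= u ^+ m.+1 / m.+1%:R + (ln (1 + u) - (log_trunc m).[u]).
    by rewrite -lerBlDl sub0r.
  apply: H => x x0; first by apply: is_deriveD; exact: dl.
  by have := B x x0; rewrite ler_norml E// => /andP[? _]; rewrite -lerBlDl sub0r.
- have := @deriv_nonneg_le
    ((fun s => s ^+ m.+1 / m.+1%:R) \- (fun s => ln (1 + s) - (log_trunc m).[s]))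
    (fun x => x ^+ m - ((1 + x)^-1 - (log_trunc m)^`().[x])) u u0.
  rewrite /= g0 expr0n/= mul0r subr0 => H.
  rewrite -subr_ge0.
  apply: H => x x0; first by apply: is_deriveB; exact: dl.
  by have := B x x0; rewrite ler_norml E// subr_ge0 => /andP[].
Qed.

Definition sqrlog_trunc (m : nat) : {poly R} := \poly_(i < m.+1) sqrlog_coef i.

Lemma sqrlog_truncS m : sqrlog_trunc m.+1 = sqrlog_trunc m + sqrlog_coef m.+1 *: 'X^(m.+1).
Proof. by rewrite /sqrlog_trunc poly_def big_ord_recr/= -poly_def. Qed.

(** The square of the logarithm series:
1 / (i (N - i)) = (1 / i + 1 / (N - i)) / N. *)
Lemma log_coef_conv N : \sum_(i < N.+1) log_coef i * log_coef (N - i) = 2 * sqrlog_coef N.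
Proof.
rewrite -(big_mkord xpredT (fun i => log_coef i * log_coef (N - i))).
have l0 : log_coef 0 = 0 by rewrite /log_coef invr0 mulr0.
rewrite big_nat_recr//= subnn l0 mulr0 addr0.
case: N => [|N]; first by rewrite big_geq// /sqrlog_coef invr0 !mulr0.
rewrite big_ltn// l0 mul0r add0r.
have E : \sum_(1 <= i < N.+1) log_coef i * log_coef (N.+1 - i) =
    (-1) ^+ N.+1 / N.+1%:R * \sum_(1 <= i < N.+1) (i%:R^-1 + (N.+1 - i)%:R^-1).
  rewrite big_distrr/=; apply: eq_big_nat => i /andP[i0 iN].
  rewrite /log_coef.
  have -> : (-1) ^+ N.+1 = (-1) ^+ i.+1 * (-1) ^+ (N.+1 - i).+1 :> R.
    by rewrite -exprD addSn addnS subnKC 1?ltnW// [RHS]exprS [X in -1 * X]exprS mulrA mulrNN mulr1 mul1r.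
  have -> : N.+1%:R = i%:R + (N.+1 - i)%:R :> R by rewrite -natrD subnKC 1?ltnW.
  have i1 : i%:R != 0 :> R by rewrite pnatr_eq0 -lt0n.
  have i2 : (N.+1 - i)%:R != 0 :> R by rewrite pnatr_eq0 -lt0n subn_gt0.
  have i3 : i%:R + (N.+1 - i)%:R != 0 :> R.
    by rewrite -natrD pnatr_eq0 subnKC 1?ltnW.
  by field; rewrite i1 i2 i3.
rewrite E big_split/= [X in _ + X]big_nat_rev/=.
have -> : \sum_(1 <= i < N.+1) (N.+1 - (1 + N.+1 - i.+1))%:R^-1 = harmonic_sum N.+1.
  by apply: eq_big_nat => i /andP[i0 iN]; rewrite add1n subSS subKn// ltnW.
by rewrite /sqrlog_coef -/(harmonic_sum _); ring.
Qed.

(** The truncations satisfy the identity between ln (1 + u)^2 / 2 and half the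
square of ln (1 + u) up to degree m.  In degree m + 1 the square is still complete,
since the top coefficient is multiplied by the constant term 0, while the
truncated half-square has lost its coefficient. *)
Lemma coef_sqrlog_remainder m i : (i <= m.+1)%N ->
  (sqrlog_trunc m - 2^-1 *: (log_trunc m ^+ 2))`_i = if (i <= m)%N then 0 else - sqrlog_coef m.+1.
Proof.
move=> im; rewrite coefB coefZ expr2 coefM.
rewrite (eq_bigr (fun j : 'I_i.+1 => log_coef j * log_coef (i - j))).
  rewrite log_coef_conv coef_poly ltnS; case: ifPn => [_|].
    by rewrite mulrA mulVf ?mul1r ?subrr// pnatr_eq0.
  rewrite -ltnNge => mi; have -> : i = m.+1 by apply/eqP; rewrite eqn_leq im.
  by rewrite mulrA mulVf ?mul1r ?sub0r// pnatr_eq0.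
move=> j _; rewrite !coef_poly !ltnS.
have l0 : log_coef 0 = 0 by rewrite /log_coef invr0 mulr0.
have jm : (j <= m.+1)%N by rewrite (leq_trans _ im)// -ltnS.
case: ifPn => [jm'|].
  case: ifPn => // ; rewrite -ltnNge => mij.
  have -> : nat_of_ord j = 0%N.
    apply/eqP; rewrite -leqn0 leqNgt; apply/negP => j0.
    have : (i - j < m.+1)%N by rewrite (leq_trans _ im)// ltn_subrL j0/= (leq_trans j0)// -ltnS.
    by rewrite ltnS leqNgt mij.
  by rewrite l0 !mul0r.
rewrite -ltnNge => mj.
have -> : (i - j = 0)%N by apply/eqP; rewrite subn_eq0 (leq_trans im).
by rewrite l0 !mulr0.
Qed.

End Polynomials.

(** * The limits for binomial polynomials *)

Section RegularPolynomials.
Context {R : realType}.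
Implicit Types (f g F G : R -> R) (z l t u : R) (p : {poly R}).

(** A nonzero polynomial over an infinite field does not vanish at all integers. *)
Lemma horner_inj p q : (forall t, p.[t] = q.[t]) -> p = q.
Proof.
move=> pq; apply/eqP; rewrite -subr_eq0; apply/eqP/(@roots_geq_poly_eq0 _ _
  [seq (i%:R : R) | i <- iota 0 (size (p - q))]).
- by apply/allP => x _; rewrite rootE hornerD hornerN pq subrr.
- by rewrite map_inj_uniq ?iota_uniq// => i j /eqP; rewrite eqr_nat => /eqP.
- by rewrite size_map size_iota.
Qed.

Lemma deriv_diff p t : ((p \Po ('X + 1)) - p)^`().[t] = p^`().[t + 1] - p^`().[t].
Proof.
rewrite derivB deriv_comp derivD derivX derivC addr0 mulr1 hornerD hornerN.
by rewrite horner_comp hornerD hornerX hornerC.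
Qed.

Lemma binpoly_diff_poly m : binpoly m.+1 \Po ('X + 1) - binpoly m.+1 = binpoly m :> {poly R}.
Proof.
apply: horner_inj => t; rewrite hornerD hornerN horner_comp hornerD hornerX hornerC.
exact: binpoly_diff.
Qed.

Lemma binpoly_jet_diff m :
  [/\ horner (binpoly m) = (fun t : R => (binpoly m.+1).[t + 1] - (binpoly m.+1).[t]),
      horner (binpoly m)^`() = (fun t : R => (binpoly m.+1)^`().[t + 1] - (binpoly m.+1)^`().[t]) &
      horner (binpoly m)^`()^`() =
        (fun t : R => (binpoly m.+1)^`()^`().[t + 1] - (binpoly m.+1)^`()^`().[t]) ].
Proof.
have E1 t : (binpoly m)^`().[t] = (binpoly m.+1)^`().[t + 1] - (binpoly m.+1)^`().[t] :> R.
  by rewrite -(binpoly_diff_poly m) deriv_diff.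
split; apply/funext => t; rewrite ?binpoly_diff//.
rewrite -deriv_diff; congr (_^`().[t]); apply: horner_inj => s.
by rewrite hornerD hornerN horner_comp hornerD hornerX hornerC E1.
Qed.

Definition jet1 p z := log_comb1 (horner p) (horner p^`()) z.
Definition jet2 p z := log_comb2 (horner p) (horner p^`()) (horner p^`()^`()) z.

(** [regular_shift] in exact form, applied to C(t - 1, m) as the difference of
C(t - 1, m + 1). *)
Lemma jet_binpoly_step m z : 0 < z < 1 ->
  jet1 (binpoly m) z = (z^-1 - 1) * jet1 (binpoly m.+1) z + log_coef m.+1 /\
  jet2 (binpoly m) z = (z^-1 - 1) * jet2 (binpoly m.+1) z - sqrlog_coef m.+1 - log_coef m.+1 * ln z.
Proof.
move=> z01; rewrite /jet1 /jet2; have [-> -> ->] := binpoly_jet_diff m.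
have S : [/\ power_summable (horner (binpoly m.+1 : {poly R})),
    power_summable (horner (binpoly m.+1 : {poly R})^`()) &
    power_summable (horner (binpoly m.+1 : {poly R})^`()^`())].
  by split; exact: power_summable_horner.
have [-> ->] := log_comb_shift S z01.
by rewrite binpoly1 deriv_binpoly1 -deriv2_binpoly1; split; ring.
Qed.

(** The geometric series, obtained by summation by parts from the constant 1. *)
Lemma power_sum1 z : 0 < z < 1 -> (z^-1 - 1) * power_sum (fun=> 1) z = 1.
Proof.
move=> z01; have := power_sum_shift z01 (@power_summable1 R).
by move=> H; rewrite mulrBl mul1r {2}H; ring.
Qed.

Lemma power_sum0 z : 0 < z < 1 -> power_sum (fun=> 0) z = 0.
Proof.
move=> z01; rewrite -[RHS](mul0r (power_sum (fun=> 1) z)) -power_sumZ//; last exact: power_summable1.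
by apply: eq_power_sum => t _; rewrite mul0r.
Qed.

(** With u = 1/z - 1 and l = ln (1 + u) = - ln z, the right-hand sides are
l - p(u) and l^2 / 2 + q(u) - l p(u), where p and q are the truncations of
ln (1 + u) and of ln (1 + u)^2 / 2. *)
Lemma jet_binpoly m z : 0 < z < 1 ->
  (z^-1 - 1) ^+ m.+1 * jet1 (binpoly m) z = - ln z - (log_trunc m).[z^-1 - 1] /\
  (z^-1 - 1) ^+ m.+1 * jet2 (binpoly m) z =
    2^-1 * ln z ^+ 2 + (sqrlog_trunc m).[z^-1 - 1] + ln z * (log_trunc m).[z^-1 - 1].
Proof.
move=> z01; elim: m => [|m [IH1 IH2]].
  have g1 := power_sum1 z01.
  have E0 : horner (binpoly 0) = (fun=> 1 : R) by apply/funext => t; rewrite binpoly0 hornerC.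
  have E1 : horner (binpoly 0)^`() = (fun=> 0 : R).
    by apply/funext => t; rewrite binpoly0 derivC horner0.
  have E2 : horner (binpoly 0)^`()^`() = (fun=> 0 : R).
    by apply/funext => t; rewrite binpoly0 derivC deriv0 horner0.
  rewrite /jet1 /jet2 /log_comb1 /log_comb2 E0 E1 E2 !power_sum0// expr1.
  rewrite /log_trunc /sqrlog_trunc !poly_def !big_ord1 /log_coef /sqrlog_coef invr0 !mulr0 !scale0r horner0.
  split; first by transitivity (- ((z^-1 - 1) * power_sum (fun=> 1) z * ln z)); [ring|rewrite g1; ring].
  transitivity (2^-1 * ((z^-1 - 1) * power_sum (fun=> 1) z * ln z ^+ 2)); first by ring.
  by rewrite g1; ring.
have [S1 S2] := jet_binpoly_step m z01.
rewrite log_truncS sqrlog_truncS !hornerD !hornerZ !hornerXn; split.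
- transitivity ((z^-1 - 1) ^+ m.+1 * jet1 (binpoly m) z - log_coef m.+1 * (z^-1 - 1) ^+ m.+1).
    by rewrite S1 exprS; ring.
  by rewrite IH1; ring.
- transitivity ((z^-1 - 1) ^+ m.+1 * jet2 (binpoly m) z +
      (sqrlog_coef m.+1 + log_coef m.+1 * ln z) * (z^-1 - 1) ^+ m.+1).
    by rewrite S2 exprS; ring.
  by rewrite IH2; ring.
Qed.

Lemma jet1_binpoly_bound m z : 0 < z < 1 -> `|jet1 (binpoly m) z| <= 1.
Proof.
move=> z01; have [H _] := jet_binpoly m z01.
have /andP[z0 z1] := z01.
have u0 : 0 < z^-1 - 1 by rewrite subr_gt0 invf_gt1.
have lnz : - ln z = ln (1 + (z^-1 - 1)) by rewrite -lnV ?posrE// subrKC.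
have := log_taylor m (ltW u0).
rewrite -lnz -H normrM ger0_norm ?exprn_ge0 ?(ltW u0)//.
rewrite ler_pM2l ?exprn_gt0// => /le_trans; apply.
by rewrite invf_le1 ?ler1n.
Qed.

(** The value at m is u times the value at m + 1, which is bounded, plus the
expected limit. *)
Lemma cvg_jet1_binpoly m : jet1 (binpoly m) z @[z --> (1 : R)^'-] --> log_coef m.+1.
Proof.
have uc := @cvg_invB1_left1 R.
have Nuc : - (z^-1 - 1) @[z --> (1 : R)^'-] --> (0 : R).
  by have O : - 0 = 0 :> R by [rewrite oppr0]; rewrite -[X in _ --> X]O; exact: cvgN uc.
have H : (z^-1 - 1) * jet1 (binpoly m.+1) z @[z --> (1 : R)^'-] --> (0 : R).
  apply: squeeze_cvgr Nuc uc; near=> z.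
  have z01 : 0 < z < 1.
    by apply/andP; split; near: z; [exact: nbhs_left_gt | exact: nbhs_left_lt].
  have /andP[z0 z1] := z01.
  have u0 : 0 < z^-1 - 1 by rewrite subr_gt0 invf_gt1.
  rewrite -ler_norml normrM (gtr0_norm u0) ler_piMr ?(ltW u0)//.
  exact: jet1_binpoly_bound.
rewrite -[X in _ --> X]add0r.
apply: (@eq_cvg_left1 _ _ (fun z => (z^-1 - 1) * jet1 (binpoly m.+1) z + log_coef m.+1)).
  by move=> z z01; have [] := jet_binpoly_step m z01.
by apply: cvgD => //; exact: cvg_cst.
Unshelve. all: by end_near. Qed.

Lemma cvg_horner_left1 p : p.[z^-1 - 1] @[z --> (1 : R)^'-] --> p.[0].
Proof.
by apply: continuous_cvg; [exact: continuous_horner | exact: cvg_invB1_left1].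
Qed.

(** Rewrite l^2 / 2 + q - l p as (l - p)^2 / 2 + (q - p^2 / 2).  One factor l - p
is divided by u^(m+1), with a finite limit, and the other tends to 0; in the
polynomial q - p^2 / 2 the coefficients up to degree m cancel. *)
Lemma cvg_jet2_binpoly m : jet2 (binpoly m) z @[z --> (1 : R)^'-] --> - sqrlog_coef m.+1.
Proof.
(* [X] is q - p^2 / 2 and [Y] is its quotient by u^(m+1). *)
pose X : {poly R} := sqrlog_trunc m - 2^-1 *: (log_trunc m ^+ 2).
pose Y := drop_poly m.+1 X.
have XE : X = Y * 'X^(m.+1).
  rewrite -[LHS](poly_take_drop m.+1) (_ : take_poly _ _ = 0) ?add0r//.
  apply/polyP => i; rewrite coef_take_poly coef0; case: ifPn => // im.
  by rewrite coef_sqrlog_remainder// ?(ltnW im)// -ltnS im.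
have Y0 : Y.[0] = - sqrlog_coef m.+1.
  by rewrite horner_coef0 coef_drop_poly add0n coef_sqrlog_remainder// ltnn.
have E : 2^-1 * (log_coef m.+1 * (- 0 - (log_trunc m).[0])) + Y.[0] = - sqrlog_coef m.+1 :> R.
  by rewrite horner_log_trunc0 Y0; ring.
rewrite -[X in _ --> X]E.
apply: (@eq_cvg_left1 _ _ (fun z => 2^-1 * (jet1 (binpoly m) z *
  (- ln z - (log_trunc m).[z^-1 - 1])) + Y.[z^-1 - 1])) => [z z01|]; last first.
  apply: cvgD; last exact: cvg_horner_left1.
  apply: cvgM; first exact: cvg_cst.
  apply: cvgM; first exact: cvg_jet1_binpoly.
  by apply: cvgB; [apply: cvgN; exact: cvg_ln_left1 | exact: cvg_horner_left1].
have [H1 H2] := jet_binpoly m z01.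
have /andP[z0 z1] := z01.
have u0 : (z^-1 - 1) ^+ m.+1 != 0.
  by rewrite expf_neq0// gt_eqF// subr_gt0 invf_gt1.
have HX : X.[z^-1 - 1] = Y.[z^-1 - 1] * (z^-1 - 1) ^+ m.+1.
  by rewrite XE hornerM hornerXn.
apply: (mulfI u0); rewrite H2.
transitivity (2^-1 * ((z^-1 - 1) ^+ m.+1 * jet1 (binpoly m) z * (- ln z - (log_trunc m).[z^-1 - 1]))
  + Y.[z^-1 - 1] * (z^-1 - 1) ^+ m.+1); last by ring.
rewrite H1 -HX /X hornerD hornerN hornerZ [in RHS]expr2 hornerM.
by field.
Qed.

Lemma regular_binpoly m : regular (horner (binpoly m)) (log_coef m.+1 : R) (- sqrlog_coef m.+1).
Proof.
exists (horner (binpoly m)^`()), (horner (binpoly m)^`()^`()); split.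
- by move=> t _; exact: is_derive_poly.
- by move=> t _; exact: is_derive_poly.
- by split; exact: power_summable_horner.
- exact: cvg_jet1_binpoly.
- exact: cvg_jet2_binpoly.
Qed.

End RegularPolynomials.

(** * Binomial polynomials divided by a linear factor *)

Section Tails.
Context {R : realType}.
Implicit Types (k m j K : nat).

Definition inv_bin K j : R := 'C(j + K, K)%:R^-1.

Lemma bin_gt0R K j : 0 < 'C(j + K, K)%:R :> R.
Proof. by rewrite ltr0n bin_gt0 leq_addl. Qed.

Lemma inv_bin_gt0 K j : 0 < inv_bin K j. Proof. by rewrite invr_gt0 bin_gt0R. Qed.

Lemma inv_binSl K j : (j.+1 + K)%:R * inv_bin K j.+1 = j.+1%:R * inv_bin K j.
Proof.
have H : j.+1%:R * 'C(j.+1 + K, K)%:R = (j.+1 + K)%:R * 'C(j + K, K)%:R :> R.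
  rewrite -!natrM; congr (_%:R); rewrite addSn.
  by have := mul_bin_down (j + K).+1 K; rewrite subSn ?leq_addl// addnK /= => ->.
rewrite /inv_bin.
have b1 := lt0r_neq0 (bin_gt0R K j); have b2 := lt0r_neq0 (bin_gt0R K j.+1).
by apply/eqP; rewrite eqr_div// H.
Qed.

Lemma inv_binSr K j : (j + K.+1)%:R * inv_bin K.+1 j = K.+1%:R * inv_bin K j.
Proof.
have H : K.+1%:R * 'C(j + K.+1, K.+1)%:R = (j + K.+1)%:R * 'C(j + K, K)%:R :> R.
  by rewrite -!natrM; congr (_%:R); rewrite addnS mul_bin_diag.
rewrite /inv_bin.
have b1 := lt0r_neq0 (bin_gt0R K j); have b2 := lt0r_neq0 (bin_gt0R K.+1 j).
by apply/eqP; rewrite eqr_div// H.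
Qed.

Lemma inv_bin0 K : inv_bin K 0 = 1. Proof. by rewrite /inv_bin add0n binn invr1. Qed.

Lemma inv_bin_le K j i : (i <= j)%N -> inv_bin K j <= inv_bin K i.
Proof.
move=> ij; rewrite lef_pV2 ?posrE ?bin_gt0R// ler_nat.
by apply: leq_bin2l; rewrite leq_add2r.
Qed.

Lemma inv_bin_le1 K j : inv_bin K j <= 1.
Proof. by rewrite -(inv_bin0 K); exact: inv_bin_le. Qed.

Lemma inv_bin_leK K j : (0 < j)%N -> inv_bin K j <= K.+1%:R^-1.
Proof.
move=> j0; apply: le_trans (inv_bin_le K j0) _.
by rewrite /inv_bin add1n binSn.
Qed.

Lemma inv_bin_lej K j : (0 < K)%N -> inv_bin K j <= j.+1%:R^-1.
Proof.
move=> K0; rewrite lef_pV2 ?posrE ?bin_gt0R// ler_nat.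
have -> : j.+1 = 'C(j + 1, 1) by rewrite bin1 addn1.
rewrite -bin_sub ?leq_addl// addnK -[X in (_ <= X)%N]bin_sub ?leq_addl// addnK.
by apply: leq_bin2l; rewrite leq_add2l.
Qed.

Lemma inv_bin_telescope K j : inv_bin K j - inv_bin K j.+1 = K%:R * (inv_bin K j.+1 / j.+1%:R).
Proof.
have := inv_binSl K j; rewrite natrD => H.
have j0 : j.+1%:R != 0 :> R by rewrite pnatr_eq0.
apply: (mulfI j0); rewrite mulrBr -H.
by field.
Qed.

Lemma cvg_inv_bin K : (0 < K)%N -> inv_bin K j @[j --> \oo] --> (0 : R).
Proof.
move=> K0; apply: (@squeeze_cvgr _ _ _ _ (fun=> 0) (@harmonic R)).
- by apply: nearW => j; rewrite (ltW (inv_bin_gt0 _ _))/=; exact: inv_bin_lej.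
- exact: cvg_cst.
- exact: cvg_harmonic.
Qed.

Lemma cvg_harmonic_sum_ratio : (harmonic_sum j.+1 * j.+1%:R^-1 : R) @[j --> \oo] --> (0 : R).
Proof.
rewrite -(cvg_shiftS (fun j => harmonic_sum j.+1 * j.+1%:R^-1)).
apply: (@squeeze_cvgr _ _ _ _ (fun=> 0) (fun n => arithmetic_mean (@harmonic R) n)).
- apply: nearW => n; rewrite /arithmetic_mean /harmonic_sum /series/= big_add1/=.
  have S0 : 0 <= \sum_(0 <= i < n.+1) i.+1%:R^-1 :> R.
    by apply: sumr_ge0 => i _; rewrite invr_ge0.
  rewrite mulr_ge0//= ?invr_ge0// mulrC ler_wpM2r//.
  by rewrite lef_pV2 ?posrE// ler_nat.
- exact: cvg_cst.
- by apply: cesaro; exact: cvg_harmonic.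
Qed.

(** The summand is a difference in j, by [inv_bin_telescope]. *)
Lemma sum_inv_bin K : (0 < K)%N ->
  summable (fun j => inv_bin K j / j%:R) /\ sum_pos (fun j => inv_bin K j / j%:R) = K%:R^-1.
Proof.
move=> K0; have KR : K%:R != 0 :> R by rewrite pnatr_eq0 -lt0n.
have /sum_pos_telescope/= [] : - inv_bin K j.-1 @[j --> \oo] --> - (0 : R).
  apply: cvgN; rewrite -(cvg_shiftS (fun j => inv_bin K j.-1)).
  exact: cvg_inv_bin.
have E j : (0 < j)%N -> K%:R^-1 * (- inv_bin K j - - inv_bin K j.-1) = inv_bin K j / j%:R.
  by case: j => // j _; rewrite opprK addrC/= inv_bin_telescope mulKf.
move=> sd Ed; split; first exact: eq_summable E (summableZ _ sd).
rewrite -(eq_sum_pos E) (sum_posZ _ sd) Ed oppr0 add0r opprK inv_bin0 mulr1//.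
Qed.

(** Summation by parts against the harmonic numbers reduces this to
[sum_inv_bin]. *)
Lemma sum_harmonic_inv_bin K : (0 < K)%N ->
  summable (fun j => harmonic_sum j * (inv_bin K j / j%:R)) /\
  sum_pos (fun j => harmonic_sum j * (inv_bin K j / j%:R)) = (K%:R ^+ 2)^-1 :> R.
Proof.
move=> K0; have KR : K%:R != 0 :> R by rewrite pnatr_eq0 -lt0n.
have /sum_pos_telescope/= [] : - (harmonic_sum j * inv_bin K j.-1) @[j --> \oo] --> - (0 : R).
  apply: cvgN; rewrite -(cvg_shiftS (fun j => harmonic_sum j * inv_bin K j.-1))/=.
  apply: (@squeeze_cvgr _ _ _ _ (fun=> 0) (fun j => harmonic_sum j.+1 * j.+1%:R^-1 : R)).
  - apply: nearW => j.
    have H0 : 0 <= harmonic_sum j.+1 :> R by apply: sumr_ge0 => i _; rewrite invr_ge0.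
    by rewrite mulr_ge0 ?(ltW (inv_bin_gt0 _ _))//= ler_wpM2l// inv_bin_lej.
  - exact: cvg_cst.
  - exact: cvg_harmonic_sum_ratio.
have [sc Ec] := sum_inv_bin K0.
have E j : (0 < j)%N -> K%:R^-1 * ((- (harmonic_sum j.+1 * inv_bin K j) - - (harmonic_sum j * inv_bin K j.-1)) +
    inv_bin K j / j%:R) = harmonic_sum j * (inv_bin K j / j%:R).
  case: j => // j _; rewrite opprK (@harmonic_sumS _ j.+1)//=.
  have -> : inv_bin K j = inv_bin K j.+1 + K%:R * (inv_bin K j.+1 / j.+1%:R).
    by rewrite -inv_bin_telescope; ring.
  have j0 : j.+1%:R != 0 :> R by rewrite pnatr_eq0.
  by move: j.+1%:R j0 => x x0; field; rewrite ?KR ?x0.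
move=> sd Ed; have sde := summableD sd sc.
split; first exact: eq_summable E (summableZ _ sde).
rewrite -(eq_sum_pos E) (sum_posZ _ sde) sum_posD// Ed Ec /harmonic_sum big_geq//.
by rewrite mul0r !oppr0 add0r add0r -invfM expr2.
Qed.

(** The absolute values of the limits for C(t - 1, m) in [regular_binpoly]; the
signs are alternating and are split off. *)
Definition inv_weight m : R := m.+1%:R^-1.
Definition harmonic_weight m : R := harmonic_sum m.+1 / m.+1%:R.

Lemma harmonic_sum_ge0 n : 0 <= harmonic_sum n :> R.
Proof. by apply: sumr_ge0 => i _; rewrite invr_ge0. Qed.

(** Induction on the truncated sum with the explicit remainder
2 (H_n + 2) / (n + 1), a discrete primitive of (H + 1) / j^2 up to a positive
error. *)
Lemma weight_bound : summable (fun j => (harmonic_sum j + 1) / (j * j)%:R : R) /\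
  sum_pos (fun j => (harmonic_sum j + 1) / (j * j)%:R : R) <= 4.
Proof.
apply: bounded_summable => [j j0|n].
  by rewrite divr_ge0// addr_ge0 ?harmonic_sum_ge0.
have H : series (fun j => (harmonic_sum j.+1 + 1) / (j.+1 * j.+1)%:R) n <=
    4 - 2 * ((harmonic_sum n.+1 + 2) / n.+1%:R) :> R.
  elim: n => [|n IH].
    by rewrite /series/= big_geq// /harmonic_sum big_geq// add0r; lra.
  rewrite /series/= big_nat_recr//= -/(series _ n).
  apply: le_trans (lerD IH (lexx _)) _.
  rewrite (@harmonic_sumS _ n.+1)// natrM -[n.+2%:R]natr1.
  have x1 : 1 <= n.+1%:R :> R by rewrite ler1n.
  move: (n.+1%:R : R) x1 (harmonic_sum_ge0 n.+1) => x x1 h0; set h := harmonic_sum _ in h0 *.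
  have x0 : x != 0 by apply: lt0r_neq0; lra.
  have x10 : x + 1 != 0 by apply: lt0r_neq0; lra.
  rewrite -subr_ge0.
  have -> : 4 - 2 * ((h + x^-1 + 2) / (x + 1)) - (4 - 2 * ((h + 2) / x) + (h + 1) / (x * x))
      = (h + 1) * (x - 1) / (x * x * (x + 1)).
    by field; rewrite x0 x10.
  by rewrite divr_ge0 ?mulr_ge0//; lra.
apply: le_trans H _.
have : 0 <= (harmonic_sum n.+1 + 2) / n.+1%:R :> R by rewrite divr_ge0// addr_ge0 ?harmonic_sum_ge0.
by move: (_ / _) => x; lra.
Qed.

Definition tail_term (w : nat -> R) K j : R := w j.-1 / j%:R * inv_bin K j.

(** What the estimates use about the two weights, so that both are treated at
once. *)
Definition good_weight (w : nat -> R) := forall m, 0 <= w m <= (harmonic_sum m.+1 + 1) / m.+1%:R.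

Lemma good_inv_weight : good_weight inv_weight.
Proof.
move=> m; rewrite invr_ge0 ler0n/= -[inv_weight m]mul1r ler_wpM2r ?invr_ge0//.
by rewrite lerDr harmonic_sum_ge0.
Qed.

Lemma good_harmonic_weight : good_weight harmonic_weight.
Proof.
move=> m; rewrite mulr_ge0 ?harmonic_sum_ge0 ?invr_ge0//= ler_wpM2r ?invr_ge0//.
by rewrite lerDl.
Qed.

(** The terms of index greater than m. *)
Definition tail_sum (w : nat -> R) K m : R := sum_pos (fun j => tail_term w K (m + j)).

Lemma good_weight_term w : good_weight w -> forall j, (0 < j)%N ->
  0 <= w j.-1 / j%:R <= (harmonic_sum j + 1) / (j * j)%:R.
Proof.
move=> gw [//|j] _ /=; have /andP[w0 wle] := gw j.
by rewrite mulr_ge0 ?invr_ge0//= natrM invfM mulrA ler_wpM2r ?invr_ge0.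
Qed.

Lemma summable_weight w : good_weight w ->
  summable (fun j => w j.-1 / j%:R) /\ sum_pos (fun j => w j.-1 / j%:R) <= 4.
Proof.
move=> gw; have [sW bW] := weight_bound; have B := good_weight_term gw.
have sw : summable (fun j => w j.-1 / j%:R) by exact: le_summable B sW.
split=> //; apply: le_trans bW; apply: le_sum_pos => // j j0.
by have /andP[] := B j j0.
Qed.

Lemma summable_tail u m : @summable R u -> summable (fun j => u (m + j)%N).
Proof.
move=> su; elim: m => [//|m IH].
apply: eq_summable (summable_shift IH) => j _.
by rewrite addSnnS.
Qed.

Lemma sum_pos_tail_le u m : (forall j, (0 < j)%N -> 0 <= u j) -> @summable R u ->
  sum_pos (fun j => u (m + j)%N) <= sum_pos u.
Proof.
move=> u0 su; elim: m => [|m IH]; first exact: lexx.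
apply: le_trans IH.
have := sum_pos_shift (summable_tail m su).
rewrite (@eq_sum_pos _ (fun k => u (m + k.+1)%N) (fun k => u (m.+1 + k)%N)); last first.
  by move=> k _; rewrite addSnnS.
by move=> ->; rewrite lerBlDr lerDl u0// addn1.
Qed.

Lemma summable_tail_term w K : good_weight w -> summable (tail_term w K).
Proof.
move=> gw; have [sw _] := summable_weight gw.
apply: le_summable sw => j j0.
have /andP[w0 _] := good_weight_term gw j0.
rewrite mulr_ge0 ?(ltW (inv_bin_gt0 _ _))//=.
by rewrite ler_piMr// inv_bin_le1.
Qed.

Lemma tail_sumS w K m : good_weight w ->
  tail_sum w K m.+1 = tail_sum w K m - tail_term w K m.+1.
Proof.
move=> gw; rewrite /tail_sum.
rewrite -[in RHS]addn1 -(sum_pos_shift (summable_tail m (summable_tail_term K gw))).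
by apply: eq_sum_pos => j _; rewrite addSnnS.
Qed.

(** Up to the sign (-1)^m, the value of a functional at C(t - 1, m) / (t + K), as
[regular_binpoly_pole] shows; which functional depends on the weight.  It solves
the recurrence [eval_tailS], whose homogeneous solution C(m + K, K) is unbounded when
K > 0: writing the right solution as a tail is what makes its boundedness visible. *)
Definition eval_tail w K m : R := tail_sum w K m / inv_bin K m.

Lemma eval_tailS w K m : good_weight w ->
  eval_tail w K m.+1 = ((m.+1 + K)%:R * eval_tail w K m - w m) / m.+1%:R.
Proof.
move=> gw; rewrite /eval_tail tail_sumS// /tail_term/=.
have c0 := lt0r_neq0 (inv_bin_gt0 K m); have c1 := lt0r_neq0 (inv_bin_gt0 K m.+1).
have m0 : m.+1%:R != 0 :> R by rewrite pnatr_eq0.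
have H := inv_binSl K m.
have mk : (m.+1 + K)%:R = m.+1%:R * inv_bin K m / inv_bin K m.+1 by rewrite -H mulfK.
by rewrite mk; move: m.+1%:R m0 => x x0; field; rewrite ?c0 ?c1 ?x0.
Qed.

(** In the tail beyond m the factor 1 / C(j + K, K) is at most its value at m,
which cancels against the denominator; what remains is bounded by
[summable_weight]. *)
Lemma eval_tail_bound w K m : good_weight w -> 0 <= eval_tail w K m <= 4.
Proof.
move=> gw; have [sw bw] := summable_weight gw.
have B := good_weight_term gw.
have st := summable_tail m (summable_tail_term K gw).
have c0 := inv_bin_gt0 K m.
apply/andP; split.
  rewrite divr_ge0 ?(ltW c0)//; apply: sum_pos_ge0 st => j j0.
  rewrite /tail_term mulr_ge0 ?(ltW (inv_bin_gt0 _ _))//.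
  by have mj : (0 < m + j)%N by [rewrite addn_gt0 j0 orbT]; have /andP[] := B _ mj.
rewrite ler_pdivrMr//.
apply: (@le_trans _ _ (inv_bin K m * sum_pos (fun j => w (m + j).-1 / (m + j)%:R))).
  have sw' := summable_tail m sw.
  rewrite -(sum_posZ _ sw'); apply: le_sum_pos => //; last exact: summableZ.
  move=> j j0; rewrite /tail_term mulrC ler_wpM2r//; last exact/inv_bin_le/leq_addr.
  by have mj : (0 < m + j)%N by [rewrite addn_gt0 j0 orbT]; have /andP[] := B _ mj.
rewrite mulrC ler_wpM2r ?(ltW c0)//.
apply: le_trans bw; apply: (@sum_pos_tail_le (fun j => w j.-1 / j%:R)) => // j j0.
by have /andP[] := B j j0.
Qed.

(** 1 / C(j + K, K) - 1 / C(j + K + 1, K + 1) is j / (K + 1) times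
1 / C(j + K + 1, K + 1). *)
Lemma tail_sum_diff w K : good_weight w ->
  tail_sum w K 0 - tail_sum w K.+1 0 = K.+1%:R^-1 * sum_pos (fun j => w j.-1 * inv_bin K.+1 j) /\
  summable (fun j => w j.-1 * inv_bin K.+1 j).
Proof.
move=> gw; have s0 := summable_tail_term K gw; have s1 := summable_tail_term K.+1 gw.
have K0 : K.+1%:R != 0 :> R by rewrite pnatr_eq0.
have E j : (0 < j)%N -> K.+1%:R * (tail_term w K j + -1 * tail_term w K.+1 j) =
    w j.-1 * inv_bin K.+1 j.
  move=> j0; have := inv_binSr K j; rewrite natrD => H.
  have jn : j%:R != 0 :> R by rewrite pnatr_eq0 -lt0n.
  rewrite /tail_term; transitivity (w j.-1 / j%:R * (K.+1%:R * inv_bin K j) - w j.-1 / j%:R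
    * K.+1%:R * inv_bin K.+1 j).
    by ring.
  by rewrite -H; field.
have s2 := summableZ (-1) s1; have s3 := summableD s0 s2.
split; last exact: eq_summable E (summableZ _ s3).
rewrite -(eq_sum_pos E) (sum_posZ _ s3) mulKf// sum_posD// (sum_posZ _ s1) mulN1r.
by rewrite /tail_sum; under eq_sum_pos do rewrite add0n.
Qed.

Lemma tail_sum_bound w K : good_weight w -> 0 <= tail_sum w K 0 <= 4 * K.+1%:R^-1.
Proof.
move=> gw; have [sw bw] := summable_weight gw.
have B := good_weight_term gw; have s0 := summable_tail_term K gw.
apply/andP; split.
  apply: sum_pos_ge0 s0 => j j0; rewrite mulr_ge0 ?(ltW (inv_bin_gt0 _ _))//.
  by have /andP[] := B j j0.
apply: (@le_trans _ _ (K.+1%:R^-1 * sum_pos (fun j => w j.-1 / j%:R))).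
  rewrite -(sum_posZ _ sw); apply: le_sum_pos => //; last exact: summableZ.
  move=> j j0; rewrite [_^-1 * _]mulrC ler_wpM2l// ?inv_bin_leK//.
  by have /andP[] := B j j0.
by rewrite mulrC ler_wpM2r// invr_ge0.
Qed.

Lemma zeta_tail_bound s K : (1 < s)%N -> 0 <= (zeta_tail s K : R) <= 2 * K.+1%:R^-1.
Proof.
move=> s1; have [sd Ed] := @summable_pole_telescope R K.
have st := @summable_zeta_tail R s K s1.
apply/andP; split.
  by apply: sum_pos_ge0 st => j j0; rewrite invr_ge0 exprn_ge0// addr_ge0.
have -> : K.+1%:R^-1 = sum_pos (fun nu => pole K nu%:R - pole K.+1 nu%:R) :> R.
  by rewrite Ed /pole nat1r.
rewrite -(sum_posZ _ sd); apply: le_sum_pos => //; last exact: summableZ.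
move=> j j0; rewrite poleB ?ltr0n// /pole -[K.+1%:R]natr1 addrA.
have j1 : 1 <= j%:R :> R by rewrite ler1n.
have k0 : 0 <= K%:R :> R by [].
set x := j%:R + K%:R; have x1 : 1 <= x by rewrite /x; lra.
rewrite -invfM -[2]invrK -invfM lef_pV2 ?posrE ?exprn_gt0 ?mulr_gt0 ?invr_gt0//; try lra.
apply: (@le_trans _ _ (x ^+ 2)); last exact: ler_weXn2l.
by rewrite expr2 mulrCA; apply: ler_wpM2l; lra.
Qed.

Lemma harmonic_bound_eq0 (D B : R) : (forall K, `|D| <= B * K.+1%:R^-1) -> D = 0.
Proof.
move=> H; apply/eqP; rewrite -normr_le0.
have c : B * K.+1%:R^-1 @[K --> \oo] --> (0 : R).
  by rewrite -[X in _ --> X](mulr0 B); apply: cvgM; [exact: cvg_cst | exact: cvg_harmonic].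
rewrite -(cvg_lim _ c)//; apply: limr_ge; last exact: nearW.
by apply/cvg_ex; exists 0.
Qed.

(** Two sequences in K with the same increments that both tend to 0. *)
Lemma tail_sum_zeta w s K : good_weight w -> (1 < s)%N ->
  (forall k, tail_sum w k 0 - tail_sum w k.+1 0 = (k.+1%:R ^+ s)^-1) ->
  tail_sum w K 0 = zeta_tail s K.
Proof.
move=> gw s1 Hd; apply/eqP; rewrite -subr_eq0; apply/eqP.
(* The difference is constant in K, and O(1 / K). *)
have H n : tail_sum w K 0 - zeta_tail s K = tail_sum w (K + n) 0 - zeta_tail s (K + n).
  elim: n => [|n ->]; first by rewrite addn0.
  rewrite addnS (@zeta_tailS _ s (K + n))// -(Hd (K + n)%N).
  by ring.
apply: (@harmonic_bound_eq0 _ 4) => n; rewrite (H n).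
have /andP[a0 a1] := tail_sum_bound (K + n) gw.
have /andP[b0 b1] := @zeta_tail_bound s (K + n) s1.
have c : (K + n).+1%:R^-1 <= n.+1%:R^-1 :> R.
  by rewrite lef_pV2 ?posrE// ler_nat ltnS leq_addl.
have c0 : 0 <= (K + n).+1%:R^-1 :> R by rewrite invr_ge0.
move: (_.+1%:R^-1) c0 (n.+1%:R^-1) c a1 b1 => x x0 y xy a1 b1.
by rewrite ler_norml; apply/andP; split; lra.
Qed.

(** This identifies the value at m = 0, where the functional was computed as a
tail of the zeta series. *)
Lemma tail_sum_inv_weight K : tail_sum inv_weight K 0 = zeta_tail 2 K.
Proof.
apply: tail_sum_zeta => // [|k]; first exact: good_inv_weight.
have [-> _] := tail_sum_diff k good_inv_weight.
have [_ E] := @sum_inv_bin k.+1 isT.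
rewrite (@eq_sum_pos _ _ (fun j => inv_bin k.+1 j / j%:R)); last first.
  by case=> // j _; rewrite mulrC.
by rewrite E -invfM expr2.
Qed.

Lemma tail_sum_harmonic_weight K : tail_sum harmonic_weight K 0 = zeta_tail 3 K.
Proof.
apply: tail_sum_zeta => // [|k]; first exact: good_harmonic_weight.
have [-> _] := tail_sum_diff k good_harmonic_weight.
have [_ E] := @sum_harmonic_inv_bin k.+1 isT.
rewrite (@eq_sum_pos _ _ (fun j => harmonic_sum j * (inv_bin k.+1 j / j%:R))); last first.
  by case=> // j _; rewrite /harmonic_weight/= -mulrA [_^-1 * _]mulrC.
by rewrite E -invfM exprS.
Qed.

(** Induction on m: (t - m - 1) / (t + K) = 1 - (m + 1 + K) / (t + K) reduces
C(t - 1, m + 1) / (t + K) to C(t - 1, m) and C(t - 1, m) / (t + K). *)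
Lemma regular_binpoly_pole K m : regular (fun t => (binpoly m).[t] * pole K t)
  ((-1) ^+ m * eval_tail inv_weight K m) ((-1) ^+ m * eval_tail harmonic_weight K m).
Proof.
elim: m => [|m IH].
  rewrite /eval_tail tail_sum_inv_weight tail_sum_harmonic_weight inv_bin0 !divr1 !mul1r.
  by apply: regular_eq (regular_pole K) => t _; rewrite binpoly0 hornerC mul1r.
have m0 : m.+1%:R != 0 :> R by rewrite pnatr_eq0.
have := regularZ m.+1%:R^-1 (regularD (@regular_binpoly R m) (regularZ (- (m.+1 + K)%:R) IH)).
have -> : m.+1%:R^-1 * (log_coef m.+1 + - (m.+1 + K)%:R * ((-1) ^+ m * eval_tail inv_weight K m)) =
    (-1) ^+ m.+1 * eval_tail inv_weight K m.+1.
  rewrite eval_tailS; last exact: good_inv_weight.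
  by rewrite /log_coef /inv_weight !exprS; field.
have -> : m.+1%:R^-1 * (- sqrlog_coef m.+1 + - (m.+1 + K)%:R * ((-1) ^+ m * eval_tail harmonic_weight K m)) =
    (-1) ^+ m.+1 * eval_tail harmonic_weight K m.+1.
  rewrite eval_tailS; last exact: good_harmonic_weight.
  by rewrite /sqrlog_coef /harmonic_weight !exprS; field.
apply: regular_eq => t t0 /=; rewrite horner_binpolyS /pole natrD.
have tk : t + K%:R != 0 by apply: lt0r_neq0; rewrite ltr_wpDr.
by move: m.+1%:R m0 => x x0; field; rewrite ?x0 ?tk.
Qed.

Lemma binpoly_pole_bound K m : exists l1 l2 : R,
  [/\ regular (fun t => (binpoly m).[t] * pole K t) l1 l2, `|l1| <= 4 & `|l2| <= 4].
Proof.
exists ((-1) ^+ m * eval_tail inv_weight K m), ((-1) ^+ m * eval_tail harmonic_weight K m).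
have /andP[a0 a1] := eval_tail_bound K m good_inv_weight.
have /andP[b0 b1] := eval_tail_bound K m good_harmonic_weight.
by split; [exact: regular_binpoly_pole | |];
  rewrite normrM normrX normrN1 expr1n mul1r ger0_norm.
Qed.

End Tails.

(** * Existence and geometric bound of the linear forms *)

Section Growth.
Context {R : realType}.
Implicit Types (f F G : R -> R) (t B : R).

Definition regular_le F B := exists l1 l2 : R,
  [/\ regular F l1 l2, `|l1| <= B & `|l2| <= B].

Lemma regular_le_eq F G B : (forall t, 0 < t -> F t = G t) -> regular_le F B -> regular_le G B.
Proof. by move=> FG [l1 [l2 [r b1 b2]]]; exists l1, l2; split=> //; exact: regular_eq r. Qed.

Lemma regular_le_scale c F B : regular_le F B -> regular_le (fun t => c * F t) (`|c| * B).
Proof.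
move=> [l1 [l2 [r b1 b2]]]; exists (c * l1), (c * l2).
by split; [exact: regularZ | rewrite normrM ler_wpM2l..].
Qed.

Lemma regular_le_add F G B C : regular_le F B -> regular_le G C -> regular_le (F \+ G) (B + C).
Proof.
move=> [l1 [l2 [r b1 b2]]] [m1 [m2 [s c1 c2]]]; exists (l1 + m1), (l2 + m2).
split; first exact: regularD.
- exact: le_trans (ler_normD _ _) (lerD b1 c1).
- exact: le_trans (ler_normD _ _) (lerD b2 c2).
Qed.

Lemma regular_le_sum N (c : nat -> R) (F : nat -> R -> R) B : (forall i, regular_le (F i) B) ->
  regular_le (fun t => \sum_(0 <= i < N) c i * F i t) ((\sum_(0 <= i < N) `|c i|) * B).
Proof.
move=> bF; elim: N => [|N IH].
  have [l1 [l2 [r _ _]]] := bF 0%N.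
  exists (0 * l1), (0 * l2); split.
  - by apply: regular_eq (regularZ 0 r) => t _; rewrite big_geq// mul0r.
  - by rewrite big_geq// !mul0r normr0.
  - by rewrite big_geq// !mul0r normr0.
rewrite big_nat_recr//= mulrDl.
apply: (regular_le_eq _ (regular_le_add IH (regular_le_scale (c N) (bF N)))) => t _ /=.
by rewrite big_nat_recr.
Qed.

(** The residue at t = - k of [Qn]. *)
Definition pf_coef n k : R := (-1) ^+ (n + k) * 'C(n, k)%:R * 'C(n + k, k)%:R.

(** One of the three numerators of R_n paired with the denominator; the other two
make up the square of a binomial polynomial. *)
Definition Qn n t : R :=
  (\prod_(1 <= j < n.+1) (t - j%:R)) / (\prod_(0 <= j < n.+1) (t + j%:R)).

Lemma QnS n t : Qn n.+1 t = Qn n t * ((t - n.+1%:R) / (t + n.+1%:R)).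
Proof. by rewrite /Qn !(big_nat_recr n.+1)//= invfM mulrACA. Qed.

Lemma pf_coefS n k : (k <= n)%N ->
  pf_coef n.+1 k = - pf_coef n k * (n.+1%:R + k%:R) / (n.+1%:R - k%:R).
Proof.
move=> kn; rewrite /pf_coef addSn exprS.
have nk : n.+1%:R - k%:R != 0 :> R.
  by rewrite -natrB ?pnatr_eq0 ?subn_eq0 -?ltnNge// ltnW.
have H1 : (n.+1%:R - k%:R) * 'C(n.+1, k)%:R = n.+1%:R * 'C(n, k)%:R :> R.
  by rewrite -natrB ?leqW// -!natrM mul_bin_down.
have H2 : n.+1%:R * 'C((n + k).+1, k)%:R = (n.+1%:R + k%:R) * 'C(n + k, k)%:R :> R.
  rewrite -natrD -!natrM; congr (_%:R).
  by have := mul_bin_down (n + k).+1 k; rewrite subSn ?leq_addl// addnK addSn => ->.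
have n0 : n.+1%:R != 0 :> R by rewrite pnatr_eq0.
have -> : 'C(n.+1, k)%:R = n.+1%:R * 'C(n, k)%:R / (n.+1%:R - k%:R) :> R.
  by rewrite -H1 mulrC mulKf.
have -> : 'C((n + k).+1, k)%:R = (n.+1%:R + k%:R) * 'C(n + k, k)%:R / n.+1%:R :> R.
  by rewrite -H2 mulrC mulKf.
by move: n.+1%:R n0 nk => x x0 xk; field; rewrite ?x0 ?xk.
Qed.

Lemma prod_shift n x : \prod_(1 <= j < n.+1) (- x - j%:R) =
  (-1) ^+ n * \prod_(1 <= j < n.+1) (x + j%:R) :> R.
Proof.
elim: n => [|n IH]; first by rewrite !big_geq// mulr1.
by rewrite !(big_nat_recr n.+1)//= IH exprS; ring.
Qed.

Lemma prod_rising m n : \prod_(1 <= j < n.+1) (m%:R + j%:R) * m`!%:R = (m + n)`!%:R :> R.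
Proof.
elim: n => [|n IH]; first by rewrite big_geq// mul1r addn0.
by rewrite big_nat_recr//= mulrAC IH addnS factS natrM mulrC -natrD addnS.
Qed.

Lemma prod_falling n : \prod_(0 <= j < n.+1) (- n.+1%:R + j%:R) =
  (-1) ^+ n.+1 * n.+1`!%:R :> R.
Proof.
rewrite big_nat_rev/= add0n fact_prod natr_prod big_add1/=.
rewrite (eq_big_nat _ _ (F2 := fun i => -1 * i.+1%:R)); last first.
  move=> i /andP[_ ni]; rewrite subSS natrB; last by rewrite -ltnS.
  by rewrite -[n.+1%:R]natr1 -[i.+1%:R]natr1; ring.
by rewrite big_split/= prodr_const_nat subn0.
Qed.

(** The residue at the new pole; - 2 (n + 1) is the value of the new factor t - n - 1
of the numerator at t = - n - 1. *)
Lemma Qn_at_pole n : - (2 * n.+1%:R) * Qn n (- n.+1%:R) = pf_coef n.+1 n.+1.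
Proof.
rewrite /Qn prod_shift prod_falling.
have := prod_rising n.+1 n; set P := \prod_(_ <= _ < _) _ => HP.
have f0 : n.+1`!%:R != 0 :> R by rewrite pnatr_eq0 -lt0n fact_gt0.
have n0 : n.+1%:R != 0 :> R by rewrite pnatr_eq0.
have f0' : n`!%:R != 0 :> R by rewrite pnatr_eq0 -lt0n fact_gt0.
have PE : P = (n.+1 + n)`!%:R / n.+1`!%:R by rewrite -HP mulfK.
rewrite PE /pf_coef binn mulr1 exprD -expr2 sqrr_sign mul1r.
have HB : 'C(n.+1 + n.+1, n.+1)%:R * (n.+1`!%:R * n.+1`!%:R) = (n.+1 + n.+1)`!%:R :> R.
  by rewrite -!natrM -(bin_fact (leq_addl n.+1 n.+1)) addnK.
have HF : (n.+1 + n.+1)`!%:R = (n.+1 + n.+1)%:R * (n.+1 + n)`!%:R :> R.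
  by rewrite -natrM addnS factS.
have -> : 'C(n.+1 + n.+1, n.+1)%:R =
    (n.+1 + n.+1)%:R * (n.+1 + n)`!%:R / (n.+1`!%:R * n.+1`!%:R) :> R.
  by rewrite -HF -HB mulfK// mulf_neq0.
have -> : (n.+1 + n.+1)%:R = 2 * n.+1%:R :> R by rewrite natrD; ring.
have s0 : (-1) ^+ n != 0 :> R by rewrite signr_eq0.
move: n.+1%:R n0 n.+1`!%:R f0 => x x0 y y0.
by rewrite exprS; field; rewrite ?s0 ?y0.
Qed.

(** Induction on n.  The induction hypothesis is used twice: at t, and at the new
pole - n - 1, where it gives the residue. *)
Lemma partial_fractions n t : (forall k, (k <= n)%N -> t + k%:R != 0) ->
  Qn n t = \sum_(0 <= k < n.+1) pf_coef n k / (t + k%:R).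
Proof.
elim: n t => [|n IH] t ht.
  by rewrite /Qn big_geq// !big_nat1 /pf_coef bin0 !mul1r addr0.
rewrite QnS IH => [|k kn]; last exact/ht/leqW.
rewrite [RHS]big_nat_recr//= -Qn_at_pole IH => [|k kn]; last first.
  by rewrite addrC subr_eq0 eqr_nat ltn_eqF.
have tn := ht _ (leqnn n.+1).
rewrite mulr_suml mulr_sumr mulr_suml -big_split/=.
apply: eq_big_nat => k /andP[_ kn].
have tk := ht k (ltnW kn).
rewrite pf_coefS//.
have nk : - n.+1%:R + k%:R != 0 :> R by rewrite addrC subr_eq0 eqr_nat ltn_eqF.
have nk' : n.+1%:R - k%:R != 0 :> R by rewrite subr_eq0 eqr_nat gtn_eqF.
move: n.+1%:R tn nk nk' => x tn nk nk'.
by field; rewrite ?tn ?nk ?nk' ?tk.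
Qed.

Lemma binpoly_prod n t : (binpoly n).[t] = \prod_(1 <= j < n.+1) (t - j%:R) / n`!%:R.
Proof.
elim: n => [|n IH]; first by rewrite binpoly0 hornerC big_geq// divr1.
have F : n.+1`!%:R = n.+1%:R * n`!%:R :> R by rewrite factS natrM.
by rewrite F horner_binpolyS IH [in RHS]big_nat_recr//= invfM; ring.
Qed.

Lemma Rn_split n t : Rn n t = (binpoly n).[t] ^+ 2 * Qn n t.
Proof.
rewrite /Rn /Qn binpoly_prod.
set P := \prod_(1 <= j < n.+1) (t - j%:R); set Q := \prod_(0 <= j < n.+1) (t + j%:R).
by rewrite invfM -exprVn exprMn; ring.
Qed.

(** The binomial coefficient C(x, m) for real x. *)
Definition rbin (x : R) m : R := \prod_(j < m) ((x - j%:R) / j.+1%:R).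

Lemma rbinS x m : rbin x m.+1 = rbin x m * ((x - m%:R) / m.+1%:R).
Proof. by rewrite /rbin big_ord_recr. Qed.

Lemma rbin0 x : rbin x 0 = 1. Proof. by rewrite /rbin big_ord0. Qed.

Lemma rbin_pascal x m : rbin (x + 1) m.+1 = rbin x m.+1 + rbin x m.
Proof.
elim: m => [|m IH]; first by rewrite !rbinS !rbin0; field.
rewrite rbinS IH !rbinS.
have m1 : m.+1%:R != 0 :> R by rewrite pnatr_eq0.
have -> : m.+2%:R = m.+1%:R + 1 :> R by rewrite natr1.
have m2 : m.+1%:R + 1 != 0 :> R by rewrite natr1 pnatr_eq0.
have -> : m%:R = m.+1%:R - 1 :> R by rewrite -natr1 addrK.
by move: m.+1%:R m1 m2 => y m1 m2; field; rewrite ?m1 ?m2.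
Qed.

(** Vandermonde's convolution, by induction on n with Pascal's rule. *)
Lemma vandermonde x n m :
  rbin (x + n%:R) m = \sum_(0 <= i < m.+1) 'C(n, m - i)%:R * rbin x i.
Proof.
elim: n m => [|n IH] m.
  rewrite addr0 big_nat_recr//= subnn bin0 mul1r big_nat_cond big1 ?add0r// => i.
  by rewrite andbT => /andP[_ im]; rewrite bin_small ?mul0r ?subn_gt0.
rewrite -natr1 addrA; case: m => [|m].
  by rewrite rbin0 big_nat1 rbin0 subnn bin0 mulr1.
rewrite rbin_pascal !IH (big_nat_recr m.+1)//= [in RHS](big_nat_recr m.+1)//=.
rewrite addrAC -big_split/= subnn !bin0; congr (_ + _).
by apply: eq_big_nat => i /andP[_ im]; rewrite subSn// binS natrD; ring.
Qed.

Lemma rbin_binpoly m t : (binpoly m).[t] = rbin (t - 1) m.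
Proof.
elim: m => [|m IH]; first by rewrite binpoly0 hornerC rbin0.
by rewrite horner_binpolyS rbinS IH -[m.+1%:R]natr1; congr (_ * (_ / _)); ring.
Qed.

Lemma rbin_mul_shift x n i :
  'C(n + i, i)%:R * rbin x (n + i) = rbin x n * rbin (x - n%:R) i.
Proof.
elim: i => [|i IH]; first by rewrite addn0 bin0 rbin0 mul1r mulr1.
rewrite addnS (rbinS x (n + i)) (rbinS (x - n%:R) i) [RHS]mulrA -IH.
have i0 : i.+1%:R != 0 :> R by rewrite pnatr_eq0.
have H : i.+1%:R * 'C((n + i).+1, i.+1)%:R = (n + i).+1%:R * 'C(n + i, i)%:R :> R.
  by rewrite -!natrM mul_bin_diag.
have ni0 : (n + i).+1%:R != 0 :> R by rewrite pnatr_eq0.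
have -> : 'C((n + i).+1, i.+1)%:R = (n + i).+1%:R * 'C(n + i, i)%:R / i.+1%:R :> R.
  by rewrite -H mulrC mulKf.
rewrite natrD; move: (n + i).+1%:R ni0 i.+1%:R i0 => y y0 z z0.
by field; rewrite ?y0 ?z0.
Qed.

(** Linearization: expand one factor C(t - 1, n) by Vandermonde around t - 1 - n,
and absorb the other one into each term. *)
Lemma binpoly_sqr n t : (binpoly n).[t] ^+ 2 =
  \sum_(0 <= i < n.+1) ('C(n, i)%:R * 'C(n + i, i)%:R) * (binpoly (n + i)).[t].
Proof.
rewrite expr2 {2}rbin_binpoly -[t - 1](subrK n%:R) vandermonde big_distrr/=.
apply: eq_big_nat => i /andP[_ im].
by rewrite bin_sub// -mulrA !rbin_binpoly rbin_mul_shift; ring.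
Qed.

(** The central Delannoy numbers. *)
Definition delannoy n : R := \sum_(0 <= k < n.+1) 'C(n, k)%:R * 'C(n + k, k)%:R.

(** One term of the binomial expansion of (5/7 + 2/7)^(n + k) = 1. *)
Lemma bin_weight n k : 'C(n + k, k)%:R * ((2 / 7) ^+ k * (5 / 7) ^+ n) <= 1 :> R.
Proof.
have e : (5 / 7 + 2 / 7 : R) ^+ (n + k) = 1 by rewrite (_ : _ + _ = 1) ?expr1n//; field.
rewrite -[X in _ <= X]e exprDn.
have kn : (k < (n + k).+1)%N by rewrite ltnS leq_addl.
rewrite (bigD1 (Ordinal kn))//= addnK mulr_natl [_ ^+ k * _]mulrC.
rewrite lerDl sumr_ge0// => i _; rewrite mulrn_wge0// mulr_ge0// exprn_ge0//; lra.
Qed.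

(** The exact growth rate is 3 + 2 sqrt 2, near 5.83; the weights 2/7 and 5/7
give 6.3, and any rate whose square is below 54.96 would do. *)
Lemma delannoy_bound n : delannoy n <= (63 / 10) ^+ n.
Proof.
apply: (@le_trans _ _ (\sum_(0 <= k < n.+1) 'C(n, k)%:R * ((7 / 2) ^+ k * (7 / 5) ^+ n))).
  apply: ler_sum_nat => k _; rewrite ler_wpM2l//.
  have p : 0 < (2 / 7) ^+ k * (5 / 7) ^+ n :> R by rewrite mulr_gt0// exprn_gt0//; lra.
  rewrite -(ler_pM2r p); apply: le_trans (bin_weight n k) _.
  have e1 : 7 / 2 * (2 / 7) = 1 :> R by lra.
  have e2 : 7 / 5 * (5 / 7) = 1 :> R by lra.
  by rewrite mulrACA -!exprMn e1 e2 !expr1n mulr1.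
have -> : (63 / 10 : R) = (1 + 7 / 2) * (7 / 5) by lra.
rewrite big_mkord [X in _ <= X]exprMn [X in _ <= X * _]exprDn mulr_suml.
apply: ler_sum => k _.
by rewrite expr1n mul1r mulrA [X in X * _ <= _]mulr_natl.
Qed.

Lemma Rn_regular_le n : regular_le (Rn n) ((63 / 10) ^+ n * ((63 / 10) ^+ n * 4)).
Proof.
have b1 k : regular_le (fun t => (binpoly n).[t] ^+ 2 * pole k t) (delannoy n * 4).
  have := @regular_le_sum n.+1 (fun i => 'C(n, i)%:R * 'C(n + i, i)%:R)
    (fun i t => (binpoly (n + i)).[t] * pole k t) 4 (fun i => binpoly_pole_bound k (n + i)).
  under eq_bigr do rewrite ger0_norm//.
  apply: regular_le_eq => t _; rewrite binpoly_sqr big_distrl/=.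
  by apply: eq_bigr => i _; rewrite mulrA.
have := @regular_le_sum n.+1 (pf_coef n) (fun k t => (binpoly n).[t] ^+ 2 * pole k t) _ b1.
have -> : \sum_(0 <= i < n.+1) `|pf_coef n i| = delannoy n.
  by apply: eq_bigr => i _; rewrite /pf_coef -mulrA normrM normrX normrN1 expr1n mul1r ger0_norm.
move=> [l1 [l2 [r c1 c2]]].
have d0 : 0 <= delannoy n by apply: sumr_ge0 => i _; rewrite mulr_ge0.
have B : delannoy n * (delannoy n * 4) <= (63 / 10) ^+ n * ((63 / 10) ^+ n * 4).
  by apply: ler_pM; rewrite ?mulr_ge0 ?ler_wpM2r ?delannoy_bound.
exists l1, l2; split; [|exact: le_trans B|exact: le_trans B].
apply: regular_eq r => t t0; rewrite Rn_split partial_fractions; last first.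
  by move=> k _; rewrite gt_eqF// ltr_wpDr.
by rewrite big_distrr/=; apply: eq_bigr => k _; rewrite /pole mulrCA.
Qed.

Lemma rt_value n l1 l2 : regular (Rn n) l1 l2 -> rt R n = l1 /\ rtt R n = l2.
Proof. by move=> /regular_rt[c1 c2]; split; exact: cvg_lim. Qed.

Lemma rt_cvg n : cvg (rt_reg n z @[z --> (1 : R)^'-]) /\
  cvg (rtt_reg n z @[z --> (1 : R)^'-]).
Proof.
have [l1 [l2 [/regular_rt[c1 c2] _ _]]] := Rn_regular_le n.
by split; apply/cvg_ex; [exists l1 | exists l2].
Qed.

Lemma rt_bound n : `|rt R n| <= 4 * 40 ^+ n /\ `|rtt R n| <= 4 * 40 ^+ n.
Proof.
have [l1 [l2 [r b1 b2]]] := Rn_regular_le n; have [-> ->] := rt_value r.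
have B : (63 / 10) ^+ n * ((63 / 10) ^+ n * 4) <= 4 * 40 ^+ n :> R.
  rewrite mulrA mulrC ler_wpM2l// -exprMn lerXn2r ?nnegrE//; lra.
by split; exact: le_trans B.
Qed.

End Growth.

(** * Creative telescoping for the linear forms *)

Section Recurrence.
Context {R : realType}.
Implicit Types (f g F G : R -> R) (t x n : R).

(** The numerator of the rational certificate, of degree 6 in t, found by
creative telescoping: its coefficients solve a linear system over Q(n), and
[certP] verifies them. *)
Definition cert (n t : R) : R :=
  ((1 * 1000 + 892) * n ^+ 5 + (3 * 1000 + 268) * n ^+ 4 + 435 * n ^+ 3
    - (1 * 1000 + 213) * n ^+ 2 - 119 * n + 153) * t ^+ 6
  + (- (17 * 1000 + 28) * n ^+ 6 - (43 * 1000 + 602) * n ^+ 5 - (29 * 1000 + 844) * n ^+ 4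
    + (5 * 1000 + 913) * n ^+ 3 + (10 * 1000 + 713) * n ^+ 2 + 153 * n - (1 * 1000 + 377)) * t ^+ 5
  + (- (34 * 1000 + 56) * n ^+ 7 - (95 * 1000 + 718) * n ^+ 6 - (85 * 1000 + 15) * n ^+ 5
    - (11 * 1000 + 666) * n ^+ 4 + (20 * 1000 + 64) * n ^+ 3 + (8 * 1000 + 96) * n ^+ 2
      - (1 * 1000 + 505) * n - (1 * 1000 + 224)) * t ^+ 4
  + ((343 * 1000 + 398) * n ^+ 8 + (1059 * 1000 + 993) * n ^+ 7 + (1088 * 1000 + 141) * n ^+ 6
    + (264 * 1000 + 513) * n ^+ 5 - (228 * 1000 + 473) * n ^+ 4 - (127 * 1000 + 162) * n ^+ 3
      + (7 * 1000 + 62) * n ^+ 2 + (15 * 1000 + 232) * n + (2 * 1000 + 448)) * t ^+ 3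
  + (- (719 * 1000 + 906) * n ^+ 8 - (2333 * 1000 + 739) * n ^+ 7 - (2592 * 1000 + 803) * n ^+ 6
    - (817 * 1000 + 663) * n ^+ 5 + (465 * 1000 + 783) * n ^+ 4 + (338 * 1000 + 938) * n ^+ 3
      + (3 * 1000 + 454) * n ^+ 2 - (38 * 1000 + 352) * n - (7 * 1000 + 344)) * n * t ^+ 2
  + ((638 * 1000 + 550) * n ^+ 8 + (2107 * 1000 + 129) * n ^+ 7 + (2409 * 1000 + 193) * n ^+ 6
    + (824 * 1000 + 838) * n ^+ 5 - (404 * 1000 + 44) * n ^+ 4 - (328 * 1000 + 223) * n ^+ 3
      - (10 * 1000 + 659) * n ^+ 2 + (36 * 1000 + 640) * n + (7 * 1000 + 344)) * n ^+ 2 * t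
  + (- (220 * 1000 + 418) * n ^+ 8 - (702 * 1000 + 835) * n ^+ 7 - (773 * 1000 + 271) * n ^+ 6
    - (252 * 1000 + 242) * n ^+ 5 + (125 * 1000 + 108) * n ^+ 4 + (99 * 1000 + 597) * n ^+ 3
      + (4 * 1000 + 725) * n ^+ 2 - (10 * 1000 + 824) * n - (2 * 1000 + 448)) * n ^+ 3
.
(** The coefficients of the recurrence as functions, which is the form in which
identities can be checked by normalization. *)
Definition rec_fun (j : nat) (n : R) : R :=
  match j with
  | 0%N => - ((946 * n ^+ 2 + 1161 * n + 368) * n * (n - 1) ^+ 3)
  | 1%N => 2 * (3784 * n ^+ 5 - 1032 * n ^+ 4 - 1925 * n ^+ 3 + 853 * n ^+ 2
            + 328 * n - 184) * n
  | 2%N => - (2 * ((104 * 1000 + 60) * n ^+ 6 + (127 * 1000 + 710) * n ^+ 5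
               + (12 * 1000 + 788) * n ^+ 4 - (34 * 1000 + 525) * n ^+ 3
               - (8 * 1000 + 482) * n ^+ 2 + 3298 * n + 1071))
  | _ => 2 * (946 * n ^+ 2 - 731 * n + 153) * (2 * n + 1) * (n + 1) ^+ 3
  end.
(** The cofactors of [rec_fun 0 n], ..., [rec_fun 3 n] on the right are R_(n-2),
R_(n-1), R_n and R_(n+1), divided by a common factor. *)
Lemma certP (n t : R) :
  t ^+ 4 * cert n (t + 1) - (t + 1 - n) ^+ 3 * (t + n + 1) * cert n t =
  rec_fun 0 n * ((n - 1) * n * (n + 1)) ^+ 2 * ((t + n - 1) * (t + n) * (t + n + 1))
  + rec_fun 1 n * (t + 1 - n) ^+ 3 * (n * (n + 1)) ^+ 2 * ((t + n) * (t + n + 1))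
  + rec_fun 2 n * ((t + 1 - n) * (t - n)) ^+ 3 * (n + 1) ^+ 2 * (t + n + 1)
  + rec_fun 3 n * ((t + 1 - n) * (t - n) * (t - n - 1)) ^+ 3.
Proof. rewrite /cert /rec_fun. ring. Qed.

Lemma rec_atE j m : (j < 4)%N -> rec_at R j m = rec_fun j m%:R.
Proof.
have H := (hornerN, hornerD, hornerM, hornerZ, hornerXn, hornerX, horner_exp, hornerC).
case: j => [|[|[|[|//]]]] _; rewrite /rec_at /rec_coef; cbn [nth rec_fun].
- by rewrite !H.
- by rewrite !H.
- by rewrite !H.
- by rewrite !H.
Qed.

Definition ex_regular F := exists l1 l2 : R, regular F l1 l2.

Lemma ex_regular_eq F G : (forall t, 0 < t -> F t = G t) -> ex_regular F -> ex_regular G.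
Proof. by move=> FG [l1 [l2 r]]; exists l1, l2; exact: regular_eq r. Qed.

Lemma ex_regularD F G : ex_regular F -> ex_regular G -> ex_regular (F \+ G).
Proof. by move=> [l1 [l2 r]] [m1 [m2 s]]; exists (l1 + m1), (l2 + m2); exact: regularD. Qed.

Lemma ex_regularZ c F : ex_regular F -> ex_regular (fun t => c * F t).
Proof. by move=> [l1 [l2 r]]; exists (c * l1), (c * l2); exact: regularZ. Qed.

(** It suffices to treat C(t - 1, m) p(t) for all m at once, since multiplication by
t maps C(t - 1, m) to (m + 1) (C(t - 1, m + 1) + C(t - 1, m)). *)
Lemma ex_regular_horner (p : {poly R}) : ex_regular (horner p).
Proof.
suff H m : ex_regular (fun t => (binpoly m).[t] * p.[t]).
  by apply: ex_regular_eq (H 0%N) => t _; rewrite binpoly0 hornerC mul1r.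
elim/poly_ind: p m => [|p c IH] m.
  apply: (@ex_regular_eq (fun t => 0 * (binpoly m).[t])).
    by move=> t _; rewrite horner0 mulr0 mul0r.
  by apply: ex_regularZ; exists (log_coef m.+1), (- sqrlog_coef m.+1); exact: regular_binpoly.
have H := ex_regularD (ex_regularD (ex_regularZ m.+1%:R (IH m.+1)) (ex_regularZ m.+1%:R (IH m)))
  (ex_regularZ c (ex_intro _ (log_coef m.+1) (ex_intro _ (- sqrlog_coef m.+1) (@regular_binpoly R m)))).
apply: ex_regular_eq H => t _ /=; rewrite hornerMXaddC.
transitivity (t * (binpoly m).[t] * p.[t] + c * (binpoly m).[t]); last by ring.
by rewrite horner_mulX_binpoly; ring.
Qed.

Lemma pole_neq0 k t : 0 < t -> t + k%:R != 0.
Proof. by move=> t0; rewrite gt_eqF// ltr_wpDr. Qed.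

Lemma ex_regular_horner_pole (p : {poly R}) k : ex_regular (fun t => p.[t] * pole k t).
Proof.
have /factor_theorem[q Hq] : root (p - p.[- k%:R]%:P) (- k%:R).
  by rewrite rootE hornerD hornerN hornerC subrr.
have H := ex_regularD (ex_regular_horner q) (ex_regularZ p.[- k%:R]
  (ex_intro _ _ (ex_intro _ _ (@regular_pole R k)))).
apply: ex_regular_eq H => t t0 /=.
have -> : p.[t] = q.[t] * (t + k%:R) + p.[- k%:R].
  have := congr1 (horner^~ t) Hq.
  rewrite hornerD hornerN hornerC hornerM hornerXsubC opprK => /eqP.
  by rewrite subr_eq => /eqP.
by rewrite /pole mulrDl mulfK// pole_neq0.
Qed.

(** Induction on the number of consecutive poles: the product of the first and last
factor is a multiple of their difference. *)
Lemma ex_regular_horner_poles (p : {poly R}) a N :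
  ex_regular (fun t => p.[t] * \prod_(i < N.+1) pole (a + i) t).
Proof.
elim: N a => [|N IH] a.
  by apply: ex_regular_eq (ex_regular_horner_pole p a) => t _; rewrite big_ord1 addn0.
apply: ex_regular_eq (ex_regularZ N.+1%:R^-1 (ex_regularD (IH a) (ex_regularZ (-1) (IH a.+1)))) => t t0 /=.
rewrite [in RHS]big_ord_recr/= [X in _ * (_ + -1 * (_ * X))]big_ord_recr/=.
rewrite [X in _ * (_ * X + _)]big_ord_recl/= [X in _ = _ * (X * _)]big_ord_recl/= addn0.
have -> : \prod_(i < N) pole (a + bump 0 i) t = \prod_(i < N) pole (a.+1 + i) t.
  by apply: eq_bigr => i _; rewrite /bump add1n addSnnS.
move: (\prod_(i < N) _) => P; rewrite /pole addSnnS.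
have a0 := pole_neq0 a t0; have a1 := pole_neq0 (a + N.+1) t0.
have N0 : N.+1%:R != 0 :> R by rewrite pnatr_eq0.
move: a1; rewrite natrD addrA; move: N.+1%:R N0 => x x0 a1.
by field; rewrite ?x0 ?a0 ?a1.
Qed.

(** The derivatives in the definition of [regular] are determined on t > 0. *)
Lemma regular_unique F l1 l2 m1 m2 : regular F l1 l2 -> regular F m1 m2 ->
  l1 = m1 /\ l2 = m2.
Proof.
move=> [F1 [F2 J]] [G1 [G2 K]].
have EF := regular_derive1 J; have EG := regular_derive1 K.
have E1 t : 0 < t -> G1 t = F1 t.
  by move=> t0; have [<- _] := EG t t0; have [<- _] := EF t t0.
have E2 t : 0 < t -> G2 t = F2 t.
  by move=> t0; have [_ <-] := EG t t0; have [_ <-] := EF t t0.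
case: J => _ _ _ c1 c2; case: K => _ _ _ d1 d2.
split.
- have d1' : log_comb1 F F1 z @[z --> (1 : R)^'-] --> m1.
    by apply: (eq_cvg_left1 _ d1) => z _; rewrite /log_comb1 (eq_power_sum _ E1).
  exact: (cvg_unique _ c1 d1').
- have d2' : log_comb2 F F1 F2 z @[z --> (1 : R)^'-] --> m2.
    by apply: (eq_cvg_left1 _ d2) => z _; rewrite /log_comb2 (eq_power_sum _ E1) (eq_power_sum _ E2).
  exact: (cvg_unique _ c2 d2').
Qed.

(** The derivative data of [regular_jet] alone. *)
Definition jets F F1 F2 := forall t : R, 0 < t ->
  is_derive t 1 F (F1 t) /\ is_derive t 1 F1 (F2 t).

Lemma jetsM F F1 F2 G G1 G2 : jets F F1 F2 -> jets G G1 G2 ->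
  jets (F \* G) (F1 \* G \+ F \* G1) (F2 \* G \+ (F1 \* G1 \+ F1 \* G1) \+ F \* G2).
Proof.
move=> jF jG t t0; have [f1 f2] := jF t t0; have [g1 g2] := jG t t0; split.
- have H := is_deriveM f1 g1; apply: is_derive_eq.
  by rewrite /GRing.scale/=; ring.
- have H := is_deriveD (is_deriveM f2 g1) (is_deriveM f1 g2); apply: is_derive_eq.
  by rewrite /GRing.scale/=; ring.
Qed.

Lemma jets_horner (p : {poly R}) : jets (horner p) (horner p^`()) (horner p^`()^`()).
Proof. by move=> t _; split; exact: is_derive_poly. Qed.

Lemma jets_pole k : jets (pole k) (fun t => - (pole k t * pole k t)) (fun t => 2 * pole k t ^+ 3).
Proof. by move=> t t0; exact: jet_pole. Qed.

Lemma jets_prod_poles a N : exists F1 F2,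
  jets (fun t => \prod_(i < N) pole (a + i) t) F1 F2.
Proof.
elim: N => [|N [F1 [F2 J]]].
  exists (horner (1%:P)^`()), (horner (1%:P)^`()^`()).
  have := jets_horner 1%:P.
  by rewrite (_ : horner 1%:P = (fun t => \prod_(i < 0) pole (a + i) t))//;
    apply/funext => t; rewrite hornerC big_ord0.
have := jetsM J (jets_pole (a + N)).
rewrite (_ : _ \* _ = (fun t => \prod_(i < N.+1) pole (a + i) t)); last first.
  by apply/funext => t; rewrite big_ord_recr.
by eexists; eexists; eassumption.
Qed.

Lemma jets_unique F F1 F2 G1 G2 : jets F F1 F2 -> jets F G1 G2 ->
  forall t, 0 < t -> F1 t = G1 t /\ F2 t = G2 t.
Proof.
move=> jF jG.
have E t : 0 < t -> F1 t = G1 t.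
  move=> t0; have [[_ <-] _] := jF t t0; have [[_ <-] _] := jG t t0; by [].
move=> t t0; split; first exact: E.
have [_ [_ <-]] := jF t t0; have [_ [_ <-]] := jG t t0.
apply: near_eq_derive; near=> s; apply: E; near: s; exact: lt_nbhsr.
Unshelve. all: by end_near. Qed.

Definition cubeX : {poly R} := ('X - 1) ^+ 3.

Lemma triple_zero (c p : {poly R}) :
  c.[1] = 0 -> c^`().[1] = 0 -> c^`()^`().[1] = 0 ->
  [/\ (c * p).[1] = 0, (c * p)^`().[1] = 0 & (c * p)^`()^`().[1] = 0].
Proof.
move=> c0 c1 c2; split.
- by rewrite hornerM c0 mul0r.
- by rewrite derivM hornerD !hornerM c0 c1 !mul0r addr0.
- by rewrite derivM derivD !derivM !(hornerD, hornerM) c0 c1 c2 !mul0r !addr0.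
Qed.

Lemma cubeX_zero : [/\ cubeX.[1] = 0, cubeX^`().[1] = 0 & cubeX^`()^`().[1] = 0].
Proof.
have X1 : ('X - 1 : {poly R}).[1] = 0 by rewrite hornerD hornerN hornerX hornerC subrr.
have d : ('X - 1 : {poly R})^`() = 1 by rewrite derivB derivX derivC subr0.
have c1 : cubeX^`() = ('X - 1) * ('X - 1) *+ 3.
  by rewrite /cubeX deriv_exp d mul1r/= expr2.
split.
- by rewrite /cubeX horner_exp X1 expr0n.
- by rewrite c1 hornerMn hornerM X1 mul0r mul0rn.
- by rewrite c1 derivMn derivM d hornerMn hornerD !hornerM X1 mul0r mulr0 addr0 mul0rn.
Qed.

(** [regular_shift] gives the limits in terms of S'(1) and S''(1), which vanish
because of the factor (t - 1)^3.  The derivatives of S are found twice, from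
[ex_regular_horner_poles] and from Leibniz' rule, and compared. *)
Lemma telescoping_regular (p : {poly R}) N :
  let S := fun t => (cubeX * p).[t] * \prod_(i < N.+1) pole (0 + i) t in
  regular (fun t => S (t + 1) - S t) 0 0.
Proof.
move=> S.
have [l1 [l2 [S1 [S2 J]]]] := ex_regular_horner_poles (cubeX * p) 0 N.
have [P1 [P2 JP]] := jets_prod_poles 0 N.+1.
have JS : jets S S1 S2.
  by move=> t t0; case: J => d1 d2 _ _ _; split; [exact: d1 | exact: d2].
have JS' := jetsM (jets_horner (cubeX * p)) JP.
have [E1 E2] := jets_unique JS JS' ltr01.
have := regular_shift J.
have [k0 k1 k2] := cubeX_zero.
have [z0 z1 z2] := triple_zero p k0 k1 k2.
rewrite E1 E2 /= z0 z1 z2 !mul0r !addr0 mulr0 oppr0 ?mul0r ?add0r ?mulr0.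
by rewrite /S.
Qed.

Definition polynomial_fun f := exists p : {poly R}, forall t, p.[t] = f t.

Lemma polynomial_fun_cst c : polynomial_fun (fun=> c).
Proof. by exists c%:P => t; rewrite hornerC. Qed.

Lemma polynomial_fun_id : polynomial_fun (fun t => t).
Proof. by exists 'X => t; rewrite hornerX. Qed.

Lemma polynomial_funD f g : polynomial_fun f -> polynomial_fun g -> polynomial_fun (fun t => f t + g t).
Proof. by move=> [p Hp] [q Hq]; exists (p + q) => t; rewrite hornerD Hp Hq. Qed.

Lemma polynomial_funM f g : polynomial_fun f -> polynomial_fun g -> polynomial_fun (fun t => f t * g t).
Proof. by move=> [p Hp] [q Hq]; exists (p * q) => t; rewrite hornerM Hp Hq. Qed.

Lemma polynomial_funX f k : polynomial_fun f -> polynomial_fun (fun t => f t ^+ k).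
Proof. by move=> [p Hp]; exists (p ^+ k) => t; rewrite horner_exp Hp. Qed.

Lemma polynomial_fun_cert n : polynomial_fun (cert n).
Proof.
rewrite /cert.
apply: polynomial_funD; last exact: polynomial_fun_cst.
apply: polynomial_funD; last exact: polynomial_funM (polynomial_fun_cst _) polynomial_fun_id.
do 4! [apply: polynomial_funD; last exact: polynomial_funM (polynomial_fun_cst _)
  (polynomial_funX _ polynomial_fun_id)].
exact: polynomial_funM (polynomial_fun_cst _) (polynomial_funX _ polynomial_fun_id).
Qed.

Lemma polynomial_fun_prod a N : polynomial_fun (fun t => \prod_(a <= j < a + N) (t - j%:R)).
Proof.
elim: N => [|N [p Hp]].
  by exists 1%:P => t; rewrite hornerC addn0 big_geq.
exists (p * ('X - (a + N)%:R%:P)) => t.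
by rewrite hornerM Hp hornerXsubC addnS big_nat_recr ?leq_addr.
Qed.

(** The common factor of R_m, ..., R_(m+3): the smallest numerator over the largest
denominator.  Here and below n = m + 2 is the index of the recurrence. *)
Definition Rn_common (m : nat) t : R :=
  (\prod_(1 <= j < m.+1) (t - j%:R)) ^+ 3 /
    (m.+3`!%:R ^+ 2 * \prod_(0 <= j < m.+4) (t + j%:R)).

(** The function S_n.  For n = m + 2 its numerator contains ((t - 1) ... (t - n + 1))^3,
hence a triple zero at t = 1. *)
Definition antidiff (m : nat) t : R :=
  cert (m%:R + 2) t * (\prod_(1 <= j < m.+2) (t - j%:R)) ^+ 3 /
    (m.+3`!%:R ^+ 2 * \prod_(0 <= j < m.+3) (t + j%:R)).

Lemma RnS m t : Rn m.+1 t =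
  Rn m t * ((t - m.+1%:R) ^+ 3 / (m.+1%:R ^+ 2 * (t + m.+1%:R))).
Proof.
have F : m.+1`!%:R = m.+1%:R * m`!%:R :> R by rewrite factS natrM.
rewrite /Rn F [X in X ^+ 3 / _](big_nat_recr m.+1)//= [X in _ / (_ * X)](big_nat_recr m.+1)//=.
rewrite mulf_div; congr (_ / _); first by rewrite exprMn.
by rewrite exprMn; ring.
Qed.

Lemma antidiff_diff m t : 0 < t ->
  antidiff m (t + 1) - antidiff m t = Rn_common m t *
    (t ^+ 4 * cert (m%:R + 2) (t + 1) -
     (t + 1 - (m%:R + 2)) ^+ 3 * (t + (m%:R + 2) + 1) * cert (m%:R + 2) t).
Proof.
move=> t0; rewrite /antidiff /Rn_common.
have E1 : \prod_(1 <= j < m.+2) (t + 1 - j%:R) = t * \prod_(1 <= j < m.+1) (t - j%:R).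
  rewrite big_ltn// addrK; congr (_ * _); rewrite big_add1/=.
  by apply: eq_bigr => j _; rewrite -natr1; ring.
have E2 : \prod_(1 <= j < m.+2) (t - j%:R) = (\prod_(1 <= j < m.+1) (t - j%:R)) * (t - m.+1%:R).
  by rewrite big_nat_recr.
have E3 : \prod_(0 <= j < m.+4) (t + j%:R) = \prod_(0 <= j < m.+3) (t + j%:R) * (t + m.+3%:R).
  by rewrite big_nat_recr.
have E4 : \prod_(0 <= j < m.+4) (t + j%:R) = t * \prod_(0 <= j < m.+3) (t + 1 + j%:R).
  rewrite big_ltn// addr0; congr (_ * _); rewrite big_add1/=.
  by apply: eq_bigr => j _; rewrite -natr1; ring.
have P0 : \prod_(0 <= j < m.+3) (t + j%:R) != 0.
  by rewrite prodf_seq_neq0; apply/allP => j _ /=; exact: pole_neq0.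
have P1 : \prod_(0 <= j < m.+3) (t + 1 + j%:R) != 0.
  by rewrite prodf_seq_neq0; apply/allP => j _ /=; apply: pole_neq0; lra.
have f0 : m.+3`!%:R != 0 :> R by rewrite pnatr_eq0 -lt0n fact_gt0.
have tm := pole_neq0 m.+3 t0; have tn := lt0r_neq0 t0.
rewrite E1 E2; move: E3 E4; move: (\prod_(0 <= j < m.+4) (t + j%:R)) => Q E3 E4.
rewrite [RHS]mulrBr; congr (_ - _).
  rewrite E4; move: (\prod_(0 <= j < m.+3) (t + 1 + j%:R)) (m.+3`!%:R) P1 f0 => A B A0 B0.
  by field; rewrite ?A0 ?B0 ?tn.
rewrite E3; have m3 : m.+3%:R = m%:R + 3 :> R by rewrite -addn3 natrD.
have m1 : m.+1%:R = m%:R + 1 :> R by rewrite natr1.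
rewrite m3 in tm *; rewrite m1.
move: (\prod_(0 <= j < m.+3) (t + j%:R)) (m.+3`!%:R) P0 f0 => A B A0 B0.
move: (cert _ _) => C; move: m%:R tm => x tm.
by field; rewrite ?A0 ?B0 ?tm.
Qed.

Lemma Rn_factor m t : 0 < t -> let n := m%:R + 2 in
  [/\ Rn m t = Rn_common m t * (((n - 1) * n * (n + 1)) ^+ 2 * ((t + n - 1) * (t + n) * (t + n + 1))),
      Rn m.+1 t = Rn_common m t * ((t + 1 - n) ^+ 3 * (n * (n + 1)) ^+ 2 * ((t + n) * (t + n + 1))),
      Rn m.+2 t = Rn_common m t * (((t + 1 - n) * (t - n)) ^+ 3 * (n + 1) ^+ 2 * (t + n + 1)) &
      Rn m.+3 t = Rn_common m t * ((t + 1 - n) * (t - n) * (t - n - 1)) ^+ 3].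
Proof.
move=> t0 n.
have n1 : m.+1%:R = n - 1 :> R by rewrite /n -natr1; ring.
have n2 : m.+2%:R = n :> R by rewrite -natr1 n1; ring.
have n3 : m.+3%:R = n + 1 :> R by rewrite -natr1 n2.
have a1 := pole_neq0 m.+1 t0; have a2 := pole_neq0 m.+2 t0; have a3 := pole_neq0 m.+3 t0.
have b1 : m.+1%:R != 0 :> R by rewrite pnatr_eq0.
have b2 : m.+2%:R != 0 :> R by rewrite pnatr_eq0.
have b3 : m.+3%:R != 0 :> R by rewrite pnatr_eq0.
have W0 : Rn m t = Rn_common m t * (((n - 1) * n * (n + 1)) ^+ 2 * ((t + n - 1) * (t + n) * (t + n + 1))).
  rewrite /Rn_common /Rn.
  have F : m.+3`!%:R = (n + 1) * (n * ((n - 1) * m`!%:R)) :> R.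
    by rewrite 3!factS !natrM n1 n2 n3.
  rewrite F !(big_nat_recr m.+3, big_nat_recr m.+2, big_nat_recr m.+1)//= n1 n2 n3.
  have f0 : m`!%:R != 0 :> R by rewrite pnatr_eq0 -lt0n fact_gt0.
  have P0 : \prod_(0 <= j < m.+1) (t + j%:R) != 0.
    by rewrite prodf_seq_neq0; apply/allP => j _ /=; exact: pole_neq0.
  rewrite n1 in a1 b1; rewrite n2 in a2 b2; rewrite n3 in a3 b3.
  move: (\prod_(0 <= j < m.+1) (t + j%:R)) (m`!%:R) P0 f0 => A B A0 B0.
  move: (\prod_(_ <= _ < _) _) => P.
  clearbody n; clear -A0 B0 a1 a2 a3 b1 b2 b3; field.
  by rewrite ?A0 ?B0 ?a1 ?a2 ?a3 ?b1 ?b2 ?b3.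
have W1 : Rn m.+1 t = Rn_common m t * ((t + 1 - n) ^+ 3 * (n * (n + 1)) ^+ 2 * ((t + n) * (t + n + 1))).
  rewrite RnS W0 n1; rewrite n1 in a1 b1.
  by field; rewrite ?a1 ?b1.
have W2 : Rn m.+2 t = Rn_common m t * (((t + 1 - n) * (t - n)) ^+ 3 * (n + 1) ^+ 2 * (t + n + 1)).
  rewrite RnS W1 n2; rewrite n2 in a2 b2.
  by field; rewrite ?a2 ?b2.
split=> //.
rewrite RnS W2 n3; rewrite n3 in a3 b3.
by field; rewrite ?a3 ?b3.
Qed.

Lemma Rn_recurrence m t : 0 < t ->
  rec_fun 3 (m%:R + 2) * Rn m.+3 t + rec_fun 2 (m%:R + 2) * Rn m.+2 t
  + rec_fun 1 (m%:R + 2) * Rn m.+1 t + rec_fun 0 (m%:R + 2) * Rn m t =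
  antidiff m (t + 1) - antidiff m t.
Proof.
move=> t0; rewrite antidiff_diff// certP.
have [-> -> -> ->] := Rn_factor m t0.
move: (rec_fun 0 _) (rec_fun 1 _) (rec_fun 2 _) (rec_fun 3 _) => c0 c1 c2 c3.
by ring.
Qed.

Lemma antidiff_regular m : regular (fun t => antidiff m (t + 1) - antidiff m t) 0 0.
Proof.
have [p Hp] := polynomial_funM (polynomial_fun_cert (m%:R + 2)) (polynomial_funM
  (polynomial_funX 3 (polynomial_fun_prod 2 m)) (polynomial_fun_cst (m.+3`!%:R ^+ 2)^-1)).
have E t : 0 < t -> (cubeX * p).[t] * \prod_(i < m.+3) pole (0 + i) t = antidiff m t.
  move=> t0; rewrite /antidiff hornerM Hp /cubeX horner_exp hornerD hornerN hornerX hornerC.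
  have E2 : \prod_(1 <= j < m.+2) (t - j%:R) = (t - 1) * \prod_(2 <= j < 2 + m) (t - j%:R).
    by rewrite big_ltn.
  have E3 : \prod_(i < m.+3) pole (0 + i) t = (\prod_(0 <= j < m.+3) (t + j%:R))^-1.
    by rewrite big_mkord prodfV.
  by rewrite E2 E3 [in RHS]invfM; ring.
apply: regular_eq (telescoping_regular p m.+2) => t t0.
by rewrite E ?E//; lra.
Qed.

(** Apply the functionals to both sides of [Rn_recurrence]: on the right they
vanish, on the left they give the recurrence. *)
Lemma rt_recurrence : satisfies_rec (rt R) /\ satisfies_rec (rtt R).
Proof.
have H m : let n := m%:R + 2 in
    rec_fun 3 n * rt R m.+3 + rec_fun 2 n * rt R m.+2 + rec_fun 1 n * rt R m.+1 + rec_fun 0 n * rt R m = 0 /\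
    rec_fun 3 n * rtt R m.+3 + rec_fun 2 n * rtt R m.+2 + rec_fun 1 n * rtt R m.+1 + rec_fun 0 n * rtt R m = 0.
  move=> n.
  have V k : regular (Rn k) (rt R k) (rtt R k).
    by have [l1 [l2 [r _ _]]] := Rn_regular_le (R := R) k; have [-> ->] := rt_value r.
  have r1 := regularD (regularD (regularD (regularZ (rec_fun 3 n) (V m.+3)) (regularZ (rec_fun 2 n) (V m.+2)))
    (regularZ (rec_fun 1 n) (V m.+1))) (regularZ (rec_fun 0 n) (V m)).
  apply: (regular_unique r1); apply: regular_eq (antidiff_regular m) => t t0 /=.
  by rewrite -Rn_recurrence.
have E m : m.+2%:R = m%:R + 2 :> R by rewrite -addn2 natrD.
split; rewrite /satisfies_rec => -[|[|m]] // _; have [H1 H2] := H m.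
- by rewrite !rec_atE// E.
- by rewrite !rec_atE// E.
Qed.

End Recurrence.

(** * The sequence of leading coefficients and the initial data *)

Section Coefficients.
Context {R : realType}.
Implicit Types (f g F G : R -> R) (t x n : R) (k m N : nat).

Definition a_term m k : R := (-1) ^+ (m + k) * 'C(m, k)%:R * 'C(m + k, k)%:R ^+ 3.

(** The terms with k > m vanish, so that the sums for several m can be taken over
the same range. *)
Lemma aE m N : (m < N)%N -> a R m = \sum_(0 <= k < N) a_term m k.
Proof.
move=> mN; rewrite (big_cat_nat (n := m.+1))//=.
rewrite [X in _ + X]big_nat_cond [X in _ + X]big1 ?addr0; last first.
  by move=> k; rewrite andbT => /andP[mk _]; rewrite /a_term bin_small// mulr0 mul0r.
rewrite /a mulr_sumr; apply: eq_bigr => k _.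
by rewrite /a_term exprD; ring.
Qed.

Lemma binR_down N k :
  N.+1%:R * 'C(N, k)%:R = (N.+1%:R - k%:R) * 'C(N.+1, k)%:R :> R.
Proof.
have [kN|Nk] := leqP k N.+1.
  by rewrite -natrB// -!natrM mul_bin_down.
by rewrite !bin_small ?mulr0// ltnW.
Qed.

Lemma binR_right N k :
  k.+1%:R * 'C(N, k.+1)%:R = (N%:R - k%:R) * 'C(N, k)%:R :> R.
Proof.
have [kN|Nk] := leqP k N.
  by rewrite -natrB// -!natrM mul_bin_left.
by rewrite !bin_small ?mulr0// ltnW.
Qed.

Lemma binR_addl m k :
  m.+1%:R * 'C(m.+1 + k, k)%:R = (m.+1%:R + k%:R) * 'C(m + k, k)%:R :> R.
Proof.
rewrite -natrD -!natrM; congr (_%:R).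
by have := mul_bin_down (m + k).+1 k; rewrite subSn ?leq_addl// addnK addSn => ->.
Qed.

Lemma binR_addr m k :
  k.+1%:R * 'C(m + k.+1, k.+1)%:R = (m%:R + k.+1%:R) * 'C(m + k, k)%:R :> R.
Proof. by rewrite -natrD -!natrM addnS mul_bin_diag. Qed.

(** The factor common to four consecutive summands, playing the role of
[Rn_common] at t = - k. *)
Definition a_common m k : R := (-1) ^+ (m + k) * 'C(m.+3, k)%:R * 'C(m + k, k)%:R ^+ 3.

(** The same four products as in [certP] and [Rn_factor], now at t = - k. *)
Lemma a_term_factor m k : let n := m%:R + 2 in let t := - k%:R in
  let K := ((n - 1) * n * (n + 1)) ^+ 3 in
  [/\ K * a_term m k = a_common m k * (((n - 1) * n * (n + 1)) ^+ 2 * ((t + n - 1) * (t + n) * (t + n + 1))),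
      K * a_term m.+1 k = a_common m k * ((t + 1 - n) ^+ 3 * (n * (n + 1)) ^+ 2 * ((t + n) * (t + n + 1))),
      K * a_term m.+2 k = a_common m k * (((t + 1 - n) * (t - n)) ^+ 3 * (n + 1) ^+ 2 * (t + n + 1)) &
      K * a_term m.+3 k = a_common m k * ((t + 1 - n) * (t - n) * (t - n - 1)) ^+ 3].
Proof.
move=> n t K.
have n1 : m.+1%:R = n - 1 :> R by rewrite /n -natr1; ring.
have n2 : m.+2%:R = n :> R by rewrite -natr1 n1; ring.
have n3 : m.+3%:R = n + 1 :> R by rewrite -natr1 n2.
have d1 := binR_down m.+2 k; have d2 := binR_down m.+1 k; have d3 := binR_down m k.
have e1 := binR_addl m k; have e2 := binR_addl m.+1 k; have e3 := binR_addl m.+2 k.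
have s1 : (-1) ^+ (m.+1 + k) = - (-1) ^+ (m + k) :> R by rewrite addSn exprS mulN1r.
have s2 : (-1) ^+ (m.+2 + k) = (-1) ^+ (m + k) :> R by rewrite addSn exprS s1 mulN1r opprK.
have s3 : (-1) ^+ (m.+3 + k) = - (-1) ^+ (m + k) :> R by rewrite addSn exprS s2 mulN1r.
have b1 : m.+1%:R != 0 :> R by rewrite pnatr_eq0.
have b2 : m.+2%:R != 0 :> R by rewrite pnatr_eq0.
have b3 : m.+3%:R != 0 :> R by rewrite pnatr_eq0.
rewrite /a_term /a_common s1 s2 s3.
rewrite n3 in d1 e3 b3; rewrite n2 in d2 e2 b2; rewrite n1 in d3 e1 b1.
have {}d1 : 'C(m.+2, k)%:R = (n + 1 - k%:R) * 'C(m.+3, k)%:R / (n + 1) :> R by rewrite -d1 mulrC mulKf.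
have {}d2 : 'C(m.+1, k)%:R = (n - k%:R) * 'C(m.+2, k)%:R / n :> R by rewrite -d2 mulrC mulKf.
have {}d3 : 'C(m, k)%:R = (n - 1 - k%:R) * 'C(m.+1, k)%:R / (n - 1) :> R by rewrite -d3 mulrC mulKf.
have {}e1 : 'C(m.+1 + k, k)%:R = (n - 1 + k%:R) * 'C(m + k, k)%:R / (n - 1) :> R by rewrite -e1 mulrC mulKf.
have {}e2 : 'C(m.+2 + k, k)%:R = (n + k%:R) * 'C(m.+1 + k, k)%:R / n :> R by rewrite -e2 mulrC mulKf.
have {}e3 : 'C(m.+3 + k, k)%:R = (n + 1 + k%:R) * 'C(m.+2 + k, k)%:R / (n + 1) :> R by rewrite -e3 mulrC mulKf.
rewrite d3 d2 d1 e3 e2 e1 /K /t.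
move: ('C(m.+3, k)%:R) ('C(m + k, k)%:R) (k%:R) ((-1) ^+ (m + k)) => A B z s.
clearbody n; clear -b1 b2 b3.
by split; field; rewrite ?b1 ?b2 ?b3.
Qed.

(** It vanishes at both ends: at k = 0 because of k^4, and at k = m + 4 because of
C(m + 3, k). *)
Definition a_antidiff m k : R := a_common m k * k%:R ^+ 4 * cert (m%:R + 2) (1 - k%:R).

Lemma a_common_step m k : a_common m k.+1 * k.+1%:R ^+ 4 =
  - (a_common m k * ((m%:R + 2 + 1 - k%:R) * (m%:R + 2 - 1 + k%:R) ^+ 3)).
Proof.
have k0 : k.+1%:R != 0 :> R by rewrite pnatr_eq0.
have e1 := binR_right m.+3 k; have e2 := binR_addr m k.
rewrite /a_common addnS exprS.
have {}e1 : 'C(m.+3, k.+1)%:R = (m.+3%:R - k%:R) * 'C(m.+3, k)%:R / k.+1%:R :> R by rewrite -e1 mulrC mulKf.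
rewrite -addnS.
have {}e2 : 'C(m + k.+1, k.+1)%:R = (m%:R + k.+1%:R) * 'C(m + k, k)%:R / k.+1%:R :> R
  by rewrite -e2 mulrC mulKf.
rewrite e1 e2.
have -> : m.+3%:R = m%:R + 3 :> R by rewrite -addn3 natrD.
have -> : k%:R = k.+1%:R - 1 :> R by rewrite -natr1 addrK.
move: k.+1%:R k0 => z z0.
by field.
Qed.

Lemma a_term_recurrence m k : let n := m%:R + 2 in
  ((n - 1) * n * (n + 1)) ^+ 3 *
  (rec_fun 3 n * a_term m.+3 k + rec_fun 2 n * a_term m.+2 k + rec_fun 1 n * a_term m.+1 k
    + rec_fun 0 n * a_term m k) =
  a_antidiff m k - a_antidiff m k.+1.
Proof.
move=> n; have [h0 h1 h2 h3] := a_term_factor m k; rewrite -/n in h0 h1 h2 h3.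
have C := certP n (- k%:R).
transitivity (a_common m k * ((- k%:R) ^+ 4 * cert n (- k%:R + 1) -
  (- k%:R + 1 - n) ^+ 3 * (- k%:R + n + 1) * cert n (- k%:R))).
  rewrite C; move: h0 h1 h2 h3.
  move: (((n - 1) * n * (n + 1)) ^+ 3) (rec_fun 0 n) (rec_fun 1 n) (rec_fun 2 n) (rec_fun 3 n) =>
    K c0 c1 c2 c3 h0 h1 h2 h3.
  transitivity (c3 * (K * a_term m.+3 k) + c2 * (K * a_term m.+2 k) + c1 * (K * a_term m.+1 k) + c0
    * (K * a_term m k)).
    by ring.
  by rewrite h0 h1 h2 h3; ring.
rewrite /a_antidiff a_common_step -/n.
have -> : 1 - k.+1%:R = - k%:R :> R by rewrite -natr1; ring.
have -> : - k%:R + 1 = 1 - k%:R :> R by ring.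
move: (cert n (1 - k%:R)) (cert n (- k%:R)) => c c'.
by ring.
Qed.

Lemma a_recurrence : satisfies_rec (a R).
Proof.
case=> [|[|m]] // _.
have E : m.+2%:R = m%:R + 2 :> R by rewrite -addn2 natrD.
rewrite !rec_atE// E; set n := m%:R + 2 => /=.
have n0 : 2 <= n by rewrite /n; have : 0 <= m%:R :> R by []; lra.
have K0 : ((n - 1) * n * (n + 1)) ^+ 3 != 0.
  by rewrite expf_neq0// !mulf_neq0//; apply: lt0r_neq0; lra.
apply: (mulfI K0); rewrite mulr0.
have A3 := @aE m.+3 m.+4 (leqnn _); have A2 := @aE m.+2 m.+4 (leqW (leqnn _)).
have A1 := @aE m.+1 m.+4 (leqW (leqW (leqnn _))).
have A0 := @aE m m.+4 (leqW (leqW (leqW (leqnn _)))).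
rewrite A3 A2 A1 A0.
rewrite !mulr_sumr -!big_split/= mulr_sumr.
rewrite (eq_bigr (fun k => a_antidiff m k - a_antidiff m k.+1)) => [|k _]; last exact: a_term_recurrence.
transitivity (- \sum_(0 <= k < m.+4) (a_antidiff m k.+1 - a_antidiff m k)).
  by rewrite -sumrN; apply: eq_bigr => k _; rewrite opprB.
rewrite telescope_sumr// /a_antidiff /a_common bin_small// expr0n/=.
by rewrite !(mulr0, mul0r, subr0, oppr0).
Qed.

Lemma comb_recurrence (u v : nat -> R) c : satisfies_rec u -> satisfies_rec v ->
  satisfies_rec (fun i => u i * c - v i).
Proof.
move=> hu hv i i2; have Hu := hu i i2; have Hv := hv i i2.
transitivity ((rec_at R 3 i * u i.+1 + rec_at R 2 i * u i + rec_at R 1 i * u i.-1 + rec_at R 0 i * u i.-2) * c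
 - (rec_at R 3 i * v i.+1 + rec_at R 2 i * v i + rec_at R 1 i * v i.-1 + rec_at R 0 i * v i.-2)).
  by ring.
by rewrite Hu Hv; ring.
Qed.

Lemma zeta_tail1 s : (1 < s)%N -> zeta_tail s 1 = zeta R s - 1 :> R.
Proof. by move=> s1; rewrite -(zeta_tail0 s) (@zeta_tailS _ s 0)// expr1n invr1; ring. Qed.

Lemma zeta_tail2 s : (1 < s)%N -> zeta_tail s 2 = zeta R s - 1 - (2 ^+ s)^-1 :> R.
Proof. by move=> s1; rewrite -zeta_tail1// (@zeta_tailS _ s 1)//; ring. Qed.

Lemma harmonic_sum_values : [/\ harmonic_sum 1 = 0 :> R, harmonic_sum 2 = 1 :> R, harmonic_sum 3 =
  3 / 2 :> R & harmonic_sum 4 = 11 / 6 :> R].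
Proof.
have h1 : harmonic_sum 1 = 0 :> R by rewrite /harmonic_sum big_geq.
have h2 : harmonic_sum 2 = 1 :> R by rewrite harmonic_sumS// h1; field.
have h3 : harmonic_sum 3 = 3 / 2 :> R by rewrite harmonic_sumS// h2; field.
by have h4 : harmonic_sum 4 = 11 / 6 :> R by [rewrite harmonic_sumS// h3; field]; split.
Qed.

Lemma regular_Rn0 : regular (Rn 0 : R -> R) (zeta R 2) (zeta R 3).
Proof.
rewrite -!zeta_tail0; apply: regular_eq (regular_pole 0) => t t0.
by rewrite /Rn big_geq// big_nat1 expr1n mul1r /pole fact0 expr1n mul1r.
Qed.

Lemma regular_Rn1 : regular (Rn 1 : R -> R) (7 * zeta R 2 - 23 / 2) (7 * zeta R 3 - 17 / 2).
Proof.
have := regularD (regularD (@regular_binpoly R 1) (regularZ (-3) (@regular_binpoly R 0)))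
  (regularD (regularZ (-1) (@regular_pole R 0)) (regularZ 8 (@regular_pole R 1))).
have -> : log_coef 2 + -3 * log_coef 1 + (-1 * zeta_tail 2 0 + 8 * zeta_tail 2 1) = 7 * zeta R 2 - 23 / 2 :> R.
  by rewrite zeta_tail1// zeta_tail0 /log_coef; field.
have -> : - sqrlog_coef 2 + -3 * - sqrlog_coef 1 + (-1 * zeta_tail 3 0 + 8 * zeta_tail 3 1) =
  7 * zeta R 3 - 17 / 2 :> R.
  by have [h1 h2 _ _] := harmonic_sum_values; rewrite zeta_tail1// zeta_tail0 /sqrlog_coef h1 h2; field.
apply: regular_eq => t t0 /=.
have P3 : \prod_(1 <= j < 2) (t - j%:R) = t - 1 by rewrite big_nat1.
have Q3 : \prod_(0 <= j < 2) (t + j%:R) = t * (t + 1).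
  by rewrite big_ltn// big_nat1 addr0.
have F2 : 1`!%:R = 1 :> R by [].
rewrite /Rn P3 Q3 F2 !horner_binpolyS binpoly0 hornerC /pole.
have t1 : t != 0 by apply: lt0r_neq0; lra.
have t2 : t + 1 != 0 by apply: lt0r_neq0; lra.
by field; rewrite ?t1 ?t2.
Qed.

(** The decomposition
R_2 = 3/2 C(t-1,3) - 3 C(t-1,2) + 19/2 C(t-1,1) - 46 + 1/t - 54/(t+1) + 216/(t+2). *)
Lemma regular_Rn2 : regular (Rn 2 : R -> R) (163 * zeta R 2 - 2145 / 8) (163 * zeta R 3 - 3135 / 16).
Proof.
have [h1 h2 h3 h4] := harmonic_sum_values.
have := regularD (regularD (regularZ (-46) (@regular_binpoly R 0)) (regularD (regularZ (19 / 2)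
  (@regular_binpoly R 1))
  (regularD (regularZ (-3) (@regular_binpoly R 2)) (regularZ (3 / 2) (@regular_binpoly R 3)))))
  (regularD (@regular_pole R 0) (regularD (regularZ (-54) (@regular_pole R 1))
     (regularZ 216 (@regular_pole R 2)))).
have -> : -46 * log_coef 1 + (19 / 2 * log_coef 2 + (-3 * log_coef 3 + 3 / 2 * log_coef 4)) +
   (zeta_tail 2 0 + (-54 * zeta_tail 2 1 + 216 * zeta_tail 2 2)) = 163 * zeta R 2 - 2145 / 8 :> R.
  by rewrite zeta_tail1// zeta_tail2// zeta_tail0 /log_coef; field.
have -> : -46 * - sqrlog_coef 1 + (19 / 2 * - sqrlog_coef 2
  + (-3 * - sqrlog_coef 3 + 3 / 2 * - sqrlog_coef 4)) +
   (zeta_tail 3 0 + (-54 * zeta_tail 3 1 + 216 * zeta_tail 3 2)) = 163 * zeta R 3 - 3135 / 16 :> R.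
  by rewrite zeta_tail1// zeta_tail2// zeta_tail0 /sqrlog_coef h1 h2 h3 h4; field.
apply: regular_eq => t t0 /=.
have P3 : \prod_(1 <= j < 3) (t - j%:R) = (t - 1) * (t - 2).
  by rewrite big_ltn// big_nat1.
have Q3 : \prod_(0 <= j < 3) (t + j%:R) = t * (t + 1) * (t + 2).
  by rewrite big_ltn// big_ltn// big_nat1 addr0 mulrA.
have F2 : 2`!%:R = 2 :> R by [].
rewrite /Rn P3 Q3 F2 !horner_binpolyS binpoly0 hornerC /pole.
have t1 : t != 0 by apply: lt0r_neq0; lra.
have t2 : t + 1 != 0 by apply: lt0r_neq0; lra.
have t3 : t + 2 != 0 by apply: lt0r_neq0; lra.
by field; rewrite ?t1 ?t2 ?t3.
Qed.

Lemma initial_data :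
  (a R 0 = 1 /\ a R 1 = 7 /\ a R 2 = 163 /\
   bt R 0 = 0 /\ bt R 1 = 23 / 2 /\ bt R 2 = 2145 / 8 /\
   btt R 0 = 0 /\ btt R 1 = 17 / 2 /\ btt R 2 = 3135 / 16).
Proof.
have a0 : a R 0 = 1.
  by rewrite (@aE 0 1)// big_nat1 /a_term !bin0 expr0 expr1n; ring.
have a1 : a R 1 = 7.
  rewrite (@aE 1 2)// big_ltn// big_nat1 /a_term !bin0 !binn bin1.
  by rewrite !exprS expr0; ring.
have a2 : a R 2 = 163.
  rewrite (@aE 2 3)// big_ltn// big_ltn// big_nat1 /a_term !bin0 !binn !bin1.
  have -> : 'C(2 + 2, 2) = 6 by [].
  by rewrite !exprS expr0; ring.
have [r0 s0] := rt_value regular_Rn0.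
have [r1 s1] := rt_value regular_Rn1.
have [r2 s2] := rt_value regular_Rn2.
rewrite /bt /btt a0 a1 a2 r0 r1 r2 s0 s1 s2.
by do !split; ring.
Qed.

End Coefficients.

(** * Growth of real sequences *)

Section Sequences.
Context {R : realType}.
Implicit Types (A Y e t u : nat -> R) (l L r : R).

Lemma cvg_norm_le u e l : (\forall n \near \oo, `|u n - l| <= e n) ->
  e @ \oo --> (0 : R) -> u @ \oo --> l.
Proof.
move=> H e0; apply/cvgrPdist_le => d d0.
near=> n; rewrite distrC.
have h1 : `|u n - l| <= e n by near: n; exact: H.
apply: le_trans h1 _; apply: le_trans (ler_norm _) _.
rewrite -[e n]subr0 distrC; near: n.
by move/cvgrPdist_le : e0; apply.
Unshelve. all: by end_near. Qed.

(** Beyond some index e is at most d (1 - th) / 2, so t_n decays geometrically to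
within d / 2 of 0. *)
Lemma contraction_cvg0 t e (th : R) N : 0 <= th -> th < 1 ->
  (forall n, (N <= n)%N -> 0 <= t n /\ t n.+1 <= th * t n + e n) ->
  e @ \oo --> (0 : R) -> t @ \oo --> (0 : R).
Proof.
move=> th0 th1 H e0.
apply/cvgrPdist_le => d d0.
have d1 : 0 < d / 2 * (1 - th) by rewrite mulr_gt0 ?divr_gt0// subr_gt0.
have [M0 _ HM0] := proj1 (cvgrPdist_le _ _) e0 _ d1.
(* From index [M] on, d / 2 is a fixed point of the perturbed contraction. *)
pose M := maxn N M0.
have B k : t (M + k)%N <= th ^+ k * t M + d / 2.
  elim: k => [|k IH]; first by rewrite addn0 expr0 mul1r lerDl divr_ge0// ltW.
  have NM : (N <= M + k)%N by rewrite (leq_trans (leq_maxl N M0)) ?leq_addr.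
  have M0M : (M0 <= M + k)%N by rewrite (leq_trans (leq_maxr N M0)) ?leq_addr.
  have [_ h] := H _ NM.
  have := HM0 _ M0M; rewrite /= sub0r normrN => /(le_trans (ler_norm _)) he.
  rewrite addnS; apply: le_trans h _.
  have : th * t (M + k)%N <= th * (th ^+ k * t M + d / 2) by rewrite ler_wpM2l.
  by rewrite exprS; move: (th ^+ k) (t M) => x y; lra.
have thc : (fun k => th ^+ k * t M) @ \oo --> (0 : R).
  rewrite -(mul0r (t M)); apply: cvgM; last exact: cvg_cst.
  by apply: cvg_expr; rewrite ger0_norm.
have d2 : 0 < d / 2 by rewrite divr_gt0.
have [K _ HK] := proj1 (cvgrPdist_le _ _) thc _ d2.
exists (M + K)%N => // n /= Kn.
have Mn : (M <= n)%N by rewrite (leq_trans _ Kn)// leq_addr.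
have KnM : (K <= n - M)%N by rewrite leq_subRL.
have := HK _ KnM; rewrite /= !sub0r !normrN => /(le_trans (ler_norm _)) hk.
have Nn : (N <= n)%N by rewrite (leq_trans _ Mn)// leq_maxl.
have [t0 _] := H _ Nn; rewrite ger0_norm//.
have := B (n - M)%N; rewrite subnKC//.
by move: hk; move: (_ * t M) => x; lra.
Qed.

(** The logarithm of u_n^(1/n) is the Cesaro mean of ln (u_(n+1) / u_n), up to the
term of u_0. *)
Lemma ratio_root u l : 0 < l -> (\forall n \near \oo, 0 < u n) ->
  u n.+1 / u n @[n --> \oo] --> l -> u n `^ n%:R^-1 @[n --> \oo] --> l.
Proof.
move=> l0 u0 ul.
pose d n := ln (u n.+1) - ln (u n).
have u1 : \forall n \near \oo, 0 < u n.+1.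
  by case: u0 => N _ HN; exists N => // n /= Nn; apply: HN; exact: leqW.
have dl : d @ \oo --> ln l.
  apply: cvg_trans (continuous_cvg _ (continuous_ln l0) ul).
  apply: near_eq_cvg; near=> n; rewrite /= /d ln_div ?posrE//; near: n; [exact: u1|exact: u0].
have := cesaro dl => mc.
have mE n : arithmetic_mean d n = n.+1%:R^-1 * (ln (u n.+1) - ln (u 0%N)).
  rewrite /arithmetic_mean; congr (_ * _); rewrite /series/= /d.
  by rewrite (@telescope_sumr _ 0%N n.+1 (fun k => ln (u k))).
have c1 : n.+1%:R^-1 * ln (u n.+1) @[n --> \oo] --> ln l.
  have -> : ln l = ln l + 0 * ln (u 0%N) by rewrite mul0r addr0.
  have h0 : n.+1%:R^-1 * ln (u 0%N) @[n --> \oo] --> 0 * ln (u 0%N).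
    by apply: cvgM; [exact: cvg_harmonic | exact: cvg_cst].
  apply: cvg_trans (cvgD mc h0); apply: near_eq_cvg; near=> n.
  by rewrite /= fctE mE; ring.
have c2 : n%:R^-1 * ln (u n) @[n --> \oo] --> ln l.
  by rewrite -(cvg_shiftS (fun n => n%:R^-1 * ln (u n))).
have c3 : expR (n%:R^-1 * ln (u n)) @[n --> \oo] --> l.
  rewrite -[X in _ --> X](lnK l0).
  by apply: continuous_cvg c2; exact: continuous_expR.
apply: cvg_trans c3; apply: near_eq_cvg; near=> n.
have un : 0 < u n by near: n.
by rewrite /powR gt_eqF.
Unshelve. all: by end_near. Qed.

(** A and Y measure the components of a solution in the dominant direction and in
the complementary one.  If A ever reaches Y at a late index, it stays ahead, since
its factor L exceeds r by more than the perturbation; then Y / A obeys a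
contraction and tends to 0.  Otherwise A stays below Y forever, and the
perturbation is negligible compared to Y. *)
Lemma mode_dichotomy A Y e L r : 0 < r -> r < L ->
  (forall n, 0 <= A n) -> (forall n, 0 <= Y n) -> (forall n, 0 < A n + Y n) ->
  (forall n, 0 <= e n) -> e @ \oo --> (0 : R) ->
  (forall n, `|A n.+1 - L * A n| <= e n * (A n + Y n)) ->
  (forall n, `|Y n.+1 - r * Y n| <= e n * (A n + Y n)) ->
  (exists M, [/\ forall n, (M <= n)%N -> 0 < A n,
     A n.+1 / A n @[n --> \oo] --> L & Y n / A n @[n --> \oo] --> (0 : R)]) \/
  (exists M, [/\ forall n, (M <= n)%N -> 0 < Y n /\ A n <= Y n &
     Y n.+1 / Y n @[n --> \oo] --> r]).
Proof.
move=> r0 rL A0 Y0 AY0 e0 ec hA hY.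
have e2c : (fun n => 2 * e n) @ \oo --> (0 : R).
  by rewrite -(mulr0 2); apply: cvgM => //; exact: cvg_cst.
(* A gap such that the factors L - 2 h and r + 2 h are still separated. *)
pose h := (L - r) / 8.
have h0 : 0 < h by rewrite divr_gt0// subr_gt0.
have [N _ HN] := proj1 (cvgrPdist_le _ _) ec _ h0.
have eh n : (N <= n)%N -> e n <= h.
  by move=> /HN; rewrite /= sub0r normrN ger0_norm.
(* Is the dominant component ahead at some index where the errors are small? *)
have [[M NM AM]|noM] := pselect (exists2 M, (N <= M)%N & Y M <= A M).
  left; exists M.
  have step n : (N <= n)%N -> 0 < A n -> Y n <= A n ->
      (L - 2 * h) * A n <= A n.+1 /\ Y n.+1 <= r * Y n + 2 * e n * A n.
    move=> Nn An Yn; have := hA n; have := hY n.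
    have e1 := eh n Nn; have e3 := e0 n.
    have B : e n * (A n + Y n) <= 2 * e n * A n.
      by rewrite -mulrA mulrCA ler_wpM2l//; lra.
    have B2 : 2 * e n * A n <= 2 * h * A n by rewrite ler_wpM2r//; lra.
    rewrite !ler_norml => /andP[_ y1] /andP[a1 _]; split; first by nra.
    by lra.
  have inv n : (M <= n)%N -> 0 < A n /\ Y n <= A n.
    move=> /subnKC <-; elim: (n - M)%N => [|k [IH1 IH2]].
      by rewrite addn0; split=> //; have := AY0 M; lra.
    have Nk : (N <= M + k)%N by rewrite (leq_trans NM)// leq_addr.
    have [s1 s2] := step _ Nk IH1 IH2; have e1 := eh _ Nk.
    rewrite addnS; move: s1 s2 IH1 IH2; move: (A (M + k)%N) (A _.+1) (Y (M + k)%N) (Y _.+1) (e (M + k)%N) e1.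
    move=> x x' y y' ee e1 s1 s2 IH1 IH2.
    have p1 : 2 * ee * x <= 2 * h * x by rewrite ler_wpM2r//; lra.
    have p2 : r * y <= r * x by rewrite ler_wpM2l// ltW.
    have p3 : 0 < (L - 2 * h) * x by rewrite mulr_gt0// /h; lra.
    split; first by lra.
    have : (r + 2 * h) * x <= (L - 2 * h) * x by rewrite ler_wpM2r ?(ltW IH1)// /h; lra.
    by nra.
  split; first by move=> n /inv[].
  - apply: cvg_norm_le e2c; exists M => // n /= Mn.
    have [An Yn] := inv n Mn.
    rewrite -[L](mulfK (lt0r_neq0 An)) -mulrBl normrM normfV (gtr0_norm An) ler_pdivrMr//.
    apply: le_trans (hA n) _; rewrite -mulrA mulrCA ler_wpM2l//; lra.
  - have Lh : 0 < L - 2 * h by rewrite /h; lra.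
    apply: (@contraction_cvg0 _ (fun n => 2 * e n / (L - 2 * h)) (r / (L - 2 * h)) M).
    + by rewrite divr_ge0// ltW.
    + by rewrite ltr_pdivrMr// mul1r /h; lra.
    + move=> n Mn; have [An Yn] := inv n Mn.
      have [An1 _] := inv n.+1 (leqW Mn).
      split; first by rewrite divr_ge0// ltW.
      have Nn := leq_trans NM Mn.
      have [s1 s2] := step n Nn An Yn.
      rewrite ler_pdivrMr//; apply: le_trans s2 _.
      have -> : r / (L - 2 * h) * (Y n / A n) + 2 * e n / (L - 2 * h) =
          (r * Y n + 2 * e n * A n) / A n / (L - 2 * h).
        by field; rewrite ?(lt0r_neq0 An) ?(lt0r_neq0 Lh).
      have c0 : 0 <= r * Y n + 2 * e n * A n.
        by rewrite addr_ge0 ?mulr_ge0// ltW.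
      have -> : (r * Y n + 2 * e n * A n) / A n / (L - 2 * h) * A n.+1 =
          (r * Y n + 2 * e n * A n) * (A n.+1 / ((L - 2 * h) * A n)).
        by field; rewrite ?(lt0r_neq0 An) ?(lt0r_neq0 Lh).
      by rewrite ler_peMr// ler_pdivlMr ?mulr_gt0// mul1r.
    + rewrite -(mul0r (L - 2 * h)^-1); apply: cvgM => //; exact: cvg_cst.
right; exists N.
have AY n : (N <= n)%N -> 0 < Y n /\ A n <= Y n.
  move=> Nn; have YA : A n < Y n.
    by rewrite ltNge; apply/negP => YA; apply: noM; exists n.
  by split; [exact: le_lt_trans YA | exact: ltW].
split=> //; apply: cvg_norm_le e2c; exists N => // n /= Nn.
have [Yn An] := AY n Nn.
rewrite -[r](mulfK (lt0r_neq0 Yn)) -mulrBl normrM normfV (gtr0_norm Yn) ler_pdivrMr//.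
apply: le_trans (hY n) _; rewrite -mulrA mulrCA ler_wpM2l//; lra.
Qed.

Lemma limn_esup_leP u r : (forall e : R, 0 < e -> \forall n \near \oo, u n <= r + e) ->
  (limn_esup (EFin \o u) <= r%:E)%E.
Proof.
move=> H; apply/lee_addgt0Pr => e e0.
have [N _ HN] := H e e0.
apply: (@le_trans _ _ (ereal_sup ((EFin \o u) @` [set n | (N <= n)%N]))).
  by apply: ereal_inf_lbound; exists [set n | (N <= n)%N] => //; exists N.
apply: ub_ereal_sup => _ [n /= Nn <-].
by rewrite -EFinD lee_fin; exact: HN.
Qed.

Lemma limn_esup_geP u r :
  (forall N (e : R), 0 < e -> exists n, (N <= n)%N /\ r - e <= u n) ->
  (r%:E <= limn_esup (EFin \o u))%E.
Proof.
move=> H; apply: le_ereal_inf_tmp => _ [V [N _ HN] <-].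
apply/lee_subgt0Pr => e e0; have [n [Nn un]] := H N e e0.
apply: (@le_trans _ _ (u n)%:E); first by rewrite -EFinB lee_fin.
by apply: ereal_sup_ubound; exists n => //; exact: HN.
Qed.

Lemma dominated_root_le u Y r M K : 0 < r -> 0 < K ->
  (forall n, (M <= n)%N -> 0 < Y n) -> Y n.+1 / Y n @[n --> \oo] --> r ->
  (forall n, (M <= n)%N -> `|u n| <= K * Y n) ->
  (limn_esup (fun n => (`|u n| `^ n%:R^-1)%:E) <= r%:E)%E.
Proof.
move=> r0 K0 Y0 Yr uY.
have KYr : (K * Y n.+1) / (K * Y n) @[n --> \oo] --> r.
  apply: cvg_trans Yr; apply: near_eq_cvg; near=> n.
  by rewrite invfM mulrACA divff ?mul1r// gt_eqF.
have KY0 : \forall n \near \oo, 0 < K * Y n.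
  by exists M => // n /= Mn; rewrite mulr_gt0// Y0.
have c := ratio_root r0 KY0 KYr.
apply: limn_esup_leP => e e0.
have h1 : \forall n \near \oo, (K * Y n) `^ n%:R^-1 <= r + e.
  have [N _ HN] := proj1 (cvgrPdist_le _ _) c _ e0; exists N => // n /= /HN.
  by rewrite distrC => /(le_trans (ler_norm _)); lra.
near=> n; apply: (@le_trans _ _ ((K * Y n) `^ n%:R^-1)); last by near: n.
have Mn : (M <= n)%N by near: n; exists M.
rewrite ge0_ler_powR ?invr_ge0 ?nnegrE// ?uY//.
by rewrite mulr_ge0 ?(ltW K0)// ltW// Y0.
Unshelve. all: by end_near. Qed.

(** Only a window of three consecutive terms of u is known to be comparable to Y, so
u_n may be small along a subsequence; this is why the conclusion concerns the limsup.
If all |u_n|^(1/n) were eventually at most s < r, then Y_n would be O(s^n). *)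
Lemma dominated_root_ge u Y r M K : 0 < r -> 0 < K ->
  (forall n, (M <= n)%N -> 0 < Y n) -> Y n.+1 / Y n @[n --> \oo] --> r ->
  (forall n, (M <= n)%N -> Y n <= K * (`|u n| + `|u n.+1| + `|u n.+2|)) ->
  (r%:E <= limn_esup (fun n => (`|u n| `^ n%:R^-1)%:E))%E.
Proof.
move=> r0 K0 Y0 Yr uY; apply: limn_esup_geP => N e e0.
apply/not_existsP => H.
(* The maximum with r / 2 only serves to keep [s] positive. *)
pose s := Num.max (r - e) (r / 2).
have sr : s < r by rewrite gt_max; apply/andP; split; lra.
have s0 : 0 < s by rewrite lt_max; apply/orP; right; lra.
have us n : (N < n)%N -> `|u n| <= s ^+ n.
  move=> Nn; have Hn : `|u n| `^ n%:R^-1 <= s.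
    rewrite le_max; apply/orP; left; rewrite leNgt; apply/negP => h.
    by apply: (H n); split; [exact: ltnW | exact: ltW].
  have n0 : n%:R != 0 :> R by rewrite pnatr_eq0 -lt0n (leq_ltn_trans _ Nn).
  rewrite -[`|u n|]powRr1// -(mulVf n0) powRrM powR_mulrn ?powR_ge0//.
  by rewrite lerXn2r ?nnegrE ?powR_ge0 ?(ltW s0).
have K1 : 0 < K * (1 + s + s ^+ 2).
  by rewrite mulr_gt0// !addr_gt0// exprn_gt0.
have Ys n : (maxn M N.+1 <= n)%N -> Y n <= K * (1 + s + s ^+ 2) * s ^+ n.
  rewrite geq_max => /andP[Mn Nn]; apply: le_trans (uY _ Mn) _.
  rewrite -mulrA ler_wpM2l ?(ltW K0)//.
  have -> : (1 + s + s ^+ 2) * s ^+ n = s ^+ n + s ^+ n.+1 + s ^+ n.+2.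
    by rewrite !exprS; ring.
  by rewrite !lerD// us// (leq_trans Nn)// -addn2 leq_addr.
have ratio : (K * (1 + s + s ^+ 2) * s ^+ n.+1) / (K * (1 + s + s ^+ 2) * s ^+ n) @[n --> \oo] --> s.
  rewrite (_ : (fun n => _) = fun=> s); first exact: cvg_cst.
  apply/funext => n.
  have sn : s ^+ n != 0 by rewrite expf_neq0// gt_eqF.
  rewrite (exprS s n); move: (K * _) (lt0r_neq0 K1) => B B0.
  by field; rewrite ?B0 ?sn.
have pos : \forall n \near \oo, 0 < K * (1 + s + s ^+ 2) * s ^+ n.
  by apply: nearW => n; rewrite mulr_gt0// exprn_gt0.
have Ypos : \forall n \near \oo, 0 < Y n by exists M.
have c1 := ratio_root s0 pos ratio.
have c2 := ratio_root r0 Ypos Yr.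
have : r <= s.
  apply: ler_cvg_to c2 c1 _; near=> n.
  have Mn : (maxn M N.+1 <= n)%N by near: n; exists (maxn M N.+1).
  have Y0n : 0 < Y n by apply: Y0; rewrite (leq_trans _ Mn)// leq_maxl.
  rewrite ge0_ler_powR ?invr_ge0 ?nnegrE ?Ys ?(ltW Y0n)//.
  exact: le_trans (ltW Y0n) (Ys _ Mn).
by rewrite leNgt sr.
Unshelve. all: by end_near. Qed.

Lemma ratio_cvg0 Y r M : 0 < r -> r < 1 ->
  (forall n, (M <= n)%N -> 0 < Y n) -> Y n.+1 / Y n @[n --> \oo] --> r ->
  Y @ \oo --> (0 : R).
Proof.
move=> r0 r1 Y0 Yr; have d0 : 0 < (1 - r) / 2 by lra.
have [N _ HN] := proj1 (cvgrPdist_le _ _) Yr _ d0.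
apply: (@contraction_cvg0 _ (fun=> 0) ((1 + r) / 2) (maxn M N)); [lra|lra| |exact: cvg_cst].
move=> n; rewrite geq_max => /andP[Mn Nn]; have Yn := Y0 _ Mn; split; first exact: ltW.
have := HN _ Nn; rewrite /= distrC => /(le_trans (ler_norm _)).
rewrite lerBlDr ler_pdivrMr// addr0 => h; apply: le_trans h _.
by rewrite ler_wpM2r ?(ltW Yn)//; lra.
Qed.

End Sequences.

(** * A Poincare dichotomy for recurrences of order three *)

Section Poincare.
Context {R : realType}.
Context (u p q s : nat -> R) (L b c : R).

(** With x^2 + b x + c = (x - mu)(x - mu') for conjugate mu and mu', this is the
modulus of x - mu y. *)
Definition qnorm (x y : R) : R := Num.sqrt ((x + b / 2 * y) ^+ 2 + (c - b ^+ 2 / 4) * y ^+ 2).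

Context (c0 : 0 < c) (rL : Num.sqrt c < L) (disc : 0 < c - b ^+ 2 / 4).
Context (pc : p @ \oo --> L - b) (qc : q @ \oo --> b * L - c) (sc : s @ \oo --> L * c).
Context (rec : forall n, u n.+3 = p n * u n.+2 + q n * u n.+1 + s n * u n).
Context (nz : forall n, [|| u n != 0, u n.+1 != 0 | u n.+2 != 0]).

Let k := Num.sqrt (c - b ^+ 2 / 4).
Let k0 : 0 < k. Proof. by rewrite sqrtr_gt0. Qed.
Let kk : k ^+ 2 = c - b ^+ 2 / 4. Proof. by rewrite sqr_sqrtr// ltW. Qed.

Lemma qnorm_ge0 x y : 0 <= qnorm x y. Proof. exact: sqrtr_ge0. Qed.

Lemma sqr_qnorm x y : qnorm x y ^+ 2 = (x + b / 2 * y) ^+ 2 + (k * y) ^+ 2.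
Proof.
rewrite sqr_sqrtr ?exprMn ?kk//.
by rewrite addr_ge0 ?sqr_ge0// mulr_ge0 ?sqr_ge0// ltW.
Qed.

Lemma qnorm_y x y : k * `|y| <= qnorm x y.
Proof.
rewrite -(@ler_pXn2r _ 2)// ?nnegrE ?mulr_ge0 ?qnorm_ge0 ?(ltW k0)//.
by rewrite sqr_qnorm !exprMn real_normK ?num_real// lerDr sqr_ge0.
Qed.

Lemma qnorm_x x y : `|x + b / 2 * y| <= qnorm x y.
Proof.
rewrite -(@ler_pXn2r _ 2)// ?nnegrE ?qnorm_ge0//.
by rewrite sqr_qnorm real_normK ?num_real// lerDl sqr_ge0.
Qed.

Lemma qnorm_le x y : qnorm x y <= `|x + b / 2 * y| + k * `|y|.
Proof.
rewrite -(@ler_pXn2r _ 2)// ?nnegrE ?qnorm_ge0 ?addr_ge0 ?mulr_ge0 ?(ltW k0)//.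
rewrite sqr_qnorm; set z := x + _.
have -> : (`|z| + k * `|y|) ^+ 2 = `|z| ^+ 2 + 2 * (`|z| * (k * `|y|)) + k ^+ 2 * `|y| ^+ 2 by ring.
rewrite !real_normK ?num_real// exprMn.
have : 0 <= `|z| * (k * `|y|) by rewrite !mulr_ge0// ltW.
by move: (`|z| * _) => v; lra.
Qed.

Lemma qnorm_perturb x y d : qnorm (x + d) y <= qnorm x y + `|d|.
Proof.
rewrite -(@ler_pXn2r _ 2)// ?nnegrE ?qnorm_ge0 ?addr_ge0 ?qnorm_ge0//.
have -> : (qnorm x y + `|d|) ^+ 2 = qnorm x y ^+ 2 + 2 * (qnorm x y * `|d|) + `|d| ^+ 2 by ring.
rewrite !sqr_qnorm real_normK ?num_real//.
have h := qnorm_x x y.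
have : (x + b / 2 * y) * d <= qnorm x y * `|d|.
  apply: le_trans (ler_norm _) _; rewrite normrM ler_wpM2r//.
move: (qnorm x y * `|d|) => z hz.
have -> : (x + d + b / 2 * y) ^+ 2 = (x + b / 2 * y) ^+ 2 + 2 * ((x + b / 2 * y) * d) + d ^+ 2 by ring.
lra.
Qed.

Lemma qnorm_perturb_abs x y d : `|qnorm (x + d) y - qnorm x y| <= `|d|.
Proof.
rewrite ler_norml; apply/andP; split.
- have := qnorm_perturb (x + d) y (- d); rewrite addrK normrN; lra.
- have := qnorm_perturb x y d; lra.
Qed.

(** The recurrence x_(n+1) = - b x_n - c x_(n-1) multiplies x_n - mu x_(n-1) by
mu', whose modulus is sqrt c. *)
Lemma qnorm_rotate x y : qnorm (- b * x - c * y) x = Num.sqrt c * qnorm x y.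
Proof.
rewrite /qnorm -sqrtrM ?(ltW c0)//; congr Num.sqrt.
by field.
Qed.

(** Applying the factor E - L of the limiting operator
(E - L)(E^2 + b E + c), with E the shift, isolates the pair; applying
E^2 + b E + c isolates the dominant zero ([X] below). *)
Let w n := u n.+2 - L * u n.+1.
Let w' n := u n.+1 - L * u n.
Let X n := u n.+2 + b * u n.+1 + c * u n.
Let Y n := qnorm (w n) (w' n).
(** The quadratic factor at L, positive since its zeros are not real. *)
Let D := L ^+ 2 + b * L + c.
(** The error made by replacing the coefficients with their limits. *)
Let del n := u n.+3 - (L - b) * u n.+2 - (b * L - c) * u n.+1 - L * c * u n.
Let S n := `|u n| + `|u n.+1| + `|u n.+2|.
Let eta n := `|p n - (L - b)| + `|q n - (b * L - c)| + `|s n - L * c|.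

Let L0 : 0 < L. Proof. exact: le_lt_trans (sqrtr_ge0 _) rL. Qed.

Let D0 : 0 < D.
Proof.
have -> : D = (L + b / 2) ^+ 2 + (c - b ^+ 2 / 4) by rewrite /D; field.
by rewrite ltr_wpDl// sqr_ge0.
Qed.

Let X_step n : X n.+1 - L * X n = del n.
Proof. by rewrite /X /del; ring. Qed.

Let Y_step n : `|Y n.+1 - Num.sqrt c * Y n| <= `|del n|.
Proof.
rewrite /Y -qnorm_rotate (_ : w' n.+1 = w n)//.
have -> : w n.+1 = - b * w n - c * w' n + del n by rewrite /w /w' /del; ring.
exact: qnorm_perturb_abs.
Qed.

Let del_bound n : `|del n| <= eta n * S n.
Proof.
have -> : del n = (p n - (L - b)) * u n.+2 + (q n - (b * L - c)) * u n.+1 + (s n - L * c) * u n.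
  by rewrite /del rec; ring.
apply: le_trans (ler_normD _ _) _; apply: le_trans (lerD (ler_normD _ _) (lexx _)) _.
rewrite !normrM /eta /S.
have := normr_ge0 (p n - (L - b)); have := normr_ge0 (q n - (b * L - c)).
have := normr_ge0 (s n - L * c).
have := normr_ge0 (u n); have := normr_ge0 (u n.+1); have := normr_ge0 (u n.+2).
move: `|p n - _| `|q n - _| `|s n - _| `|u n| `|u n.+1| `|u n.+2| => x1 x2 x3 y1 y2 y3.
nra.
Qed.

Let eta_cvg : eta @ \oo --> (0 : R).
Proof.
have N f l : f @ \oo --> (l : R) -> `|f n - l| @[n --> \oo] --> (0 : R).
  move=> fl; rewrite -(normr0 R) -(subrr l).
  by apply: cvg_norm; apply: cvgB => //; exact: cvg_cst.
rewrite -[X in _ --> X]addr0 -[X in _ --> X + _]addr0.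
by apply: cvgD; [apply: cvgD|]; exact: N.
Qed.

Let u_XY n : D * u n = X n - w n - (b + L) * w' n.
Proof. by rewrite /D /X /w /w'; ring. Qed.

Let K1 := (1 + `|b / 2| / k + `|b + L| / k) / D.

Let w'_bound n : `|w' n| <= Y n / k.
Proof. by rewrite ler_pdivlMr// mulrC; exact: qnorm_y. Qed.

Let w_bound n : `|w n| <= (1 + `|b / 2| / k) * Y n.
Proof.
have -> : w n = (w n + b / 2 * w' n) - b / 2 * w' n by ring.
apply: le_trans (ler_normB _ _) _.
rewrite mulrDl mul1r lerD//; first exact: qnorm_x.
by rewrite normrM mulrAC -mulrA ler_wpM2l// w'_bound.
Qed.

(** When X dominates, u_n is close to X_n / D. *)
Let u_X_bound n : `|u n - X n / D| <= K1 * Y n.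
Proof.
have -> : u n - X n / D = - (w n + (b + L) * w' n) / D.
  have <- : D * u n / D = u n by rewrite mulrC mulKf// gt_eqF.
  by rewrite u_XY; field; rewrite gt_eqF.
rewrite normrM normrN normfV (gtr0_norm D0) /K1 mulrAC ler_wpM2r ?invr_ge0 ?(ltW D0)//.
apply: le_trans (ler_normD _ _) _; rewrite [X in _ <= X]mulrDl lerD ?w_bound//.
by rewrite normrM mulrAC -mulrA ler_wpM2l// w'_bound.
Qed.

Let K1_ge0 : 0 <= K1.
Proof.
have kV : 0 <= k^-1 by rewrite invr_ge0 ltW.
by rewrite /K1 mulr_ge0 ?invr_ge0 ?(ltW D0)// !addr_ge0// mulr_ge0.
Qed.

(** The change of coordinates between three consecutive terms and (X, Y) is
invertible: this bound and the next are its two continuity estimates. *)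
Let S_bound : exists2 K, 0 < K & forall n, S n <= K * (`|X n| + Y n).
Proof.
(* Bounds for u_n, u_(n+1), u_(n+2), each obtained from the previous one. *)
pose a0 := D^-1 + K1.
pose a1 := k^-1 + L * a0.
pose a2 := (1 + `|b / 2| / k) + L * a1.
have kV : 0 <= k^-1 by rewrite invr_ge0 ltW.
have a00 : 0 < a0 by apply: ltr_wpDr; [exact: K1_ge0 | rewrite invr_gt0].
have a10 : 0 < a1 by rewrite ltr_wpDl// mulr_gt0.
have a20 : 0 < a2 by rewrite ltr_wpDl ?mulr_gt0// addr_ge0// mulr_ge0.
exists (a0 + a1 + a2); first by apply: addr_gt0 => //; exact: addr_gt0.
move=> n; have Yn : 0 <= Y n by exact: qnorm_ge0.
have Xn := normr_ge0 (X n).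
have u0 : `|u n| <= a0 * (`|X n| + Y n).
  have -> : u n = X n / D + (u n - X n / D) by ring.
  apply: le_trans (ler_normD _ _) _; rewrite normrM normfV (gtr0_norm D0).
  apply: le_trans (lerD (lexx _) (u_X_bound n)) _.
  have -> : a0 * (`|X n| + Y n) = `|X n| / D + K1 * Y n + (D^-1 * Y n + K1 * `|X n|).
    by rewrite /a0; ring.
  by rewrite lerDl addr_ge0// mulr_ge0// invr_ge0 ltW.
have u1 : `|u n.+1| <= a1 * (`|X n| + Y n).
  have -> : u n.+1 = w' n + L * u n by rewrite /w'; ring.
  apply: le_trans (ler_normD _ _) _.
  rewrite normrM (gtr0_norm L0) /a1 mulrDl lerD//.
    apply: le_trans (w'_bound n) _; rewrite mulrC ler_wpM2l//; lra.
  by rewrite -mulrA ler_wpM2l// ltW.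
have u2 : `|u n.+2| <= a2 * (`|X n| + Y n).
  have -> : u n.+2 = w n + L * u n.+1 by rewrite /w; ring.
  apply: le_trans (ler_normD _ _) _.
  rewrite normrM (gtr0_norm L0) /a2 mulrDl lerD//.
    apply: le_trans (w_bound n) _; rewrite ler_wpM2l//; last by lra.
    by rewrite addr_ge0// mulr_ge0.
  by rewrite -mulrA ler_wpM2l// ltW.
by rewrite /S (mulrDl (a0 + a1) a2) (mulrDl a0 a1); apply: lerD => //; exact: lerD.
Qed.

Let Y_bound : exists2 K, 0 < K & forall n, Y n <= K * S n.
Proof.
pose B := 1 + L + `|b / 2| * (1 + L) + k * (1 + L).
have B0 : 0 < B.
  rewrite /B; have := mulr_ge0 (normr_ge0 (b / 2)) (ltW (addr_gt0 ltr01 L0)).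
  have := mulr_gt0 k0 (addr_gt0 ltr01 L0); have := L0; lra.
exists B => // n; apply: le_trans (qnorm_le _ _) _.
have s0 : 0 <= S n by rewrite !addr_ge0.
have l0 := ltW L0.
have h1 : `|w n| <= (1 + L) * S n.
  apply: le_trans (ler_normB _ _) _; rewrite normrM (gtr0_norm L0).
  rewrite mulrDl mul1r lerD//; first by rewrite /S lerDr addr_ge0.
  by rewrite ler_wpM2l// /S -addrA addrCA lerDl addr_ge0.
have h2 : `|w' n| <= (1 + L) * S n.
  apply: le_trans (ler_normB _ _) _; rewrite normrM (gtr0_norm L0).
  rewrite mulrDl mul1r lerD//; first by rewrite /S -addrA addrCA lerDl addr_ge0.
  by rewrite ler_wpM2l// /S -addrA lerDl addr_ge0.
apply: le_trans (lerD (ler_normD _ _) (lexx _)) _.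
rewrite /B !mulrDl normrM.
have h3 : `|b / 2| * `|w' n| <= `|b / 2| * ((1 + L) * S n) by rewrite ler_wpM2l.
have h4 : k * `|w' n| <= k * ((1 + L) * S n) by rewrite ler_wpM2l// ltW.
rewrite -!mulrA; rewrite !mulrDl in h1 h3 h4 *.
by lra.
Qed.

(** Both coordinates obey their limiting first-order recurrence up to the error
[del], which is negligible relative to |X| + Y; hence [mode_dichotomy] applies. *)
Theorem poincare_dichotomy :
  (`|u n| `^ n%:R^-1 @[n --> \oo] --> L) \/
  (limn_esup (fun n => (`|u n| `^ n%:R^-1)%:E) = (Num.sqrt c)%:E /\
   (Num.sqrt c < 1 -> u @ \oo --> (0 : R))).
Proof.
have [K KP SK] := S_bound; have [K' KP' YK'] := Y_bound.
have r0 : 0 < Num.sqrt c by rewrite sqrtr_gt0.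
have Y0 n : 0 <= Y n by exact: qnorm_ge0.
have eta0 n : 0 <= eta n by rewrite !addr_ge0.
have S0 n : 0 < S n.
  have := nz n; rewrite /S -!normr_gt0.
  have := normr_ge0 (u n); have := normr_ge0 (u n.+1); have := normr_ge0 (u n.+2).
  by move=> h1 h2 h3 /or3P[] h; lra.
have e0 n : 0 <= K * eta n by rewrite mulr_ge0// ltW.
have ec : (fun n => K * eta n) @ \oo --> (0 : R).
  by rewrite -(mulr0 K); apply: cvgM; [exact: cvg_cst | exact: eta_cvg].
have del_b n : `|del n| <= K * eta n * (`|X n| + Y n).
  apply: le_trans (del_bound n) _.
  by rewrite [K * _]mulrC -mulrA ler_wpM2l.
have := @mode_dichotomy R (fun n => `|X n|) Y (fun n => K * eta n) L (Num.sqrt c) r0 rL.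
case=> //.
- by move=> n; have := lt_le_trans (S0 n) (SK n); rewrite pmulr_rgt0.
- move=> n; apply: le_trans (del_b n); rewrite -X_step.
  rewrite -[L * `|X n|](_ : `|L * X n| = _); last by rewrite normrM gtr0_norm.
  exact: ler_dist_dist.
- by move=> n; apply: le_trans (Y_step n) (del_b n).
- move=> [M [A0 AL YA]]; left.
  have DX : `|u n| / `|X n| @[n --> \oo] --> D^-1.
    have K1c : K1 * (Y n / `|X n|) @[n --> \oo] --> (0 : R).
      by rewrite -(mulr0 K1); apply: cvgM => //; exact: cvg_cst.
    apply: cvg_norm_le K1c; exists M => // n /= Mn.
    have Xn := A0 n Mn.
    have -> : D^-1 = `|X n / D| / `|X n|.
      by rewrite normrM normfV (gtr0_norm D0) mulrC mulKf// gt_eqF.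
    rewrite -mulrBl normrM normfV normr_id mulrA ler_wpM2r ?invr_ge0//.
    by apply: le_trans (ler_dist_dist _ _) _; exact: u_X_bound.
  have uP : \forall n \near \oo, 0 < `|u n|.
    have d2 : 0 < D^-1 / 2 by rewrite divr_gt0// invr_gt0.
    have [N _ HN] := proj1 (cvgrPdist_le _ _) DX _ d2.
    exists (maxn M N) => // n /=; rewrite geq_max => /andP[Mn Nn].
    have := HN _ Nn; rewrite /= => /(le_trans (ler_norm _)) h.
    have : 0 < `|u n| / `|X n| by move: h d2; move: (_ / `|X n|) (D^-1) => x y; lra.
    by rewrite pmulr_lgt0// invr_gt0 A0.
  apply: ratio_root => //.
  have DX1 : `|u n.+1| / `|X n.+1| @[n --> \oo] --> D^-1.
    by rewrite (cvg_shiftS (fun n => `|u n| / `|X n|)).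
  have DVn : D^-1 != 0 by rewrite invr_eq0 gt_eqF.
  have EL : D^-1 * L / D^-1 = L by rewrite mulrAC divff ?mul1r.
  rewrite -[X in _ --> X]EL.
  apply: cvg_trans (cvgM (cvgM DX1 AL) (cvgV DVn DX)).
  apply: near_eq_cvg; near=> n.
  have u0 : 0 < `|u n| by near: n.
  have X0 : 0 < `|X n| by apply: A0; near: n; exists M.
  have X1 : 0 < `|X n.+1| by apply: A0; apply: leqW; near: n; exists M.
  change (`|u n.+1| / `|X n.+1| * (`|X n.+1| / `|X n|) * (`|u n| / `|X n|)^-1 = `|u n.+1| / `|u n|).
  move: (lt0r_neq0 u0) (lt0r_neq0 X0) (lt0r_neq0 X1).
  move: `|u n| `|X n| `|X n.+1| `|u n.+1| => x1 x2 x3 x4 h1 h2 h3.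
  by field; rewrite ?h1 ?h2 ?h3.
- move=> [M [AY Yr]]; right.
  have Yp n : (M <= n)%N -> 0 < Y n by move=> /AY[].
  have uY n : (M <= n)%N -> `|u n| <= 2 * K * Y n.
    move=> Mn; have [_ XY] := AY n Mn.
    have uS : `|u n| <= S n by rewrite /S -addrA lerDl addr_ge0.
    apply: le_trans uS _; apply: le_trans (SK n) _.
    rewrite -mulrA mulrCA ler_wpM2l ?(ltW KP)//; lra.
  split.
    apply/eqP; rewrite eq_le; apply/andP; split.
      by apply: (@dominated_root_le _ u Y _ M (2 * K)) => //; rewrite mulr_gt0.
    by apply: (@dominated_root_ge _ u Y _ M K') => // n _; exact: YK'.
  move=> r1; have Yc := ratio_cvg0 r0 r1 Yp Yr.
  have K2c : (fun n => 2 * K * Y n) @ \oo --> (0 : R).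
    by rewrite -(mulr0 (2 * K)); apply: cvgM => //; exact: cvg_cst.
  by apply: cvg_norm_le K2c; exists M => // n /= Mn; rewrite subr0; exact: uY.
Unshelve. all: by end_near. Qed.

End Poincare.

(** * The characteristic polynomial *)

Section Roots.
Context {R : realType}.

(** The intermediate value theorem, on a bracket narrow enough for the decimals of
all quantities derived from the root. *)
Lemma chi_root : exists2 L : R,
  54 + 963 / 1000 + 695 / 1000 ^+ 2 + 98 / 1000 ^+ 3 + 300 / 1000 ^+ 4 <= L <=
  54 + 963 / 1000 + 695 / 1000 ^+ 2 + 98 / 1000 ^+ 3 + 400 / 1000 ^+ 4 &
  4 * L ^+ 3 - 220 * L ^+ 2 + 8 * L - 1 = 0.
Proof.
have E (x : R) : (chi R).[x] = 4 * x ^+ 3 - 220 * x ^+ 2 + 8 * x - 1.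
  by rewrite /chi !(hornerD, hornerN, hornerZ, hornerXn, hornerX, hornerC).
have [||L hL /rootP rL] := @poly_ivt R (chi R)
  (54 + 963 / 1000 + 695 / 1000 ^+ 2 + 98 / 1000 ^+ 3 + 300 / 1000 ^+ 4)
  (54 + 963 / 1000 + 695 / 1000 ^+ 2 + 98 / 1000 ^+ 3 + 400 / 1000 ^+ 4).
- lra.
- rewrite !E; apply/andP; split; lra.
- by exists L => //; rewrite -E.
Qed.

(** The coefficient of degree [d], with the bound on the degree that makes
it add and multiply; [c] may be 0. *)
Definition top_coef (p : {poly R}) d c := (size p <= d.+1)%N /\ p`_d = c.

Lemma top_coefC c : top_coef c%:P 0 c.
Proof. by split; [exact: size_polyC_leq1 | rewrite coefC]. Qed.

Lemma top_coef1 : top_coef 1 0 1. Proof. exact: top_coefC. Qed.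

Lemma top_coefXn n : top_coef 'X^n n 1.
Proof. by split; [rewrite size_polyXn | rewrite coefXn eqxx]. Qed.

Lemma top_coefX : top_coef 'X 1 1.
Proof. by split; [rewrite size_polyX | rewrite coefX]. Qed.

Lemma top_coefZ k p d c : top_coef p d c -> top_coef (k *: p) d (k * c).
Proof.
move=> [s e]; split; last by rewrite coefZ e.
exact: leq_trans (size_scale_leq _ _) s.
Qed.

Lemma top_coefN p d c : top_coef p d c -> top_coef (- p) d (- c).
Proof. by move=> [s e]; split; [rewrite size_polyN | rewrite coefN e]. Qed.

Lemma top_coefD p q d e c c' : top_coef p d c -> top_coef q e c' -> (e < d)%N -> top_coef (p + q) d c.
Proof.
move=> [s h] [s' h'] ed; split.
  apply: leq_trans (size_polyD _ _) _; rewrite geq_max s/=.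
  by apply: leq_trans s' _; exact: leqW.
by rewrite coefD h nth_default ?addr0// (leq_trans s').
Qed.

Lemma top_coefB p q d e c c' : top_coef p d c -> top_coef q e c' -> (e < d)%N -> top_coef (p - q) d c.
Proof. by move=> hp /top_coefN hq; exact: top_coefD hp hq. Qed.

Lemma top_coefM p q d e c c' : top_coef p d c -> top_coef q e c' -> top_coef (p * q) (d + e) (c * c').
Proof.
move=> [s h] [s' h']; split.
  apply: leq_trans (size_polyMleq _ _) _.
  rewrite -subn1 leq_subLR; apply: leq_trans (leq_add s s') _.
  by rewrite addSn addnS.
have dd : (d < (d + e).+1)%N by rewrite ltnS leq_addr.
rewrite coefM (bigD1 (Ordinal dd))//= addKn h h' big1 ?addr0// => i ni.
have [id|di|E] := ltngtP i d.
- rewrite [q`_ _]nth_default ?mulr0//; apply: leq_trans s' _.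
  by rewrite ltn_subRL ltn_add2r.
- by rewrite nth_default ?mul0r// (leq_trans s).
- by case/eqP: ni; apply/val_inj.
Qed.

Lemma top_coefXp p d c n : top_coef p d c -> top_coef (p ^+ n) (d * n) (c ^+ n).
Proof.
move=> hp; elim: n => [|n IH]; first by rewrite muln0 !expr0; exact: top_coef1.
by rewrite mulnS !exprS; exact: top_coefM.
Qed.

Lemma rec_coef_top :
  [/\ top_coef (rec_coef R)`_0 6 (- 946), top_coef (rec_coef R)`_1 6 (946 * 8),
      top_coef (rec_coef R)`_2 6 (946 * (- 220)) & top_coef (rec_coef R)`_3 6 (946 * 4)].
Proof.
have C (p : {poly R}) d c c' : top_coef p d c -> c = c' -> top_coef p d c' by move=> h <-.
split; rewrite /rec_coef; cbn [nth].
- apply: (@C _ 6 _ _ (top_coefN (top_coefM (top_coefM (top_coefD (top_coefD (top_coefZ 946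
  (top_coefXn 2)) (top_coefZ 1161 top_coefX) isT) (top_coefC 368) isT) top_coefX)
    (top_coefXp 3 (top_coefB top_coefX top_coef1 isT))))).
  by rewrite expr1n !mulr1.
- apply: (@C _ 6 _ _ (top_coefM (top_coefZ 2 (top_coefB (top_coefD (top_coefD (top_coefB (top_coefB
  (top_coefZ 3784 (top_coefXn 5)) (top_coefZ 1032 (top_coefXn 4)) isT)
    (top_coefZ 1925 (top_coefXn 3)) isT) (top_coefZ 853 (top_coefXn 2)) isT)
      (top_coefZ 328 top_coefX) isT) (top_coefC 184) isT)) top_coefX)).
  by ring.
- apply: (@C _ 6 _ _ (top_coefN (top_coefZ 2 (top_coefD (top_coefD (top_coefB (top_coefB (top_coefD
  (top_coefD (top_coefZ (104 * 1000 + 60) (top_coefXn 6))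
    (top_coefZ (127 * 1000 + 710) (top_coefXn 5)) isT) (top_coefZ (12 * 1000 + 788) (top_coefXn 4)) isT)
    (top_coefZ (34 * 1000 + 525) (top_coefXn 3)) isT) (top_coefZ (8 * 1000 + 482) (top_coefXn 2)) isT)
    (top_coefZ 3298 top_coefX) isT) (top_coefC 1071) isT)))).
  by ring.
- apply: (@C _ 6 _ _ (top_coefM (top_coefM (top_coefZ 2 (top_coefD (top_coefB (top_coefZ 946
  (top_coefXn 2)) (top_coefZ 731 top_coefX) isT) (top_coefC 153) isT))
    (top_coefD (top_coefZ 2 top_coefX) top_coef1 isT)) (top_coefXp 3 (top_coefD top_coefX top_coef1 isT)))).
  by ring.
Qed.

Lemma charpolyE : rec_charpoly (rec_coef R) = 946 *: chi R.
Proof.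
have [[s0 t0] [s1 t1] [s2 t2] [s3 t3]] := rec_coef_top.
have sz3 : size (rec_coef R)`_3 = 7%N.
  apply/eqP; rewrite eqn_leq s3/= ltnNge; apply/negP => s6.
  have := t3; rewrite nth_default// => /eqP; rewrite eq_sym mulf_eq0 => /orP[]/eqP; lra.
(* Each coefficient has degree at most 6, and the leading one exactly 6. *)
have d6 : (\max_(j < size (rec_coef R)) size (nth 0%R (rec_coef R) j)).-1 = 6%N.
  rewrite -[size (rec_coef R)]/4%N !big_ord_recl big_ord0 maxn0.
  rewrite (_ : size _ = size (rec_coef R)`_0)//.
  have -> : maxn (size (rec_coef R)`_0) (maxn (size (rec_coef R)`_1) (maxn (size (rec_coef R)`_2)
    (size (rec_coef R)`_3))) = 7%N.
    by apply/eqP; rewrite eqn_leq !geq_max s0 s1 s2 s3 sz3 !leq_max leqnn !orbT.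
  by [].
rewrite /rec_charpoly d6 -[size (rec_coef R)]/4%N.
apply/polyP => j; rewrite coef_poly coefZ /chi !(coefB, coefD, coefZ, coefXn, coefX, coef1).
case: j => [|[|[|[|j]]]] /=.
- by rewrite t0; ring.
- by rewrite t1; ring.
- by rewrite t2; ring.
- by rewrite t3; ring.
- by ring.
Qed.

(** p(n) / n^d is the value at 1 / n of the reversed polynomial. *)
Lemma cvg_horner_ratio (p : {poly R}) d : (size p <= d.+1)%N ->
  p.[n%:R] / n%:R ^+ d @[n --> \oo] --> p`_d.
Proof.
move=> sp.
pose r := \poly_(i < d.+1) p`_(d - i).
have r0 : r.[0] = p`_d by rewrite horner_coef0 coef_poly subn0.
rewrite -(cvg_shiftS (fun n => p.[n%:R] / n%:R ^+ d)) -r0.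
have c : r.[n.+1%:R^-1] @[n --> \oo] --> r.[0].
  by apply: continuous_cvg; [exact: continuous_horner | exact: cvg_harmonic].
apply: cvg_trans c; apply: near_eq_cvg; apply: nearW => n.
rewrite /= (horner_coef_wide _ sp) horner_poly mulr_suml.
rewrite [RHS](reindex_inj rev_ord_inj)/=; apply: eq_bigr => i _.
have ile : (i <= d)%N by rewrite -ltnS.
rewrite subSS -mulrA; congr (_ * _).
have n0 : n.+1%:R != 0 :> R by rewrite pnatr_eq0.
rewrite -[in X in _ / X](subnK ile) exprD invfM mulrA divff ?mul1r ?exprVn// expf_neq0.
Qed.

End Roots.

(** * Asymptotics *)

Section Asymptotics.
Context {R : realType}.
Implicit Types (u : nat -> R).

Lemma rec_at3_neq0 n : (2 <= n)%N -> rec_at R 3 n != 0.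
Proof.
move=> n2; rewrite rec_atE//; have : 2 <= n%:R :> R by rewrite ler_nat.
move: n%:R => x x2; apply: lt0r_neq0; rewrite /rec_fun.
have h1 : 0 < 946 * x ^+ 2 - 731 * x + 153 by nra.
by rewrite !mulr_gt0 ?exprn_gt0//; lra.
Qed.

Lemma rec_at0_neq0 n : (2 <= n)%N -> rec_at R 0 n != 0.
Proof.
move=> n2; rewrite rec_atE//; have : 2 <= n%:R :> R by rewrite ler_nat.
move: n%:R => x x2; rewrite /rec_fun oppr_eq0; apply: lt0r_neq0.
have h1 : 0 < 946 * x ^+ 2 + 1161 * x + 368 by nra.
by rewrite !mulr_gt0 ?exprn_gt0//; lra.
Qed.

(** The trailing coefficient does not vanish, so three consecutive zeros would
propagate down to the initial values. *)
Lemma solution_nonzero u : satisfies_rec u -> [|| u 0%N != 0, u 1%N != 0 | u 2%N != 0] ->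
  forall n, [|| u n != 0, u n.+1 != 0 | u n.+2 != 0].
Proof.
move=> hu h0; elim=> [//|n IH].
have := hu n.+2 isT => /=.
case: (eqVneq (u n.+1) 0) IH => //= u1.
case: (eqVneq (u n.+2) 0) => //= u2.
case: (eqVneq (u n.+3) 0) => //= u3; rewrite orbF => un.
rewrite u1 u2 u3 !mulr0 !add0r => /eqP.
by rewrite mulf_eq0 (negbTE un) orbF (negbTE (rec_at0_neq0 _)).
Qed.

Lemma rec_ratio_cvg j c : (j < 3)%N -> top_coef (rec_coef R)`_j 6 c ->
  - (rec_at R j n.+2 / rec_at R 3 n.+2) @[n --> \oo] --> - (c / (946 * 4)).
Proof.
move=> j3 [sj tj]; have [_ _ _ [s3 t3]] := @rec_coef_top R.
apply: cvgN.
rewrite (cvg_shiftS (fun n => rec_at R j n.+1 / rec_at R 3 n.+1)).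
rewrite (cvg_shiftS (fun n => rec_at R j n / rec_at R 3 n)).
have cj := cvg_horner_ratio sj; have c3 := cvg_horner_ratio s3.
rewrite tj in cj; rewrite t3 in c3.
have nz : (946 * 4 : R) != 0 by apply: lt0r_neq0; lra.
apply: cvg_trans (cvgM cj (cvgV nz c3)).
apply: near_eq_cvg; exists 2%N => // n /= n2.
have n0 : n%:R ^+ 6 != 0 :> R by rewrite expf_neq0// pnatr_eq0 -lt0n ltnW.
change (((rec_coef R)`_j).[n%:R] / n%:R ^+ 6 * (((rec_coef R)`_3).[n%:R] / n%:R ^+ 6)^-1 =
  rec_at R j n / rec_at R 3 n).
rewrite -/(rec_at R j n) -/(rec_at R 3 n).
have r3 := rec_at3_neq0 n2.
move: (rec_at R j n) (rec_at R 3 n) r3 (n%:R ^+ 6) n0 => x y y0 z z0.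
by field; rewrite ?y0 ?z0.
Qed.

Record dominant_root (L : R) : Prop := DominantRoot {
  dominant_root_ge : 54 + 963 / 1000 + 695 / 1000 ^+ 2 + 98 / 1000 ^+ 3 + 300 / 1000 ^+ 4 <= L;
  dominant_root_le : L <= 54 + 963 / 1000 + 695 / 1000 ^+ 2 + 98 / 1000 ^+ 3 + 400 / 1000 ^+ 4;
  dominant_root_eq : 4 * L ^+ 3 - 220 * L ^+ 2 + 8 * L - 1 = 0 }.

(** Grouping the nine digits by three keeps the numerals small. *)
Lemma has_decimals_thousands (x : R) N d1 d2 d3 d4 d5 d6 d7 d8 d9 :
  N%:R + (100 * d1%:R + 10 * d2%:R + d3%:R) / 1000
    + (100 * d4%:R + 10 * d5%:R + d6%:R) / 1000 ^+ 2
    + (100 * d7%:R + 10 * d8%:R + d9%:R) / 1000 ^+ 3 <= x ->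
  x < N%:R + (100 * d1%:R + 10 * d2%:R + d3%:R) / 1000
    + (100 * d4%:R + 10 * d5%:R + d6%:R) / 1000 ^+ 2
    + (100 * d7%:R + 10 * d8%:R + d9%:R + 1) / 1000 ^+ 3 ->
  has_decimals x N [:: d1; d2; d3; d4; d5; d6; d7; d8; d9]%N.
Proof.
rewrite /has_decimals /= !big_ord_recl big_ord0 /=.
move: N%:R d1%:R d2%:R d3%:R d4%:R d5%:R d6%:R d7%:R d8%:R d9%:R => *.
by apply/andP; split; lra.
Qed.

Lemma zeta_gt0 s : (1 < s)%N -> 0 < zeta R s.
Proof.
move=> s1; have sz : summable (fun k => (k%:R ^+ s)^-1 : R).
  by apply: eq_summable (@summable_zeta_tail R s 0 s1) => k _; rewrite addr0.
have := @sum_pos_ge R (fun k => (k%:R ^+ s)^-1) 1 _ sz.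
rewrite /series/= big_nat1 expr1n invr1 => /(_ _)/(lt_le_trans ltr01); apply.
by move=> k _; rewrite invr_ge0 exprn_ge0.
Qed.

Section Root.
Context (L : R) (HL : dominant_root L).

(** The squared modulus of the complex zeros: the product of the three zeros is
1/4. *)
Definition root_normsq := (4 * L)^-1.

Lemma L_gt0 : 0 < L. Proof. by have [L1 L2 _] := HL; lra. Qed.

Lemma root_normsqE : root_normsq = L ^+ 2 - 55 * L + 2.
Proof.
have L0 := L_gt0; have l0 : 4 * L != 0 by apply: lt0r_neq0; lra.
have [_ _ rL] := HL.
by apply: (mulfI l0); rewrite /root_normsq divff//; lra.
Qed.

Lemma L_root_normsq : L * root_normsq = 4^-1.
Proof. by rewrite /root_normsq invfM mulrCA divff ?mulr1// lt0r_neq0// L_gt0. Qed.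

Lemma root_normsq_bounds :
  4 / 1000 + 548 / 1000 ^+ 2 + 456 / 1000 ^+ 3 + 932 / 1000 ^+ 4 <= root_normsq <=
  4 / 1000 + 548 / 1000 ^+ 2 + 456 / 1000 ^+ 3 + 933 / 1000 ^+ 4.
Proof.
have h := L_root_normsq; have l0 := L_gt0; have [L1 L2 _] := HL.
apply/andP; split; rewrite -(ler_pM2l l0) h; lra.
Qed.

(** The sum of the three zeros is 55. *)
Definition re1 := (55 - L) / 2.
Definition im1 := Num.sqrt (root_normsq - re1 ^+ 2).

Lemma im1_sqr_bounds :
  (64 / 1000 + 953 / 1000 ^+ 2 + 409 / 1000 ^+ 3 : R) ^+ 2 <= root_normsq - re1 ^+ 2 <
  (64 / 1000 + 953 / 1000 ^+ 2 + 410 / 1000 ^+ 3) ^+ 2.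
Proof.
have sq (x y : R) : 0 <= x -> x <= y -> x ^+ 2 <= y ^+ 2.
  by move=> x0 xy; rewrite lerXn2r ?nnegrE// (le_trans x0).
have lo0 : 0 <= 18 / 1000 + 152 / 1000 ^+ 2 + 450 / 1000 ^+ 3 + 800 / 1000 ^+ 4 :> R by lra.
have [L1 L2 _] := HL.
have r1 : 18 / 1000 + 152 / 1000 ^+ 2 + 450 / 1000 ^+ 3 + 800 / 1000 ^+ 4 <= re1.
  by rewrite /re1; lra.
have r2 : re1 <= 18 / 1000 + 152 / 1000 ^+ 2 + 450 / 1000 ^+ 3 + 850 / 1000 ^+ 4.
  by rewrite /re1; lra.
have q1 := sq _ _ lo0 r1; have q2 := sq _ _ (le_trans lo0 r1) r2.
move: q1 q2; have /andP[] := root_normsq_bounds; clear.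
move: root_normsq (re1 ^+ 2) => x y *.
by apply/andP; split; lra.
Qed.

Lemma sqrt_bounds (x lo hi : R) : 0 <= lo -> 0 <= hi -> lo ^+ 2 <= x < hi ^+ 2 ->
  lo <= Num.sqrt x < hi.
Proof.
move=> l0 h0 /andP[h1 h2].
have x0 : 0 <= x by apply: le_trans h1; exact: sqr_ge0.
rewrite -[lo in lo <= _](ger0_norm l0) -sqrtr_sqr ler_sqrt//= h1/=.
by rewrite -[hi](ger0_norm h0) -sqrtr_sqr ltr_sqrt// (le_lt_trans x0).
Qed.

Lemma decimals_L : has_decimals L 54 [:: 9; 6; 3; 6; 9; 5; 0; 9]%N.
Proof.
have [L1 L2 _] := HL.
by rewrite /has_decimals /= !big_ord_recl big_ord0 /=; apply/andP; split; lra.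
Qed.

Lemma decimals_re : has_decimals re1 0 [:: 0; 1; 8; 1; 5; 2; 4; 5; 0]%N.
Proof.
have [L1 L2 _] := HL.
have r1 : 18 / 1000 + 152 / 1000 ^+ 2 + 450 / 1000 ^+ 3 <= re1 by rewrite /re1; lra.
have r2 : re1 < 18 / 1000 + 152 / 1000 ^+ 2 + 451 / 1000 ^+ 3 by rewrite /re1; lra.
move: re1 r1 r2 => x r1 r2.
by apply: has_decimals_thousands; lra.
Qed.

Lemma decimals_im : has_decimals im1 0 [:: 0; 6; 4; 9; 5; 3; 4; 0; 9]%N.
Proof.
have /andP[] : 64 / 1000 + 953 / 1000 ^+ 2 + 409 / 1000 ^+ 3 <= im1 <
    64 / 1000 + 953 / 1000 ^+ 2 + 410 / 1000 ^+ 3.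
  by apply: sqrt_bounds im1_sqr_bounds; lra.
move: im1 => x h1 h2.
by apply: has_decimals_thousands; lra.
Qed.

Lemma decimals_modulus : has_decimals (Num.sqrt root_normsq) 0 [:: 0; 6; 7; 4; 4; 2; 2; 4; 8]%N.
Proof.
have /andP[c1 c2] := root_normsq_bounds.
have /andP[] : 67 / 1000 + 442 / 1000 ^+ 2 + 248 / 1000 ^+ 3 <= Num.sqrt root_normsq <
    67 / 1000 + 442 / 1000 ^+ 2 + 249 / 1000 ^+ 3.
  by apply: sqrt_bounds; [lra|lra|apply/andP; split; lra].
move: (Num.sqrt root_normsq) => x h1 h2.
by apply: has_decimals_thousands; lra.
Qed.

Lemma disc_gt0 : 0 < root_normsq - re1 ^+ 2.
Proof.
have /andP[h _] := im1_sqr_bounds; apply: lt_le_trans h; apply: exprn_gt0; lra.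
Qed.

Definition root1 : R[i] := Complex re1 im1.

Lemma normc_root1 : normc root1 = Num.sqrt root_normsq.
Proof. by rewrite /normc /root1 /im1 sqr_sqrtr ?(ltW disc_gt0)// addrC subrK. Qed.

Lemma normc_conj_root1 : normc (conjc root1) = normc root1.
Proof. by rewrite /normc /root1 /conjc sqrrN. Qed.

Lemma chi_quad : chi R = 4 *: (('X ^+ 2 - (2 * re1) *: 'X + root_normsq%:P) * ('X - L%:P)).
Proof.
apply: horner_inj => t.
rewrite /chi !(hornerZ, hornerM, hornerD, hornerN, hornerXn, horner_exp, hornerX, hornerC).
have h := L_root_normsq; have e := root_normsqE.
have -> : 2 * re1 = 55 - L by rewrite /re1; field.
transitivity (4 * (t ^+ 3 - 55 * t ^+ 2 + (root_normsq + (55 - L) * L) * t - L * root_normsq)); last by ring.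
by rewrite h e; field.
Qed.

Lemma chi_factor : map_poly (real_complex R) (chi R) =
  4 *: (('X - root1%:P) * ('X - (conjc root1)%:P) * ('X - (real_complex R L)%:P)).
Proof.
rewrite chi_quad map_polyZ; congr (_ *: _); first by rewrite /= rmorph_nat.
rewrite rmorphM/= map_polyXsubC; congr (_ * _).
rewrite rmorphD rmorphB/= rmorphXn/= map_polyX map_polyZ map_polyX map_polyC/=.
have e1 : real_complex R (2 * re1) = root1 + conjc root1.
  by apply/eqP; rewrite eq_complex /=; apply/andP; split; apply/eqP; ring.
have e2 : real_complex R root_normsq = root1 * conjc root1.
  apply/eqP; rewrite eq_complex /=; apply/andP; split; apply/eqP; last by ring.
  by rewrite mulrN opprK -!expr2 /im1 sqr_sqrtr ?(ltW disc_gt0)//; ring.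
rewrite e1 e2 polyCM -mul_polyC polyCD.
by ring.
Qed.

(** [poincare_dichotomy] with b = L - 55 and c the squared modulus. *)
Lemma rec_dichotomy u : satisfies_rec u -> [|| u 0%N != 0, u 1%N != 0 | u 2%N != 0] ->
  (`|u n| `^ n%:R^-1 @[n --> \oo] --> L) \/
  (limn_esup (fun n => (`|u n| `^ n%:R^-1)%:E) = (Num.sqrt root_normsq)%:E /\
   u @ \oo --> (0 : R)).
Proof.
move=> hu h0.
have nz := solution_nonzero hu h0.
have L1 : 54 <= L by have [L1 _ _] := HL; lra.
have [t0 t1 t2 _] := @rec_coef_top R.
have c0 := @rec_ratio_cvg 0 _ isT t0; have c1 := @rec_ratio_cvg 1 _ isT t1.
have c2 := @rec_ratio_cvg 2 _ isT t2.
have cq0 : 0 < root_normsq by rewrite invr_gt0 mulr_gt0// L_gt0.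
have sq1 : Num.sqrt root_normsq < 1.
  rewrite -[X in _ < X]sqrtr1 ltr_sqrt//; have /andP[_] := root_normsq_bounds; lra.
have D := disc_gt0; have E := root_normsqE; have F := L_root_normsq.
have rec n : u n.+3 = - (rec_at R 2 n.+2 / rec_at R 3 n.+2) * u n.+2 +
    - (rec_at R 1 n.+2 / rec_at R 3 n.+2) * u n.+1 +
    - (rec_at R 0 n.+2 / rec_at R 3 n.+2) * u n.
  have r3 := @rec_at3_neq0 n.+2 isT; apply: (mulfI r3).
  have := hu n.+2 isT => /= H; apply/eqP; rewrite -subr_eq0; apply/eqP; rewrite -[RHS]H.
  move: (rec_at R 3 n.+2) r3 => x x0.
  by field.
have sqL : Num.sqrt root_normsq < L by lra.
have dis : 0 < root_normsq - (L - 55) ^+ 2 / 4.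
  by have -> : (L - 55) ^+ 2 / 4 = re1 ^+ 2 by rewrite /re1; field.
have p2 : - (946 * - 220 / (946 * 4)) = L - (L - 55) by lra.
have p1 : - (946 * 8 / (946 * 4)) = (L - 55) * L - root_normsq.
  by rewrite E; transitivity (- 2 : R); [lra | ring].
have p0 : - (- 946 / (946 * 4)) = L * root_normsq by rewrite F; lra.
rewrite p2 in c2; rewrite p1 in c1; rewrite p0 in c0.
case: (@poincare_dichotomy R u _ _ _ L (L - 55) root_normsq cq0 sqL dis c2 c1 c0 rec nz) => [h|[h1 h2]].
  by left.
by right; split=> //; exact: h2.
Qed.

Lemma a_int n : a R n \is a Num.int.
Proof.
rewrite /a rpredM ?rpredX ?rpredN ?rpred1//; apply: rpred_sum => k _.
by rewrite !rpredM ?rpredX ?rpredN ?rpred1 ?rpredX ?rpred_nat.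
Qed.

Lemma a_init : [|| a R 0 != 0, a R 1 != 0 | a R 2 != 0].
Proof. by have [-> _] := @initial_data R; rewrite oner_eq0. Qed.

(** Integers tending to 0 are eventually 0, against [solution_nonzero]. *)
Lemma a_not_cvg0 : ~ (a R @ \oo --> (0 : R)).
Proof.
move=> ac; have [N _ HN] := proj1 (cvgrPdist_lt _ _) ac _ ltr01.
have z n : (N <= n)%N -> a R n = 0.
  move=> /HN; rewrite /= sub0r normrN => h; apply/eqP; apply/negPn/negP => a0.
  by have := norm_intr_ge1 (a_int n) a0; rewrite leNgt h.
have := solution_nonzero (@a_recurrence R) a_init N.
by rewrite !z ?eqxx// ?leqW.
Qed.

Lemma a_root : `|a R n| `^ n%:R^-1 @[n --> \oo] --> L.
Proof.
have [//|[_ ac]] := rec_dichotomy (@a_recurrence R) a_init.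
by have := a_not_cvg0 ac.
Qed.

(** The growth rate L, near 54.96, is incompatible with the bound 40. *)
Lemma small_solution u : satisfies_rec u -> u 0%N != 0 ->
  (forall n, `|u n| <= 4 * 40 ^+ n) ->
  limn_esup (fun n => (`|u n| `^ n%:R^-1)%:E) = (Num.sqrt root_normsq)%:E /\
  u @ \oo --> (0 : R).
Proof.
move=> hu u0 ub.
have nz : [|| u 0%N != 0, u 1%N != 0 | u 2%N != 0] by rewrite u0.
have [c|//] := rec_dichotomy hu nz.
exfalso; have [L1 L2 _] := HL.
have c40 : (4 * 40 ^+ n) `^ n%:R^-1 @[n --> \oo] --> (40 : R).
  apply: ratio_root => //.
    by apply: nearW => n; rewrite mulr_gt0// exprn_gt0.
  rewrite (_ : (fun n => _) = fun=> 40); first exact: cvg_cst.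
  apply/funext => n; have h : 40 ^+ n != 0 :> R by rewrite expf_neq0.
  by rewrite (exprS 40 n); move: (40 ^+ n) h => x h; field.
have L40 : L <= 40.
  apply: ler_cvg_to c c40 _; apply: nearW => n.
  by rewrite ge0_ler_powR ?invr_ge0 ?nnegrE// mulr_ge0// exprn_ge0.
lra.
Qed.

(** If a_n z - v_n were not dominant it would tend to 0, and so would a_n. *)
Lemma large_solution (v : nat -> R) z : 0 < z -> satisfies_rec v -> v @ \oo --> (0 : R) ->
  a R 1 * z - v 1%N != 0 ->
  `|a R n * z - v n| `^ n%:R^-1 @[n --> \oo] --> L.
Proof.
move=> z0 hv vc b1.
have hb := comb_recurrence z (@a_recurrence R) hv.
have hb0 : [|| a R 0 * z - v 0%N != 0, a R 1 * z - v 1%N != 0 | a R 2 * z - v 2%N != 0].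
  by apply/or3P; apply: Or32.
have [//|[_ bc]] := rec_dichotomy hb hb0.
exfalso; apply: a_not_cvg0.
have -> : a R = fun n => (a R n * z - v n + v n) * z^-1.
  by apply/funext => n; rewrite subrK mulfK// gt_eqF.
have E0 : (0 + 0) * z^-1 = 0 :> R by rewrite addr0 mul0r.
rewrite -[X in _ --> X]E0.
exact: cvgM (cvgD bc vc) (cvg_cst z^-1).
Qed.

End Root.
End Asymptotics.

Theorem theorem2 (R : realType) :
  (* the limits defining the two sequences of linear forms exist *)
  (forall n : nat,
      cvg (rt_reg n z @[z --> (1 : R)^'-]) /\
      cvg (rtt_reg n z @[z --> (1 : R)^'-])) /\
  (* the recurrence *)
  (satisfies_rec (rt R) /\ satisfies_rec (rtt R) /\
   satisfies_rec (a R) /\ satisfies_rec (bt R) /\ satisfies_rec (btt R)) /\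
  (* it is of order 3 *)
  (size (rec_coef R) = 4%N /\
   forall n : nat, (2 <= n)%N ->
     rec_at R 3 n != 0 /\ rec_at R 0 n != 0) /\
  (* the initial data *)
  (a R 0 = 1 /\ a R 1 = 7 /\ a R 2 = 163 /\
   bt R 0 = 0 /\ bt R 1 = 23 / 2 /\ bt R 2 = 2145 / 8 /\
   btt R 0 = 0 /\ btt R 1 = 17 / 2 /\ btt R 2 = 3135 / 16) /\
  (* the asymptotics, in terms of the zeros of the characteristic polynomial *)
  rec_charpoly (rec_coef R) = 946 *: chi R /\
  exists (l1 l2 : R[i]) (l3 : R),
    map_poly (real_complex R) (chi R) =
      4 *: (('X - l1%:P) * ('X - l2%:P) * ('X - (real_complex R l3)%:P)) /\
    l2 = conjc l1 /\
    has_decimals (complex.Re l1) 0 [:: 0; 1; 8; 1; 5; 2; 4; 5; 0]%N /\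
    has_decimals (complex.Im l1) 0 [:: 0; 6; 4; 9; 5; 3; 4; 0; 9]%N /\
    has_decimals l3 54 [:: 9; 6; 3; 6; 9; 5; 0; 9]%N /\
    has_decimals (normc l1) 0 [:: 0; 6; 7; 4; 4; 2; 2; 4; 8]%N /\
    normc l2 = normc l1 /\
    limn_esup (fun n : nat => (`|rt R n| `^ n%:R^-1)%:E) =
      (normc l1)%:E /\
    limn_esup (fun n : nat => (`|rtt R n| `^ n%:R^-1)%:E) =
      (normc l1)%:E /\
    (`|a R n| `^ n%:R^-1 @[n --> \oo] --> l3) /\
    (`|bt R n| `^ n%:R^-1 @[n --> \oo] --> l3) /\
    (`|btt R n| `^ n%:R^-1 @[n --> \oo] --> l3).
Proof.
have [rrt rrtt] := @rt_recurrence R.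
split; first exact: rt_cvg.
split.
  do !split=> //; [exact: a_recurrence | |].
  - exact: comb_recurrence (@a_recurrence R) rrt.
  - exact: comb_recurrence (@a_recurrence R) rrtt.
split.
  by split=> // n n2; split; [exact: rec_at3_neq0 | exact: rec_at0_neq0].
have I := @initial_data R.
split; first exact: I.
split; first exact: charpolyE.
have [L /andP[L1 L2] rL] := @chi_root R.
have HL := DominantRoot L1 L2 rL.
have [r0 s0] := rt_value (@regular_Rn0 R).
have z2 := @zeta_gt0 R 2 isT; have z3 := @zeta_gt0 R 3 isT.
have [limr cr] : limn_esup (fun n : nat => (`|rt R n| `^ n%:R^-1)%:E) = (Num.sqrt (root_normsq L))%:E /\
    rt R @ \oo --> (0 : R).
  apply: (small_solution HL rrt); first by rewrite r0 gt_eqF.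
  by move=> n; have [] := @rt_bound R n.
have [lims cs] : limn_esup (fun n : nat => (`|rtt R n| `^ n%:R^-1)%:E) = (Num.sqrt (root_normsq L))%:E /\
    rtt R @ \oo --> (0 : R).
  apply: (small_solution HL rrtt); first by rewrite s0 gt_eqF.
  by move=> n; have [] := @rt_bound R n.
case: I => _ [_ [_ [_ [b1 [_ [_ [bb1 _]]]]]]].
exists (root1 L), (conjc (root1 L)), L.
rewrite normc_conj_root1 normc_root1//.
split; first exact: chi_factor.
split; first by [].
split; first exact: decimals_re.
split; first exact: decimals_im.
split; first exact: decimals_L.
split; first exact: decimals_modulus.
do 3! (split; first by []).
split; first exact: (a_root HL).
split.
- apply: (large_solution HL z2 rrt cr).
  by rewrite (_ : _ - _ = bt R 1)// b1 mulf_neq0 ?invr_eq0 ?pnatr_eq0.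
- apply: (large_solution HL z3 rrtt cs).
  by rewrite (_ : _ - _ = btt R 1)// bb1 mulf_neq0 ?invr_eq0 ?pnatr_eq0.
Qed.
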